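(* Let $k\ge 2$ be an integer and $0\le\alpha\le 1$. Let $K\subset\mathbb{R}^n$ be a compact convex set whose interior contains the origin, such that $\partial K$ is $C^{k,\alpha}$ and its principal curvatures are positive at every point. Let $U\subset\mathbb{R}^n$ be a bounded open set with $C^{k,\alpha}$ boundary. Let $\varphi:\mathbb{R}^n\to\mathbb{R}$ be a $C^{k,\alpha}$ function with $\gamma^{\circ}(D\varphi)<1$ everywhere. Let $x\in U\setminus R_\rho$, and let $y$ be the unique $\rho$-closest point to $x$ on $\partial U$. Let $A$ be a symmetric positive semidefinite $n\times n$ matrix. Then $$\mathrm{tr}[A\,D^2\rho(x)]\le\mathrm{tr}[A\,D^2\rho(y)].$$ In particular $D^2_{\xi\xi}\rho(x)\le D^2_{\xi\xi}\rho(y)$ for every $\xi\in\mathbb{R}^n$.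
   Context: Gauge and polar: $\gamma(x):=\inf\{t>0: x\in tK\}$ is the gauge function of $K$; $K^{\circ}:=\{x:\langle x,z\rangle\le 1 \text{ for all } z\in K\}$ is the polar of $K$; $\gamma^{\circ}$ is the gauge function of $K^{\circ}$. Obstacle: $\rho(x):=\min_{z\in\partial U}[\gamma(x-z)+\varphi(z)]$, regarded as a function on $\overline U$. A point $z\in\partial U$ is called a $\rho$-closest point to $x$ on $\partial U$ if $\rho(x)=\gamma(x-z)+\varphi(z)$. The $\rho$-ridge $R_\rho$ is the set of all $x\in U$ such that $\rho$ is not $C^{1,1}$ in any neighborhood of $x$; under the stated assumptions, every point of $U\setminus R_\rho$ has a unique $\rho$-closest point on $\partial U$ and $\rho$ is $C^{2}$ near it. Under the stated assumptions $\rho$ is $C^{k,\alpha}$ on $\overline U\cap B_r(y)$ for some $r>0$ for every $y\in\partial U$; $D^2\rho(y)$ for $y\in\partial U$ denotes the Hessian of $\rho|_{\overline U}$ at $y$ (the limit of $D^2\rho$ from inside $U$). $D^2_{\xi\xi}\rho=\sum_{i,j}\xi_i\xi_jD^2_{ij}\rho$. *)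

(* Defs.v *)
(* Vectors of R^n are row vectors; the library is MathComp-Analysis. *)
From HB Require Import structures.
From mathcomp Require Import all_boot all_order all_algebra.
From mathcomp Require Import all_classical all_reals all_analysis.
Set Implicit Arguments.
Unset Strict Implicit.
Unset Printing Implicit Defensive.
Import Order.TTheory GRing.Theory Num.Theory.
Import numFieldNormedType.Exports.
Local Open Scope classical_set_scope.
Local Open Scope ring_scope.

Section Calculus.
Context {R : realType} {n : nat}.
Implicit Types (f : 'rV[R]_n -> R) (V : set 'rV[R]_n) (x y : 'rV[R]_n).

Definition partial (i : 'I_n) f x : R := 'D_(delta_mx 0 i) f x.

Definition grad f x : 'rV[R]_n := \row_i partial i f x.

Definition hessian f x : 'M[R]_n :=
  \matrix_(i, j) partial j (partial i f) x.

Definition hessian_closure (U : set 'rV[R]_n) f y : 'M[R]_n :=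
  lim (hessian f z @[z --> within U (nbhs y)]).

Definition quad_form (A : 'M[R]_n) (xi : 'rV[R]_n) : R :=
  \sum_i \sum_j xi 0 i * xi 0 j * A i j.

(* Hoelder continuity is local, so that for a = 0 it adds nothing to
   continuity (0 `^ 0 = 1).  The library norm on row vectors is the sup norm,
   which is equivalent to the Euclidean one. *)
Definition locally_holder (a : R) V f : Prop :=
  forall x, V x -> exists C : R,
    \forall u & v \near x, `|f u - f v| <= C * `|u - v| `^ a.

(* f is of class C^{k,a} on V, where V is meant to be open. *)
Fixpoint class_C (k : nat) (a : R) V f : Prop :=
  if k is k'.+1 then
    (forall x, V x -> differentiable f x) /\
    (forall i, class_C k' a V (partial i f))
  else
    (forall x, V x -> {for x, continuous f}) /\ locally_holder a V f.

End Calculus.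

Section Hypersurfaces.
Context {R : realType} {n : nat}.
Implicit Types (S : set 'rV[R]_n.+1) (y : 'rV[R]_n.+1).
Implicit Types (Q : 'M[R]_n.+1) (psi : 'rV[R]_n -> R).

Definition boundary S : set 'rV[R]_n.+1 := closure S `\` interior S.

(* In the coordinates (x - y) *m Q centred at y, with Q orthogonal, the
   interior of S is near y the part lying strictly above the graph of psi,
   and the boundary of S is that graph. *)
Definition graph_chart S y Q psi : Prop :=
  Q *m Q^T = 1%:M /\
  \forall x \near y,
    let z := (x - y) *m Q in
    let z' : 'rV[R]_n := col' ord_max z in
    (interior S x <-> psi z' < z 0 ord_max) /\
    (boundary S x <-> z 0 ord_max = psi z').

Definition class_C_boundary (k : nat) (a : R) S : Prop :=
  forall y, boundary S y ->
    exists Q psi, graph_chart S y Q psi /\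
      exists V : set 'rV[R]_n, open_nbhs (0 : 'rV[R]_n) V /\ class_C k a V psi.

(* The principal curvatures are the eigenvalues of the Hessian of psi in a
   chart whose last axis is the inner normal at y, so that they are
   nonnegative for convex sets. *)
Definition principal_curvature S y (c : R) : Prop :=
  exists Q psi, graph_chart S y Q psi /\
    (exists V : set 'rV[R]_n, open_nbhs (0 : 'rV[R]_n) V /\ class_C 2 0 V psi) /\
    grad psi 0 = 0 /\ eigenvalue (hessian psi 0) c.

End Hypersurfaces.

Section Obstacle.
Context {R : realType} {n : nat}.
Implicit Types (K U : set 'rV[R]_n.+1) (phi : 'rV[R]_n.+1 -> R).
Implicit Types (x y z : 'rV[R]_n.+1).

Definition gauge K x : R :=
  inf [set t : R | 0 < t /\ exists2 z, K z & x = t *: z].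

Definition polar K : set 'rV[R]_n.+1 :=
  [set x | forall z, K z -> \sum_i x 0 i * z 0 i <= 1].

(* The infimum is a minimum, because the boundary of a nonempty bounded open
   set is compact and nonempty. *)
Definition rho K U phi x : R :=
  inf [set gauge K (x - z) + phi z | z in boundary U].

Definition rho_closest K U phi x z : Prop :=
  boundary U z /\ rho K U phi x = gauge K (x - z) + phi z.

Definition rho_ridge K U phi : set 'rV[R]_n.+1 :=
  [set x | U x /\
    ~ exists V, open_nbhs x V /\ class_C 1 1 V (rho K U phi)].

End Obstacle.

(* Main.v *)
Require Import Defs.
From HB Require Import structures.
From mathcomp Require Import all_boot all_order all_algebra.
From mathcomp Require Import all_classical all_reals all_analysis.
From mathcomp Require Import ring lra.
(* Let y be the closest point to x and z = y + t (x - y) a point of the segment.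
   The triangle inequality rho (x + h) <= rho (z + h) + gamma (x - z), which is an
   equality for h = 0, says that the increments of rho at x are at most those at
   z.  Comparing second-order terms gives D^2 rho (x) <= D^2 rho (z), and t -> 0
   gives the claim, so what remains is the regularity of rho.

   The closest point z(x), the unit direction e(x) and the length s(x) of the ray
   solve z + s e = x, z in the boundary of U, D gamma (e) = D phi (z) + l N(z).
   They exist by compactness, so no implicit function theorem is needed: strict
   differentiability of the data turns this system into linear relations between
   differences, up to lower order terms.  Near the boundary (s -> 0) the linear
   system is invertible.  At a point outside the ridge, grad rho = D gamma (e) is
   Lipschitz, so the differences of z and e are O(h), which forces the linear
   system to be surjective, hence invertible.  In both cases e, and with it
   grad rho, is strictly differentiable. *)

Set Implicit Arguments.
Unset Strict Implicit.
Unset Printing Implicit Defensive.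
Import Order.TTheory GRing.Theory Num.Theory.
Import numFieldNormedType.Exports.
Local Open Scope classical_set_scope.
Local Open Scope ring_scope.

(** * Asymptotic comparison along a filter *)

(** Strict differentiability compares two free points near the base point, instead of one point with
    the base point. Two features of it shape the proof. The estimate makes sense along any filter,
    so one sensitivity analysis serves both [nbhs x] and [within U (nbhs y)]. And it already
    contains the continuity of the derivative ([sgrad_cvg]): strict differentiability of [grad rho]
    along [within U (nbhs y)] makes the Hessian converge there, so that the [lim] in
    [hessian_closure] is a genuine limit.

    The obstacle is a circularity: the linear relations between displacements carry error terms that
    contain the unknown displacements. These are absorbed ([big_absorb]), but for a ray of positive
    length this needs an a priori bound on the variation of the direction, which the class C^{1,1}
    off the ridge supplies.

    Curvature enters through a kernel: once the eigenvalue 0 is excluded in a chart, the Jacobian of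
    [grad (gauge K)] annihilates only radial vectors. A chart of class C^2 whose last axis is the
    inner normal has to be built for this, again from strict differentiability. *)

Section Dot.
Context {R : realType} {n : nat}.
Implicit Types (u v w : 'rV[R]_n) (a : R).

Definition dot u v : R := \sum_i u 0 i * v 0 i.

Lemma dotC u v : dot u v = dot v u.
Proof. by apply: eq_bigr => i _; rewrite mulrC. Qed.

Lemma dotDl u v w : dot (u + v) w = dot u w + dot v w.
Proof. by rewrite -big_split; apply: eq_bigr => i _; rewrite mxE mulrDl. Qed.

Lemma dotZl a u w : dot (a *: u) w = a * dot u w.
Proof. by rewrite mulr_sumr; apply: eq_bigr => i _; rewrite mxE mulrA. Qed.

Lemma dotNl u w : dot (- u) w = - dot u w.
Proof. by rewrite -scaleN1r dotZl mulN1r. Qed.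

Lemma dotBl u v w : dot (u - v) w = dot u w - dot v w.
Proof. by rewrite dotDl dotNl. Qed.

Lemma dotDr u v w : dot w (u + v) = dot w u + dot w v.
Proof. by rewrite !(dotC w) dotDl. Qed.

Lemma dotZr a u w : dot w (a *: u) = a * dot w u.
Proof. by rewrite !(dotC w) dotZl. Qed.

Lemma dotNr u w : dot w (- u) = - dot w u.
Proof. by rewrite !(dotC w) dotNl. Qed.

Lemma dotBr u v w : dot w (u - v) = dot w u - dot w v.
Proof. by rewrite dotDr dotNr. Qed.

Lemma dot0l w : dot 0 w = 0.
Proof. by rewrite -(scale0r w) dotZl mul0r. Qed.

Lemma dot0r w : dot w 0 = 0.
Proof. by rewrite dotC dot0l. Qed.

Lemma dot_mx u v : u *m v^T = (dot u v)%:M.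
Proof.
by apply/matrixP => i j; rewrite !ord1 !mxE mulr1n; apply: eq_bigr => k _; rewrite mxE.
Qed.

Lemma dot_gt0 u : u != 0 -> 0 < dot u u.
Proof.
move=> u0; rewrite lt_neqAle; apply/andP; split; last first.
  by apply: sumr_ge0 => i _; rewrite -expr2 sqr_ge0.
apply: contra u0; rewrite eq_sym psumr_eq0; last first.
  by move=> i _; rewrite -expr2 sqr_ge0.
move=> /allP u0; apply/eqP/rowP => i; rewrite mxE.
by have := u0 i (mem_index_enum _); rewrite -expr2 sqrf_eq0 => /eqP.
Qed.

Lemma dot_delta u i : dot (delta_mx 0 i) u = u 0 i.
Proof.
rewrite /dot (bigD1 i)//= big1 ?addr0 ?mxE ?eqxx ?mul1r// => j ji.
by rewrite mxE (negPf ji) andbF mul0r.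
Qed.




End Dot.

Section DotNorm.
Context {R : realType}.

Lemma dot_mulmx m n (u : 'rV[R]_m) (A : 'M[R]_(m, n)) v :
  dot (u *m A) v = dot u (v *m A^T).
Proof.
have := mulmxA u A v^T; have -> : A *m v^T = (v *m A^T)^T by rewrite trmx_mul trmxK.
rewrite !dot_mx => /(congr1 (fun M : 'M[R]_1 => M 0 0)).
by rewrite !mxE !mulr1n.
Qed.

Lemma mulmx_trr m n (u : 'rV[R]_m) (a : 'rV[R]_m) (b : 'rV[R]_n) :
  u *m (a^T *m b) = dot u a *: b.
Proof. by rewrite mulmxA dot_mx mul_scalar_mx. Qed.

Lemma coord_le_norm m n (x : 'M[R]_(m, n)) i j : `|x i j| <= `|x|.
Proof.
rewrite [leRHS]/Num.norm/= mx_normrE.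
by apply: (le_trans _ (le_bigmax _ _ (i, j))).
Qed.

Lemma norm_le_coord m n (x : 'M[R]_(m, n)) C : 0 <= C ->
  (forall i j, `|x i j| <= C) -> `|x| <= C.
Proof.
move=> C0 xC; rewrite [leLHS]/Num.norm/= mx_normrE.
by apply/bigmax_leP; split => // -[i j] _ /=.
Qed.

Lemma norm_dot n (u v : 'rV[R]_n) : `|dot u v| <= n%:R * `|u| * `|v|.
Proof.
apply: le_trans (ler_norm_sum _ _ _) _.
apply: (@le_trans _ _ (\sum_(i < n) `|u| * `|v|)).
  by apply: ler_sum => i _; rewrite normrM ler_pM// coord_le_norm.
by rewrite sumr_const card_ord -[leLHS]mulr_natl mulrA.
Qed.

Lemma norm_mulmx m n k (u : 'M[R]_(m, n)) (A : 'M[R]_(n, k)) :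
  `|u *m A| <= n%:R * `|A| * `|u|.
Proof.
apply: norm_le_coord => [|i j]; first by rewrite !mulr_ge0.
rewrite mxE; apply: le_trans (ler_norm_sum _ _ _) _.
apply: (@le_trans _ _ (\sum_(i < n) `|A| * `|u|)).
  by apply: ler_sum => l _; rewrite normrM mulrC ler_pM// coord_le_norm.
by rewrite sumr_const card_ord -[leLHS]mulr_natl mulrA.
Qed.

End DotNorm.

Section Small.
Context {R : realType} {T : Type} (F : set_system T) {FF : Filter F}.
Implicit Types (V W : normedModType R) (g h : T -> R).

(** Landau's o and, below it, O along an arbitrary filter. In most applications [T] is a type of
    pairs of points and the filter a product, so that both points approach the base point
    independently. *)
Definition small V (f : T -> V) g :=
  forall e, 0 < e -> \forall t \near F, `|f t| <= e * g t.

Definition big V (f : T -> V) g :=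
  exists2 C, 0 < C & \forall t \near F, `|f t| <= C * g t.

Lemma small_near V (f f' : T -> V) g :
  (\forall t \near F, f t = f' t) -> small f g -> small f' g.
Proof.
by move=> ff' fg e e0; near=> t; rewrite -(near ff' t)//; near: t; exact: fg.
Unshelve. all: by end_near. Qed.

Lemma smallD V (f f' : T -> V) g :
  small f g -> small f' g -> small (fun t => f t + f' t) g.
Proof.
move=> fg f'g e e0; near=> t.
rewrite (le_trans (ler_normD _ _))// (splitr e) mulrDl lerD//; near: t.
- by apply: fg; rewrite divr_gt0.
- by apply: f'g; rewrite divr_gt0.
Unshelve. all: by end_near. Qed.

Lemma smallN V (f : T -> V) g : small f g -> small (fun t => - f t) g.
Proof. by move=> fg e e0; near=> t; rewrite normrN; near: t; exact: fg.
Unshelve. all: by end_near. Qed.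

Lemma smallB V (f f' : T -> V) g :
  small f g -> small f' g -> small (fun t => f t - f' t) g.
Proof. by move=> fg f'g; apply: smallD => //; exact: smallN. Qed.

Lemma bigD V (f f' : T -> V) g :
  big f g -> big f' g -> big (fun t => f t + f' t) g.
Proof.
move=> [C C0 fC] [D D0 fD]; exists (C + D); first exact: addr_gt0.
near=> t; rewrite (le_trans (ler_normD _ _))// mulrDl lerD//; near: t => //.
Unshelve. all: by end_near. Qed.

Lemma bigN V (f : T -> V) g : big f g -> big (fun t => - f t) g.
Proof.
by move=> [C C0 fC]; exists C => //; near=> t; rewrite normrN; near: t.
Unshelve. all: by end_near. Qed.

Lemma bigB V (f f' : T -> V) g :
  big f g -> big f' g -> big (fun t => f t - f' t) g.
Proof. by move=> fg f'g; apply: bigD => //; exact: bigN. Qed.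

Lemma small_big V (f : T -> V) g : small f g -> big f g.
Proof. by move=> fg; exists 1 => //; exact: fg. Qed.

Lemma big_self V (f : T -> V) : big f (fun t => `|f t|).
Proof. by exists 1 => //; near=> t; rewrite mul1r.
Unshelve. all: by end_near. Qed.

Lemma small_trans V (f : T -> V) g h :
  small f g -> big g h -> small f h.
Proof.
move=> fg [C C0 gh] e e0.
have eC : 0 < e / C by rewrite divr_gt0.
near=> t; apply: (@le_trans _ _ (e / C * g t)); first by near: t; exact: fg.
rewrite -mulrA ler_pM2l// mulrC ler_pdivrMr// mulrC.
by rewrite (le_trans (ler_norm _))//; near: t.
Unshelve. all: by end_near. Qed.

Lemma big_trans V (f : T -> V) g h : big f g -> big g h -> big f h.
Proof.
move=> [D D0 fg] [C C0 gh]; exists (D * C); first exact: mulr_gt0.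
near=> t; apply: (@le_trans _ _ (D * g t)); first by near: t.
rewrite -mulrA ler_pM2l//.
by rewrite (le_trans (ler_norm _))//; near: t.
Unshelve. all: by end_near. Qed.

Lemma big_near V (f f' : T -> V) g :
  (\forall t \near F, f t = f' t) -> big f g -> big f' g.
Proof.
move=> ff' [C C0 fg]; exists C => //.
by near=> t; rewrite -(near ff' t)//; near: t.
Unshelve. all: by end_near. Qed.

Lemma small_mulmx m n k (f : T -> 'M[R]_(m, n)) (A : 'M[R]_(n, k)) g :
  small f g -> small (fun t => f t *m A) g.
Proof.
move=> fg e e0; set C := n%:R * `|A| + 1.
have C0 : 0 < C by rewrite ltr_wpDl// mulr_ge0.
near=> t; apply: le_trans (norm_mulmx _ _) _.
apply: (@le_trans _ _ (C * `|f t|)); first by rewrite ler_wpM2r// lerDl.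
rewrite -ler_pdivlMl// mulrA; near: t; apply: fg.
by rewrite mulr_gt0// invr_gt0.
Unshelve. all: by end_near. Qed.

Lemma big_mulmx m n k (f : T -> 'M[R]_(m, n)) (A : 'M[R]_(n, k)) g :
  big f g -> big (fun t => f t *m A) g.
Proof.
move=> [D D0 fg]; set C := n%:R * `|A| + 1.
have C0 : 0 < C by rewrite ltr_wpDl// mulr_ge0.
exists (C * D); first exact: mulr_gt0.
near=> t; apply: le_trans (norm_mulmx _ _) _.
apply: (@le_trans _ _ (C * `|f t|)); first by rewrite ler_wpM2r// lerDl.
by rewrite -mulrA ler_pM2l//; near: t.
Unshelve. all: by end_near. Qed.

Lemma small_scale V (c : T -> R) (f : T -> V) g :
  c @ F --> 0 -> big f g -> small (fun t => c t *: f t) g.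
Proof.
move=> c0 [C C0 fg] e e0.
have eC : 0 < e / C by rewrite divr_gt0.
move/cvgr0Pnorm_le : c0 => /(_ _ eC) c0.
near=> t; rewrite normrZ.
apply: (@le_trans _ _ (e / C * (C * g t))); last first.
  by rewrite mulrA divfK// gt_eqF.
by rewrite ler_pM//; near: t.
Unshelve. all: by end_near. Qed.

Lemma small_scaler V (c : T -> R) (f : T -> V) g :
  f @ F --> 0 -> big c g -> small (fun t => c t *: f t) g.
Proof.
move=> c0 [C C0 fg] e e0.
have eC : 0 < e / C by rewrite divr_gt0.
move/cvgr0Pnorm_le : c0 => /(_ _ eC) c0.
near=> t; rewrite normrZ mulrC.
apply: (@le_trans _ _ (e / C * (C * g t))); last first.
  by rewrite mulrA divfK// gt_eqF.
by rewrite ler_pM//; near: t.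
Unshelve. all: by end_near. Qed.

Lemma cvg_bounded V (f : T -> V) (l : V) : f @ F --> l ->
  exists2 C, 0 < C & \forall t \near F, `|f t| <= C.
Proof.
move=> fl; exists (`|l| + 1); first by rewrite ltr_wpDl.
move/cvgrPdist_le : fl => /(_ _ ltr01) fl.
near=> t; rewrite -[f t](subrK l) addrC (le_trans (ler_normD _ _))// lerD2l.
by rewrite distrC; near: t.
Unshelve. all: by end_near. Qed.

Lemma big_scale V (c : T -> R) (l : R) (f : T -> V) g :
  c @ F --> l -> big f g -> big (fun t => c t *: f t) g.
Proof.
move=> /cvg_bounded[D D0 cD] [C C0 fg]; exists (D * C); first exact: mulr_gt0.
near=> t; rewrite normrZ -mulrA.
by rewrite ler_pM//; near: t.
Unshelve. all: by end_near. Qed.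

Lemma big_scaler V (c : T -> R) (f : T -> V) (l : V) g :
  f @ F --> l -> big c g -> big (fun t => c t *: f t) g.
Proof.
move=> /cvg_bounded[D D0 cD] [C C0 fg]; exists (D * C); first exact: mulr_gt0.
near=> t; rewrite normrZ mulrC -mulrA.
by rewrite ler_pM//; near: t.
Unshelve. all: by end_near. Qed.

Lemma small_scalel V (c : R) (f : T -> V) g :
  small f g -> small (fun t => c *: f t) g.
Proof.
move=> fg e e0; have C0 : 0 < `|c| + 1 by rewrite ltr_wpDl.
near=> t; rewrite normrZ.
apply: (@le_trans _ _ ((`|c| + 1) * `|f t|)); first by rewrite ler_wpM2r// lerDl.
rewrite -ler_pdivlMl// mulrA; near: t; apply: fg.
by rewrite mulr_gt0// invr_gt0.
Unshelve. all: by end_near. Qed.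

Lemma small_scale_vec V (c : T -> R) (v : V) g :
  small c g -> small (fun t => c t *: v) g.
Proof.
move=> fg e e0; have C0 : 0 < `|v| + 1 by rewrite ltr_wpDl.
near=> t; rewrite normrZ mulrC.
apply: (@le_trans _ _ ((`|v| + 1) * `|c t|)); first by rewrite ler_wpM2r// lerDl.
rewrite -ler_pdivlMl// mulrA; near: t; apply: fg.
by rewrite mulr_gt0// invr_gt0.
Unshelve. all: by end_near. Qed.

Lemma small_dot n (f : T -> 'rV[R]_n) v g :
  small f g -> small (fun t => dot (f t) v) g.
Proof.
move=> fg e e0; set C := n%:R * `|v| + 1.
have C0 : 0 < C by rewrite ltr_wpDl// mulr_ge0.
near=> t; apply: le_trans (norm_dot _ _) _.
apply: (@le_trans _ _ (C * `|f t|)); first by rewrite mulrAC ler_wpM2r// lerDl.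
rewrite -ler_pdivlMl// mulrA; near: t; apply: fg.
by rewrite mulr_gt0// invr_gt0.
Unshelve. all: by end_near. Qed.

Lemma big_dot n (f : T -> 'rV[R]_n) v g :
  big f g -> big (fun t => dot (f t) v) g.
Proof.
move=> [D D0 fg]; set C := n%:R * `|v| + 1.
have C0 : 0 < C by rewrite ltr_wpDl// mulr_ge0.
exists (C * D); first exact: mulr_gt0.
near=> t; apply: le_trans (norm_dot _ _) _.
apply: (@le_trans _ _ (C * `|f t|)); first by rewrite mulrAC ler_wpM2r// lerDl.
by rewrite -mulrA ler_pM2l//; near: t.
Unshelve. all: by end_near. Qed.

(** With the small constant 1/2, half of [f] on the right is absorbed by the left side. This is how
    displacements are bounded from relations whose error terms involve these same displacements. *)
Lemma big_absorb V (f f1 : T -> V) g : (forall t, 0 <= g t) ->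
  small (fun t => f t - f1 t) (fun t => `|f t| + g t) -> big f1 g -> big f g.
Proof.
move=> g0 sm [C C0 f1g]; exists (2 * C + 1); first by rewrite addr_gt0// mulr_gt0.
have h0 : (0 : R) < 2^-1 by rewrite invr_gt0.
near=> t.
have h1 : `|f t - f1 t| <= 2^-1 * (`|f t| + g t) by near: t; exact: sm.
have h2 : `|f1 t| <= C * g t by near: t.
have h3 : `|f t| <= `|f t - f1 t| + `|f1 t|.
  by rewrite -{1}(subrK (f1 t) (f t)) ler_normD.
rewrite mulrDl mul1r.
have := g0 t; lra.
Unshelve. all: by end_near. Qed.

Lemma big_le V W (f : T -> V) (f' : T -> W) g :
  (forall t, `|f t| <= `|f' t|) -> big f' g -> big f g.
Proof.
move=> ff' [C C0 fg]; exists C => //; near=> t; rewrite (le_trans (ff' t))//.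
by near: t.
Unshelve. all: by end_near. Qed.

Lemma big_norm V (f : T -> V) g : big f g -> big (fun t => `|f t|) g.
Proof. by apply: big_le => t; rewrite normr_id. Qed.

Lemma big_addr V (f : T -> V) g h : (forall t, 0 <= h t) ->
  big f g -> (forall t, 0 <= g t) -> big f (fun t => g t + h t).
Proof.
move=> h0 [C C0 fg] g0; exists C => //; near=> t.
apply: (@le_trans _ _ (C * g t)); first by near: t.
by rewrite ler_pM2l// lerDl.
Unshelve. all: by end_near. Qed.

End Small.

Lemma small_comp {R : realType} {T U : Type} (F : set_system T) (G : set_system U)
    (V : normedModType R) (k : T -> U) (f : U -> V) g :
  k @ F --> G -> small G f g -> small F (f \o k) (g \o k).
Proof. by move=> kFG fg e /fg; exact: kFG. Qed.

(** * First-order analysis of the closest point *)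

Section Sensitivity.
Context {R : realType} {n : nat} {T : Type} (F : set_system T) {FF : Filter F}.
(* Read za = z(a), ea = e(a), ... for two points a, b near a base point, with
   h = a - b: z is the closest boundary point, e the unit direction and s the
   length of the ray from z, and p(e) = q(z) + l N(z) is the Lagrange multiplier
   rule.  Eliminating the multiplier gives e as a function of z to first order
   (sens_E); sens_P is the projection along e0 onto the tangent space. *)
Variables (h za zb ea eb pa pb qa qb Na Nb : T -> 'rV[R]_n).
Variables (sa sb la lb : T -> R).
Variables (e0 p0 N0 : 'rV[R]_n) (s0 l0 : R) (Hg Phi Nz S : 'M[R]_n).

Let dz t := za t - zb t.
Let de t := ea t - eb t.
Let dl t := la t - lb t.
Let ds t := sa t - sb t.

Hypothesis hz :
  \forall t \near F, za t + sa t *: ea t - (zb t + sb t *: eb t) = h t.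
Hypothesis hp : small F (fun t => pa t - pb t - de t *m Hg) (fun t => `|de t|).
Hypothesis hq : small F (fun t => qa t - qb t - dz t *m Phi) (fun t => `|dz t|).
Hypothesis hN : small F (fun t => Na t - Nb t - dz t *m Nz) (fun t => `|dz t|).
Hypothesis hN0 : small F (fun t => dot (dz t) N0) (fun t => `|dz t|).
Hypothesis hp0 : small F (fun t => dot (de t) p0) (fun t => `|de t|).
Hypothesis hpa : \forall t \near F, pa t = qa t + la t *: Na t.
Hypothesis hpb : \forall t \near F, pb t = qb t + lb t *: Nb t.
Hypothesis cv_eb : eb @ F --> e0.
Hypothesis cv_Nb : Nb @ F --> N0.
Hypothesis cv_la : la @ F --> l0.
Hypothesis cv_sa : sa @ F --> s0.
Hypothesis eN0 : dot e0 N0 != 0.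
Hypothesis ep0 : dot e0 p0 = 1.
Hypothesis Hge : Hg *m e0^T = 0.
Hypothesis hS : (Hg + p0^T *m p0) *m S = 1%:M.

Let c := dot e0 N0.

(** [sens_M] is the derivative of [q + l N] in [z] with the multiplier frozen at [l0]. In [sens_E]
    the middle factor subtracts the multiple of [N0] that makes the pairing with [e0] vanish, which
    accounts for the variation of the multiplier; then [S] inverts [Hg + p0^T *m p0]. The matrix
    [Hg] alone is singular, but [de . p0] is o(de), so the rank one term is harmless. [sens_L] comes
    from [dz + s0 de P = h P] on substituting [de = dz E] and [dz = dz P], all up to lower order. *)
Definition sens_M := Phi + l0 *: Nz.
Definition sens_E := sens_M *m (1%:M - c^-1 *: (e0^T *m N0)) *m S.
Definition sens_P := 1%:M - c^-1 *: (N0^T *m e0).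
Definition sens_L := 1%:M + s0 *: (sens_P *m sens_E *m sens_P).

Let gz t := `|dz t|.
Let g t := `|dz t| + `|de t|.

Let big_gz_g : big F gz g.
Proof.
apply: big_addr => //; exists 1 => //; near=> t; by rewrite mul1r normr_id.
Unshelve. all: by end_near. Qed.

Let big_ge_g : big F (fun t => `|de t|) g.
Proof.
have : big F (fun t => `|de t|) (fun t => `|de t| + `|dz t|).
  by apply: big_addr => //; exists 1 => //; near=> t; rewrite mul1r normr_id.
by case=> C C0 hC; exists C => //; near=> t; rewrite /g addrC; near: t.
Unshelve. all: by end_near. Qed.

Let cvg_dot_r (f : T -> 'rV[R]_n) l v : f @ F --> l ->
  (fun t => dot (f t) v) @ F --> dot l v.
Proof.
move=> fl; apply/cvgrPdist_le => e0' e0'0.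
have C0 : 0 < n%:R * `|v| + 1 by rewrite ltr_wpDl// mulr_ge0.
have eC : 0 < e0' / (n%:R * `|v| + 1) by rewrite divr_gt0.
move/cvgrPdist_le : fl => /(_ _ eC) fl; near=> t.
rewrite -dotBl (le_trans (norm_dot _ _))// mulrAC.
apply: (@le_trans _ _ ((n%:R * `|v| + 1) * `|l - f t|)).
  by rewrite ler_wpM2r// lerDl.
by rewrite mulrC -ler_pdivlMr//; near: t.
Unshelve. all: by end_near. Qed.

(** Difference of the multiplier rules at the two points. Writing
    [la Na - lb Nb = la (Na - Nb) + dl Nb] keeps the unknown [dl] exact, before any bound on it is
    available. *)
Lemma sens_multiplier : small F (fun t => de t *m Hg - dl t *: Nb t - dz t *m sens_M) g.
Proof.
pose f t := - (pa t - pb t - de t *m Hg) + (qa t - qb t - dz t *m Phi)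
  + la t *: (Na t - Nb t - dz t *m Nz) + (la t - l0) *: (dz t *m Nz).
apply: (@small_near _ _ _ _ _ f); rewrite /f.
  near=> t; rewrite (near hpa t)// (near hpb t)// /sens_M mulmxDr -scalemxAr.
  move: (de t *m Hg) (dz t *m Phi) (dz t *m Nz) => A B C.
  by apply/rowP => i; rewrite !mxE /dl; ring.
apply: smallD; [apply: smallD; [apply: smallD|]|].
- by apply: smallN; apply: small_trans hp big_ge_g.
- by apply: small_trans hq big_gz_g.
- pose proof (small_trans hN big_gz_g) as hN'.
  have k : small F (fun t => (la t - l0) *: (Na t - Nb t - dz t *m Nz)
            + l0 *: (Na t - Nb t - dz t *m Nz)) g.
    apply: smallD; last exact: small_scalel.
    apply: small_scale; last exact: small_big.
    by rewrite -(subrr l0); apply: cvgB => //; exact: cvg_cst.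
  by apply: small_near k; near=> t; rewrite -scalerDl subrK.
- apply: small_scale; first by rewrite -(subrr l0); apply: cvgB => //; exact: cvg_cst.
  apply: big_mulmx; apply: big_trans big_gz_g; exact: big_self.
Unshelve. all: by end_near. Qed.

Let dotHg v : dot (v *m Hg) e0 = 0.
Proof.
rewrite dot_mulmx; have -> : e0 *m Hg^T = (Hg *m e0^T)^T by rewrite trmx_mul trmxK.
by rewrite Hge trmx0 dot0r.
Qed.

Let big_dz_g : big F dz g.
Proof. by apply: big_trans big_gz_g; exact: big_self. Qed.

(** Pairing with [e0] kills the Hessian term, and the factor [Nb . e0] of [dl] tends to a nonzero
    limit. *)
Lemma sens_big_dl : big F dl g.
Proof.
have cN : (fun t => (dot (Nb t) e0)^-1) @ F --> c^-1.
  by apply: cvgV; [exact: eN0|rewrite /c dotC; exact: cvg_dot_r].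
have nz : \forall t \near F, dot (Nb t) e0 != 0.
  have : (fun t => dot (Nb t) e0) @ F --> c by rewrite /c dotC; exact: cvg_dot_r.
  by move=> /cvgr_neq0; apply; exact: eN0.
have h1 : big F (fun t => dot (de t *m Hg - dl t *: Nb t - dz t *m sens_M) e0
    + dot (dz t *m sens_M) e0) g.
  apply: bigD; first by apply: small_big; apply: small_dot; exact: sens_multiplier.
  by apply: big_dot; exact: big_mulmx.
apply: (big_near _ (bigN (big_scale cN h1))); near=> t.
have Nt : dot (Nb t) e0 != 0 by near: t.
rewrite /GRing.scale/= !dotBl dotHg dotZl; field.
exact: Nt.
Unshelve. all: by end_near. Qed.

(** Now that [dl] is bounded, [Nb] may be replaced by [N0]. Pairing with [e0] solves for [dl];
    substituting it back leaves [de Hg], and adding [(de . p0) p0], which is o(de), completes [Hg]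
    to the matrix inverted by [S]. *)
Lemma sens_de_g : small F (fun t => de t - dz t *m sens_E) g.
Proof.
have h1 : small F (fun t => de t *m Hg - dl t *: N0 - dz t *m sens_M) g.
  have h2 : small F (fun t => dl t *: (Nb t - N0)) g.
    apply: small_scaler; last exact: sens_big_dl.
    by rewrite -(subrr N0); apply: cvgB => //; exact: cvg_cst.
  apply: (small_near _ (smallD sens_multiplier h2)); near=> t.
  move: (de t *m Hg) (dz t *m sens_M) => A B.
  by apply/rowP => i; rewrite !mxE; ring.
have h2 : small F (fun t => dl t + c^-1 * dot (dz t *m sens_M) e0) g.
  apply: (small_near _ (smallN (small_scalel c^-1 (small_dot e0 h1)))); near=> t.
  rewrite /GRing.scale/= !dotBl dotHg dotZl (dotC N0) -/c; field.
  exact: eN0.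
have h3 : small F (fun t => de t *m Hg - dz t *m (sens_M *m (1%:M - c^-1 *: (e0^T *m N0)))) g.
  apply: (small_near _ (smallD h1 (small_scale_vec N0 h2))); near=> t.
  rewrite mulmxA mulmxBr mulmx1 -scalemxAr mulmx_trr.
  move: (de t *m Hg) (dz t *m sens_M) => A B.
  by apply/rowP => i; rewrite !mxE; ring.
pose proof (smallD h3 (small_scale_vec p0 (small_trans hp0 big_ge_g))) as h4.
apply: (small_near _ (small_mulmx S h4)); near=> t.
rewrite addrAC -(mulmx_trr (de t)) -mulmxDr mulmxBl -mulmxA hS mulmx1.
by rewrite /sens_E !mulmxA.
Unshelve. all: by end_near. Qed.

Lemma sens_big_de : big F de gz.
Proof.
apply: (@big_absorb _ _ _ _ _ _ (fun t => dz t *m sens_E)) => [t||].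
- exact: normr_ge0.
- apply: (small_trans sens_de_g); exists 1 => //; near=> t.
  by rewrite mul1r /g /gz ger0_norm ?addr_ge0// addrC.
- by apply: big_mulmx; exact: big_self.
Unshelve. all: by end_near. Qed.

Lemma sens_de : small F (fun t => de t - dz t *m sens_E) gz.
Proof.
apply: (small_trans sens_de_g); apply: bigD.
  by apply: big_norm; exact: big_self.
by apply: big_norm; exact: sens_big_de.
Qed.

Let e0P : e0 *m sens_P = 0.
Proof.
rewrite mulmxBr mulmx1 -scalemxAr mulmx_trr scalerA mulVf ?scale1r ?subrr//.
Qed.

Let g2 t := `|dz t| + `|h t|.

Let big_gz_g2 : big F gz g2.
Proof.
apply: big_addr => //; exists 1 => //; near=> t; by rewrite mul1r normr_id.
Unshelve. all: by end_near. Qed.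

Let big_h_g2 : big F h g2.
Proof.
exists 1 => //; near=> t; by rewrite mul1r lerDr.
Unshelve. all: by end_near. Qed.

(** The difference of the ray equations is [h = dz + sa de + ds eb]. Pairing with [p0], where
    [eb . p0] tends to 1, bounds [ds]; applying the projection then removes the term [ds eb],
    because [e0 P = 0]. *)
Lemma sens_main : small F (fun t => dz t + s0 *: (de t *m sens_P) - h t *m sens_P) g2.
Proof.
pose proof (big_trans sens_big_de big_gz_g2) as bde.
have bdz : big F dz g2 by apply: big_trans big_gz_g2; exact: big_self.
have hz' : \forall t \near F, h t = dz t + sa t *: de t + ds t *: eb t.
  near=> t; rewrite -(near hz t)//.
  by apply/rowP => i; rewrite !mxE /ds; ring.
have bds : big F ds g2.
  have ce : (fun t => (dot (eb t) p0)^-1) @ F --> (1 : R).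
    by rewrite -invr1; apply: cvgV; rewrite ?oner_eq0// -ep0; exact: cvg_dot_r.
  have nz : \forall t \near F, dot (eb t) p0 != 0.
    have : (fun t => dot (eb t) p0) @ F --> (1 : R) by rewrite -ep0; exact: cvg_dot_r.
    by move=> /cvgr_neq0; apply; rewrite oner_eq0.
  have h1 : big F (fun t => dot (h t - dz t - sa t *: de t) p0) g2.
    apply: big_dot; apply: bigB; first exact: bigB.
    by apply: big_scale; [exact: cv_sa|].
  apply: (big_near _ (big_scale ce h1)); near=> t.
  have et : dot (eb t) p0 != 0 by near: t.
  rewrite (near hz' t)// /GRing.scale/=; move: (dz t) (de t) => A B.
  rewrite !dotBl !dotDl !dotZl; field.
  exact: et.
have k1 : small F (fun t => c^-1 *: (dot (dz t) N0 *: e0)) g2.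
  by apply: small_scalel; apply: small_scale_vec; exact: small_trans hN0 big_gz_g2.
have k2 : small F (fun t => (sa t - s0) *: (de t *m sens_P)) g2.
  apply: small_scale; last exact: big_mulmx.
  by rewrite -(subrr s0); apply: cvgB => //; exact: cvg_cst.
have k3 : small F (fun t => (ds t *: (eb t - e0)) *m sens_P) g2.
  apply: small_mulmx; apply: small_scaler => //.
  by rewrite -(subrr e0); apply: cvgB => //; exact: cvg_cst.
apply: (small_near _ (smallB (smallB k1 k2) k3)); near=> t.
have Pz : dz t *m sens_P = dz t - c^-1 *: (dot (dz t) N0 *: e0).
  by rewrite mulmxBr mulmx1 -scalemxAr mulmx_trr.
rewrite (near hz' t)//; move: (dz t) (de t) (ds t) Pz => A B a Pz.
rewrite !mulmxDl -!scalemxAl mulmxBl e0P subr0 Pz.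
move: (B *m sens_P) (eb t *m sens_P) (dot A N0 *: e0) => C D E.
by apply/rowP => i; rewrite !mxE; ring.
Unshelve. all: by end_near. Qed.

Hypothesis big_h : s0 = 0 \/ big F de (fun t => `|h t|).

(** The term [s0 de P] of [sens_main] either vanishes or is O(h) by assumption, so only [dz] has to
    be absorbed. Without one of the two alternatives [de = O(dz)] would enter with a coefficient
    that is not small. *)
Lemma sens_big_dz : big F dz (fun t => `|h t|).
Proof.
case: big_h => [s00|hde].
  apply: (@big_absorb _ _ _ _ _ _ (fun t => h t *m sens_P)) => //.
    apply: (small_near _ (sens_main)); near=> t.
    by rewrite s00 scale0r addr0.
  by apply: big_mulmx; exact: big_self.
apply: (@big_absorb _ _ _ _ _ _ (fun t => h t *m sens_P - s0 *: (de t *m sens_P))) => //.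
  apply: (small_near _ (sens_main)); near=> t.
  by rewrite opprB addrA.
apply: bigB; first by apply: big_mulmx; exact: big_self.
by apply: big_scale; [exact: cvg_cst|exact: big_mulmx].
Unshelve. all: by end_near. Qed.

Let big_gz_h : big F gz (fun t => `|h t|).
Proof. exact: big_norm sens_big_dz. Qed.

Lemma sens_big_de_h : big F de (fun t => `|h t|).
Proof. by apply: (big_trans sens_big_de); exact: big_gz_h. Qed.

Lemma sens_dzL : small F (fun t => dz t *m sens_L - h t *m sens_P) (fun t => `|h t|).
Proof.
have k1 : small F (fun t => dz t + s0 *: (de t *m sens_P) - h t *m sens_P)
    (fun t => `|h t|).
  apply: (small_trans sens_main); apply: bigD; first exact: big_gz_h.
  by apply: big_norm; exact: big_self.
have k2 : small F (fun t => s0 *: ((de t - dz t *m sens_E) *m sens_P)) (fun t => `|h t|).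
  apply: small_scalel; apply: small_mulmx; apply: (small_trans sens_de).
  exact: big_gz_h.
have k3 : small F (fun t => s0 *: (c^-1 *: (dot (dz t) N0 *: e0) *m (sens_E *m sens_P)))
    (fun t => `|h t|).
  apply: small_scalel; apply: small_mulmx; apply: small_scalel.
  by apply: small_scale_vec; exact: small_trans hN0 big_gz_h.
apply: (small_near _ (smallB (smallB k1 k2) k3)); near=> t.
have -> : c^-1 *: (dot (dz t) N0 *: e0) = dz t - dz t *m sens_P.
  by rewrite /sens_P mulmxBr mulmx1 -scalemxAr mulmx_trr opprB addrC subrK.
rewrite /sens_L; move: sens_E sens_P (dz t) (de t) => E P A B.
rewrite mulmxDr mulmx1 -scalemxAr !mulmxBl !mulmxA.
move: (B *m P) (A *m E *m P) (h t *m P) (A *m P *m E *m P) => C D G K.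
by apply/rowP => i; rewrite !mxE; ring.
Unshelve. all: by end_near. Qed.

Lemma sens_e (B : 'M[R]_n) : sens_L *m B = 1%:M ->
  small F (fun t => de t - h t *m (sens_P *m B *m sens_E)) (fun t => `|h t|).
Proof.
move=> LB.
pose proof (small_trans sens_de big_gz_h) as k1.
pose proof (small_mulmx sens_E (small_mulmx B sens_dzL)) as k2.
apply: (small_near _ (smallD k1 k2)); near=> t.
move: sens_E sens_P sens_L LB (dz t) (de t) => E P L LB A B'.
by rewrite !mulmxBl -(mulmxA A L) LB mulmx1 !mulmxA addrA subrK.
Unshelve. all: by end_near. Qed.

Lemma sens_e0L : e0 *m sens_L = e0.
Proof. by rewrite mulmxDr mulmx1 -scalemxAr !mulmxA e0P !mul0mx scaler0 addr0. Qed.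

End Sensitivity.

(** * Strict differentiability *)

Lemma near_dist {R : realType} (V : normedModType R) (x : V) (e : R) : 0 < e ->
  \forall u \near x, `|x - u| < e.
Proof. by move=> e0; apply/nbhs_normP; exists e. Qed.

Lemma continuous_eps {R : realType} (V W : normedModType R) (f : V -> W) x :
  {for x, continuous f} <->
  forall e, 0 < e -> \forall z \near x, `|f x - f z| <= e.
Proof. exact: (@cvgrPdist_le R W V (nbhs x) _ f (f x)). Qed.

Section DotLinear.
Context {R : realType} {n : nat}.
Implicit Types (f : 'rV[R]_n -> R) (u v x N : 'rV[R]_n).

(** Named, with the fixed vector first, so that a linear structure can be attached to it and it can
    be identified with ['d f x]. *)
Definition dotr N v := dot v N.

Let dotr_linear N : linear_for *:%R (dotr N : 'rV[R]_n -> R^o).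
Proof. by move=> a u v; rewrite /dotr dotDl dotZl. Qed.

HB.instance Definition _ N :=
  GRing.isLinear.Build R 'rV[R]_n R^o *:%R (dotr N) (dotr_linear N).

Lemma dotr_continuous N : continuous (dotr N).
Proof.
move=> x; apply/(@cvgrPdist_le R R _ (nbhs (x : 'rV[R]_n))) => e e0.
have C0 : 0 < n%:R * `|N| + 1 by rewrite ltr_wpDl// mulr_ge0.
have := near_dist x (divr_gt0 e0 C0); apply: filterS => u xu.
rewrite /dotr -dotBl (le_trans (norm_dot _ _))// mulrAC.
apply: (@le_trans _ _ ((n%:R * `|N| + 1) * `|x - u|)).
  by rewrite ler_wpM2r// lerDl.
by rewrite mulrC -ler_pdivlMr// ltW.
Qed.

Lemma differentiable_dot f x N :
  (forall e, 0 < e -> \forall h \near (0 : 'rV[R]_n), `|f (h + x) - f x - dot h N| <= e * `|h|) ->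
  differentiable f x /\ 'd f x = dotr N :> ('rV[R]_n -> R).
Proof.
move=> fN.
have dE : 'd f x = dotr N :> ('rV[R]_n -> R).
  apply: diff_unique; first exact: dotr_continuous.
  apply/eqaddoP => e e0; near=> h.
  rewrite !fctE /= opprD addrA; near: h; exact: fN.
split => //; apply/diff_locallyP; rewrite dE; split; first exact: dotr_continuous.
apply/eqaddoP => e e0; near=> h.
rewrite !fctE /= opprD addrA; near: h; exact: fN.
Unshelve. all: by end_near. Qed.

Lemma diff_grad f x v : differentiable f x -> 'd f x v = dot v (grad f x).
Proof.
move=> fx; rewrite {1}(row_sum_delta v) linear_sum; apply: eq_bigr => i _.
by rewrite linearZ /grad mxE /partial deriveE.
Qed.

Lemma differentiable_dotP f x : differentiable f x ->
  forall e, 0 < e ->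
  \forall h \near (0 : 'rV[R]_n), `|f (h + x) - f x - dot h (grad f x)| <= e * `|h|.
Proof.
move=> fx e e0; have /diff_locally/eqaddoP/(_ _ e0) := fx.
apply: filterS => h; rewrite !fctE /= opprD addrA diff_grad//.
Qed.

Lemma mean_value f v w :
  (forall t : R, 0 <= t <= 1 -> differentiable f (v + t *: w)) ->
  exists2 t, 0 < t < 1 & f (v + w) - f v = dot w (grad f (v + t *: w)).
Proof.
move=> df; pose k (t : R) := v + t *: w.
have dg (t : R) : 0 <= t <= 1 ->
    is_derive t (1 : R) (f \o k) (dot w (grad f (k t))).
  move=> t01; have dfk := df _ t01.
  have E : (fun h : R => h^-1 *: (((f \o k) \o shift t) (h *: 1) - (f \o k) t))
      = (fun h : R => h^-1 *: ((f \o shift (k t)) (h *: w) - f (k t))).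
    apply/funext => h; congr (_ *: (f _ - _)).
    by rewrite /k /= [h *: 1]mulr1 scalerDl addrCA.
  apply: DeriveDef; first by rewrite /derivable E; exact: diff_derivable.
  by rewrite /derive E -/(derive _ _ _) deriveE// diff_grad.
have [||t t01] := @MVT R (f \o k) (fun t => dot w (grad f (k t))) 0 1 ltr01.
- by move=> t /[!in_itv]/= /andP[t0 t1]; apply: dg; rewrite !ltW.
- apply: continuous_in_subspaceT => t /[!inE]/= /[!in_itv]/= t01.
  apply: differentiable_continuous; have := dg _ t01.
  by move=> [/derivable1_diffP].
rewrite subr0 mulr1 /k /= scale1r scale0r addr0 => fE; exists t => //.
Qed.

End DotLinear.

Section Strict.
Context {R : realType}.

(** Strict differentiability with gradient [N]. For [F = nbhs x] it is stronger than
    differentiability at [x]; for a general [F] the limit point itself takes no part, as when a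
    boundary point is approached from inside. *)
Definition sgrad n (f : 'rV[R]_n -> R) (F : set_system 'rV[R]_n) N :=
  small (filter_prod F F) (fun t => f t.1 - f t.2 - dot (t.1 - t.2) N)
    (fun t => `|t.1 - t.2|).

Definition sdiff m n (f : 'rV[R]_m -> 'rV[R]_n) (F : set_system 'rV[R]_m) (J : 'M[R]_(m, n)) :=
  small (filter_prod F F) (fun t => f t.1 - f t.2 - (t.1 - t.2) *m J)
    (fun t => `|t.1 - t.2|).

Lemma sgradP n (f : 'rV[R]_n -> R) (x N : 'rV[R]_n) : sgrad f (nbhs x) N <->
  forall e, 0 < e -> exists2 r, 0 < r & forall u v, ball x r u -> ball x r v ->
    `|f u - f v - dot (u - v) N| <= e * `|u - v|.
Proof.
split=> [fN e /fN|fN e /fN].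
  move=> [[A B] /= [/nbhs_ballP[a /= a0 aA] /nbhs_ballP[b /= b0 bB]] AB].
  exists (Num.min a b); first by rewrite lt_min a0.
  move=> u v xu xv; apply: (AB (u, v)); split => /=.
    by apply: aA; apply: le_ball xu; rewrite ge_min lexx.
  by apply: bB; apply: le_ball xv; rewrite ge_min lexx orbT.
move=> [r r0 h]; exists (ball x r, ball x r); first by split; exact: nbhsx_ballx.
by move=> [u v] [/= xu xv]; exact: h.
Qed.

Lemma sgrad_differentiable n (f : 'rV[R]_n -> R) (x N : 'rV[R]_n) :
  sgrad f (nbhs x) N -> differentiable f x /\ grad f x = N.
Proof.
move=> /sgradP fN.
have [df dE] : differentiable f x /\ 'd f x = dotr N :> ('rV[R]_n -> R).
  apply: differentiable_dot => e /fN[r r0 h]; near=> k.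
  have -> : dot k N = dot (k + x - x) N by rewrite addrK.
  rewrite -{3}(addrK x k); apply: h; last exact: ballxx.
  rewrite -ball_normE /= opprD addrC subrK normrN; near: k.
  by have := near_dist (0 : 'rV[R]_n) r0; apply: filterS => y; rewrite sub0r normrN.
split=> //; apply/rowP => i; rewrite mxE /partial deriveE// dE /dotr.
by rewrite dot_delta.
Unshelve. all: by end_near. Qed.

Lemma sgrad_continuous n (f : 'rV[R]_n -> R) (x N : 'rV[R]_n) :
  sgrad f (nbhs x) N -> {for x, continuous f}.
Proof. by move=> /sgrad_differentiable[/differentiable_continuous]. Qed.

Lemma C1_sgrad n (f : 'rV[R]_n -> R) x :
  (\forall z \near x, differentiable f z) ->
  (forall i, {for x, continuous (partial i f)}) ->
  sgrad f (nbhs x) (grad f x).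
Proof.
move=> df cf; apply/sgradP => e e0.
(* In the sup norm a dot product costs a factor [n]; dividing by [n.+1] also covers [n = 0]. *)
pose e' := e / n.+1%:R.
have e'0 : 0 < e' by rewrite divr_gt0.
have : \forall z \near x, differentiable f z /\ forall i, `|partial i f z - partial i f x| <= e'.
  near=> z; split; first by near: z.
  near: z; apply: filter_forall => i.
  have /cvgrPdist_le/(_ _ e'0) := cf i.
  by apply: filterS => z; rewrite distrC.
move=> /nbhs_ballP[r /= r0 xr]; exists r => // u v xu xv.
have seg t : 0 <= t <= 1 -> ball x r (v + t *: (u - v)).
  move=> /andP[t0 t1]; move: xu xv; rewrite -!ball_normE /= => xu xv.
  have -> : x - (v + t *: (u - v)) = t *: (x - u) + (1 - t) *: (x - v).
    by apply/rowP => i; rewrite !mxE; ring.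
  apply: le_lt_trans (ler_normD _ _) _; rewrite !normrZ !ger0_norm ?subr_ge0//.
  have [->|tn0] := eqVneq t 0; first by rewrite mul0r add0r subr0 mul1r.
  have tp : 0 < t by rewrite lt_neqAle eq_sym tn0.
  have : t * `|x - u| < t * r by rewrite ltr_pM2l.
  have : (1 - t) * `|x - v| <= (1 - t) * r by rewrite ler_wpM2l ?subr_ge0// ltW.
  lra.
have [t t01] := mean_value (fun t t01 => (xr _ (seg t t01)).1).
rewrite [v + (u - v)]addrC subrK => ->; rewrite -dotBr.
have t01' : 0 <= t <= 1 by case/andP: t01 => t0 t1; rewrite !ltW.
have [_ gx] := xr _ (seg t t01').
apply: le_trans (norm_dot _ _) _.
apply: (@le_trans _ _ (n%:R * `|u - v| * e')).
  rewrite ler_wpM2l ?mulr_ge0//; apply: norm_le_coord => [|i j]; first exact: ltW.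
  by rewrite !mxE.
rewrite /e' mulrC mulrA ler_wpM2r// -mulrA ler_piMr ?(ltW e0)//.
by rewrite mulrC ler_pdivrMr// mul1r ler_nat.
Unshelve. all: by end_near. Qed.

Lemma sdiff_coord m n (f : 'rV[R]_m -> 'rV[R]_n) (F : set_system 'rV[R]_m)
    (J : 'M[R]_(m, n)) {FF : Filter F} :
  (forall j, sgrad (fun x => f x 0 j) F (\row_i J i j)) -> sdiff f F J.
Proof.
move=> fJ e e0.
have : \forall t \near filter_prod F F, forall j,
   `|f t.1 0 j - f t.2 0 j - dot (t.1 - t.2) (\row_i J i j)| <= e * `|t.1 - t.2|.
  by apply: filter_forall => j; exact: fJ.
apply: filterS => t ft; apply: norm_le_coord => [|i j].
  by rewrite mulr_ge0// ltW.
rewrite ord1 !mxE (_ : \sum_(k < m) _ = dot (t.1 - t.2) (\row_i J i j))//.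
by apply: eq_bigr => k _; rewrite !mxE.
Qed.

Lemma coord_sdiff m n (f : 'rV[R]_m -> 'rV[R]_n) (F : set_system 'rV[R]_m)
    (J : 'M[R]_(m, n)) j {FF : Filter F} :
  sdiff f F J -> sgrad (fun x => f x 0 j) F (\row_i J i j).
Proof.
move=> fJ e /fJ; apply: filterS => t; apply: le_trans.
apply: le_trans (coord_le_norm _ 0 j).
rewrite !mxE (_ : \sum_(k < m) _ = dot (t.1 - t.2) (\row_i J i j))//.
by apply: eq_bigr => k _; rewrite !mxE.
Qed.

Lemma sdiff_continuous m n (f : 'rV[R]_m -> 'rV[R]_n) (x : 'rV[R]_m) (J : 'M[R]_(m, n)) :
  sdiff f (nbhs x) J -> {for x, continuous f}.
Proof.
move=> fJ; apply/continuous_eps => e e0.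
have : \forall z \near x, forall j, `|f x 0 j - f z 0 j| <= e.
  apply: (@filter_forall _ _ (fun j z => `|f x 0 j - f z 0 j| <= e) (nbhs x)) => j.
  have cj : {for x, continuous (fun x => f x 0 j)}.
    exact: sgrad_continuous (coord_sdiff j fJ).
  by move/continuous_eps : cj; exact.
apply: filterS => z xz; apply: norm_le_coord => [|i j]; first exact: ltW.
by rewrite ord1 !mxE.
Qed.

End Strict.

(** * Calculus rules for strict derivatives along a filter *)

Section StrictCalculus.
Context {R : realType} {m : nat} (F : set_system 'rV[R]_m) {FF : Filter F}.

Let FF2 := filter_prod F F.
Let d (t : 'rV[R]_m * 'rV[R]_m) := `|t.1 - t.2|.

Lemma pair_cvg (T : topologicalType) (f : 'rV[R]_m -> T) (y : T) : f @ F --> y ->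
  (fun t => (f t.1, f t.2)) @ FF2 --> filter_prod (nbhs y) (nbhs y).
Proof.
by move=> fy; apply: cvg_pair; apply: cvg_comp fy; [exact: cvg_fst|exact: cvg_snd].
Qed.

Lemma fst_cvg (T : topologicalType) (f : 'rV[R]_m -> T) (y : T) : f @ F --> y ->
  (fun t => f t.1) @ FF2 --> y.
Proof. by move=> fy; apply: cvg_comp fy; exact: cvg_fst. Qed.

Lemma snd_cvg (T : topologicalType) (f : 'rV[R]_m -> T) (y : T) : f @ F --> y ->
  (fun t => f t.2) @ FF2 --> y.
Proof. by move=> fy; apply: cvg_comp fy; exact: cvg_snd. Qed.

Lemma sdiff_big n (f : 'rV[R]_m -> 'rV[R]_n) (J : 'M[R]_(m, n)) : sdiff f F J ->
  big FF2 (fun t => f t.1 - f t.2) d.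
Proof.
move=> fJ.
have bJ : big FF2 (fun t => (t.1 - t.2) *m J) d by apply: big_mulmx; exact: big_self.
apply: (big_near _ (bigD (small_big fJ) bJ)); near=> t; exact: subrK.
Unshelve. all: by end_near. Qed.

Lemma sgrad_big (f : 'rV[R]_m -> R) N : sgrad f F N ->
  big FF2 (fun t => f t.1 - f t.2) d.
Proof.
move=> fN.
have bJ : big FF2 (fun t => dot (t.1 - t.2) N) d by apply: big_dot; exact: big_self.
apply: (big_near _ (bigD (small_big fN) bJ)); near=> t; exact: subrK.
Unshelve. all: by end_near. Qed.

Lemma sdiff_near n (f g : 'rV[R]_m -> 'rV[R]_n) (J : 'M[R]_(m, n)) :
  (\forall x \near F, f x = g x) -> sdiff f F J -> sdiff g F J.
Proof.
move=> fg; apply: small_near; exists ((fun x => f x = g x), (fun x => f x = g x)) => //.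
by move=> [x y] [/= -> ->].
Qed.

Lemma sgrad_near (f g : 'rV[R]_m -> R) N :
  (\forall x \near F, f x = g x) -> sgrad f F N -> sgrad g F N.
Proof.
move=> fg; apply: small_near; exists ((fun x => f x = g x), (fun x => f x = g x)) => //.
by move=> [x y] [/= -> ->].
Qed.

Lemma sdiff_comp n k (f : 'rV[R]_m -> 'rV[R]_n) (g : 'rV[R]_n -> 'rV[R]_k)
    (y : 'rV[R]_n) (J : 'M[R]_(m, n)) J' :
  f @ F --> y -> sdiff f F J -> sdiff g (nbhs y) J' ->
  sdiff (g \o f) F (J *m J').
Proof.
move=> fy fJ gJ'; pose proof (small_comp (pair_cvg fy) gJ') as k1.
pose proof (small_trans k1 (big_norm (sdiff_big fJ))) as k2.
apply: (small_near _ (smallD k2 (small_mulmx J' fJ))); near=> t.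
rewrite /= mulmxA; move: (f t.1 - f t.2) (_ *m J) => A B.
by rewrite mulmxBl addrA subrK.
Unshelve. all: by end_near. Qed.

Lemma sgrad_comp n (f : 'rV[R]_m -> 'rV[R]_n) (g : 'rV[R]_n -> R)
    (y : 'rV[R]_n) (J : 'M[R]_(m, n)) N :
  f @ F --> y -> sdiff f F J -> sgrad g (nbhs y) N ->
  sgrad (g \o f) F (N *m J^T).
Proof.
move=> fy fJ gN; pose proof (small_comp (pair_cvg fy) gN) as k1.
pose proof (small_trans k1 (big_norm (sdiff_big fJ))) as k2.
apply: (small_near _ (smallD k2 (small_dot N fJ))); near=> t.
rewrite /= -dot_mulmx; move: (f t.1 - f t.2) (_ *m J) => A B.
by rewrite dotBl addrA subrK.
Unshelve. all: by end_near. Qed.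

Lemma sgrad_dotl n (f : 'rV[R]_m -> 'rV[R]_n) (J : 'M[R]_(m, n)) v :
  sdiff f F J -> sgrad (fun x => dot (f x) v) F (v *m J^T).
Proof.
move=> fJ; apply: (small_near _ (small_dot v fJ)); near=> t.
rewrite -dot_mulmx dotBl; congr (_ - _); exact: dotBl.
Unshelve. all: by end_near. Qed.

Lemma sgradV (f : 'rV[R]_m -> R) (f0 : R) N : f0 != 0 ->
  f @ F --> f0 -> sgrad f F N -> sgrad (fun x => (f x)^-1) F (- (f0 ^- 2) *: N).
Proof.
move=> f00 ff fN.
have nz : \forall t \near FF2, f t.1 != 0 /\ f t.2 != 0.
  have /cvgr_neq0/(_ f00) f1 := fst_cvg ff; have /cvgr_neq0/(_ f00) f2 := snd_cvg ff.
  by near=> t; split; near: t.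
have iv : (fun t => - ((f t.1)^-1 * (f t.2)^-1) + f0 ^- 2) @ FF2 --> (0 : R).
  rewrite -(addNr (f0 ^- 2)) expr2 invfM; apply: cvgD; last exact: cvg_cst.
  by apply: cvgN; apply: cvgM; apply: cvgV => //; [exact: fst_cvg|exact: snd_cvg].
pose proof (small_scale iv (sgrad_big fN)) as k1.
apply: (small_near _ (smallD k1 (small_scalel (- (f0 ^- 2)) fN))); near=> t.
have [t1 t2] : f t.1 != 0 /\ f t.2 != 0 by near: t.
rewrite /GRing.scale/= dotZr; field.
by rewrite t1 t2 f00.
Unshelve. all: by end_near. Qed.

Lemma sdiff_scale n (c : 'rV[R]_m -> R) (f : 'rV[R]_m -> 'rV[R]_n)
    (c0 : R) (f0 : 'rV[R]_n) N
    (J : 'M[R]_(m, n)) :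
  c @ F --> c0 -> f @ F --> f0 -> sgrad c F N -> sdiff f F J ->
  sdiff (fun x => c x *: f x) F (c0 *: J + N^T *m f0).
Proof.
move=> cc ff cN fJ.
have k1 : small FF2 (fun t => (c t.1 - c0) *: (f t.1 - f t.2)) d.
  apply: small_scale; last exact: sdiff_big fJ.
  by rewrite -(subrr c0); apply: cvgB; [exact: fst_cvg|exact: cvg_cst].
have k2 : small FF2 (fun t => (c t.1 - c t.2) *: (f t.2 - f0)) d.
  apply: small_scaler; last exact: sgrad_big cN.
  by rewrite -(subrr f0); apply: cvgB; [exact: snd_cvg|exact: cvg_cst].
apply: (small_near _ (smallD (smallD k1 k2)
  (smallD (small_scalel c0 fJ) (small_scale_vec f0 cN)))); near=> t.
rewrite mulmxDr mulmx_trr -scalemxAr.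
move: (_ *m J) (dot _ _) => A a.
by apply/rowP => i; rewrite !mxE; ring.
Unshelve. all: by end_near. Qed.

Lemma sgrad_dot n (f g : 'rV[R]_m -> 'rV[R]_n) (f0 g0 : 'rV[R]_n)
    (Jf Jg : 'M[R]_(m, n)) :
  f @ F --> f0 -> g @ F --> g0 -> sdiff f F Jf -> sdiff g F Jg ->
  sgrad (fun x => dot (f x) (g x)) F (g0 *m Jf^T + f0 *m Jg^T).
Proof.
move=> ff gg fJ gJ.
have dsmall (a b : 'rV[R]_m * 'rV[R]_m -> 'rV[R]_n) :
    a @ FF2 --> (0 : 'rV[R]_n) -> big FF2 b d -> small FF2 (fun t => dot (a t) (b t)) d.
  move=> a0 [C C0 bC] e e0; have C1 : 0 < n.+1%:R * C by rewrite mulr_gt0.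
  move/cvgr0Pnorm_le : a0 => /(_ _ (divr_gt0 e0 C1)) a0; near=> t.
  have h1 : `|a t| <= e / (n.+1%:R * C) by near: t.
  have h2 : `|b t| <= C * d t by near: t.
  apply: le_trans (norm_dot _ _) _.
  apply: (@le_trans _ _ (n.+1%:R * (e / (n.+1%:R * C)) * (C * d t))).
    by rewrite ler_pM// ?mulr_ge0// ler_pM// ler_nat.
  rewrite le_eqVlt; apply/orP; left; apply/eqP; field.
  by rewrite (gt_eqF C0)/= nat1r pnatr_eq0.
have k1 : small FF2 (fun t => dot (g t.2 - g0) (f t.1 - f t.2)) d.
  apply: dsmall; last exact: sdiff_big fJ.
  by rewrite -(subrr g0); apply: cvgB; [exact: snd_cvg|exact: cvg_cst].
have k2 : small FF2 (fun t => dot (f t.1 - f0) (g t.1 - g t.2)) d.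
  apply: dsmall; last exact: sdiff_big gJ.
  by rewrite -(subrr f0); apply: cvgB; [exact: fst_cvg|exact: cvg_cst].
apply: (small_near _ (smallD (smallD k1 k2)
  (smallD (small_dot g0 fJ) (small_dot f0 gJ)))); near=> t.
rewrite [dot _ (_ *m _ + _)]dotDr -!dot_mulmx; move: (_ *m Jf) (_ *m Jg) => A B.
rewrite !dotBl !dotBr !(dotC _ (f t.1)) !(dotC _ (f t.2)) !(dotC _ f0) !(dotC _ g0).
by rewrite !(dotC g0); ring.
Unshelve. all: by end_near. Qed.

Lemma sdiff_affine n (A : 'M[R]_(m, n)) b : sdiff (fun x => x *m A + b) F A.
Proof.
by move=> e e0; near=> t; rewrite opprD addrACA subrr addr0 -mulmxBl subrr normr0 mulr_ge0// ltW.
Unshelve. all: by end_near. Qed.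

Lemma sdiffD n (f g : 'rV[R]_m -> 'rV[R]_n) (J J' : 'M[R]_(m, n)) :
  sdiff f F J -> sdiff g F J' -> sdiff (fun x => f x + g x) F (J + J').
Proof.
move=> fJ gJ; apply: (small_near _ (smallD fJ gJ)); near=> t.
rewrite mulmxDr; move: (_ *m J) (_ *m J') => A B.
by apply/rowP => i; rewrite !mxE; ring.
Unshelve. all: by end_near. Qed.

Lemma sgradD (f g : 'rV[R]_m -> R) N N' :
  sgrad f F N -> sgrad g F N' -> sgrad (fun x => f x + g x) F (N + N').
Proof.
move=> fJ gJ; apply: (small_near _ (smallD fJ gJ)); near=> t.
by rewrite dotDr; ring.
Unshelve. all: by end_near. Qed.

Lemma sgradN (f : 'rV[R]_m -> R) N : sgrad f F N -> sgrad (fun x => - f x) F (- N).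
Proof.
move=> fJ; apply: (small_near _ (smallN fJ)); near=> t.
by rewrite dotNr; ring.
Unshelve. all: by end_near. Qed.

(** For [x] deep enough in [F] and a short vector [v], both the estimate along [F] and the one at
    [x] apply to the pair [x + v], [x]; hence the two gradients differ by at most [e] in each
    coordinate direction. The condition that [F] contains the interiors of its sets provides the
    room around [x]. *)
Lemma sgrad_cvg (f : 'rV[R]_m -> R) N (N' : 'rV[R]_m -> 'rV[R]_m) :
  (forall P, F P -> F P°) -> sgrad f F N ->
  (\forall x \near F, sgrad f (nbhs x) (N' x)) -> N' @ F --> N.
Proof.
move=> FI fN fN'; apply/cvgrPdist_le => e e0.
have e20 : 0 < e / 2 by rewrite divr_gt0.
have [[A B] /= [FA FB] AB] := fN _ e20.
have FC : F (A `&` B)° by apply: FI; exact: filterI.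
near=> x.
have xC : (A `&` B)° x by near: x.
have /sgradP/(_ _ e20)[r r0 h] : sgrad f (nbhs x) (N' x) by near: x.
have [s /= s0 sC] : exists2 s, 0 < s & ball x s `<=` A `&` B.
  by move: xC => /nbhs_ballP[s s0 sC]; exists s.
apply: norm_le_coord => [|i j]; first exact: ltW.
rewrite ord1 -(dot_delta (N - N' x)) {i}.
pose a := Num.min r s / 2; have a0 : 0 < a by rewrite divr_gt0// lt_min r0.
have ars : a < Num.min r s by rewrite ltr_pdivrMr// ltr_pMr ?lt_min ?r0// ltr1n.
have [ar as_] : a < r /\ a < s by move: ars; rewrite lt_min => /andP.
pose v : 'rV[R]_m := a *: delta_mx 0 j.
have nv : `|v| <= a.
  apply: norm_le_coord => [|i k]; first exact: ltW.
  rewrite ord1 !mxE eqxx/=; case: eqP => _; rewrite ?mulr1 ?mulr0 ?normr0 ?(ltW a0)//.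
  by rewrite ger0_norm// ltW.
have xv q : a < q -> ball x q (x + v).
  by move=> aq; rewrite -ball_normE /= opprD addrA subrr add0r normrN (le_lt_trans nv).
have h1 := AB (x + v, x) _; have h2 := h (x + v) x (xv _ ar) (ballxx _ r0).
have {h1} h1 : `|f (x + v) - f x - dot (x + v - x) N| <= e / 2 * `|x + v - x|.
  apply: h1; split; first exact: (sC _ (xv _ as_)).1.
  exact: (sC _ (ballxx _ s0)).2.
have xvE : x + v - x = v by rewrite addrC addKr.
rewrite !xvE in h1 h2.
have : `|dot v (N - N' x)| <= e * a.
  have -> : dot v (N - N' x) = (f (x + v) - f x - dot v (N' x)) - (f (x + v) - f x - dot v N).
    by rewrite dotBr; ring.
  rewrite (le_trans (ler_normB _ _))//.
  apply: (@le_trans _ _ (e / 2 * `|v| + e / 2 * `|v|)); first exact: lerD.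
  by rewrite -mulrDl -splitr ler_pM2l.
by rewrite dotZl normrM (gtr0_norm a0) mulrC ler_pM2r.
Unshelve. all: by end_near. Qed.

End StrictCalculus.

(** * The gauge of a convex body *)

Section Gauge.
Context {R : realType} {n : nat}.
Variable K : set 'rV[R]_n.+1.
Hypothesis Kcompact : compact K.
Hypothesis Kconvex : convex_set (K : set (convex_lmodType 'rV[R]_n.+1)).
Hypothesis K0 : interior K 0.
Implicit Types (x y z : 'rV[R]_n.+1) (t c : R).

Let Kconv z w t : K z -> K w -> 0 <= t <= 1 -> K (t *: z + (1 - t) *: w).
Proof.
move=> Kz Kw /andP[t0 t1].
by have := Kconvex (Itv01 t0 t1) (mem_set Kz) (mem_set Kw); rewrite inE.
Qed.

Let Kball : exists2 r : R, 0 < r & forall z, `|z| < r -> K z.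
Proof.
move: K0 => /nbhs_ballP[r /= r0 rK]; exists r => // z zr; apply: rK.
by rewrite -ball_normE /= sub0r normrN.
Qed.

Let Kbounded : exists2 M : R, 0 < M & forall z, K z -> `|z| <= M.
Proof.
have /pinfty_ex_gt0[M M0 KM] := compact_bounded Kcompact.
by exists M => // z Kz; exact: KM.
Qed.

Let K00 : K 0. Proof. exact: (nbhs_singleton K0). Qed.

Let S x := [set t : R | 0 < t /\ exists2 z, K z & x = t *: z].

Let S_up x t t' : S x t -> t <= t' -> S x t'.
Proof.
move=> [t0 [z Kz ->]] tt'; have t'0 : 0 < t' by exact: lt_le_trans tt'.
split=> //; exists ((t / t') *: z + (1 - t / t') *: 0).
  by apply: Kconv => //; rewrite (divr_ge0 (ltW t0) (ltW t'0))/= ler_pdivrMr// mul1r.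
by rewrite scaler0 addr0 scalerA mulrC divfK// gt_eqF.
Qed.

Let S_neq0 x : S x !=set0.
Proof.
have [r r0 rK] := Kball; pose t := (`|x| + 1) / r.
have t0 : 0 < t by rewrite divr_gt0// ltr_wpDl.
exists t; split=> //; exists (t^-1 *: x); last by rewrite scalerA divff ?scale1r ?gt_eqF.
apply: rK; rewrite normrZ gtr0_norm ?invr_gt0// mulrC ltr_pdivrMr//.
by rewrite /t mulrC divfK ?gt_eqF// ltrDl.
Qed.

Let S_lb x : has_lbound (S x).
Proof. by exists 0 => t [/ltW]. Qed.

Lemma gauge_ge0 x : 0 <= gauge K x.
Proof. by apply: (lb_le_inf (S_neq0 x)) => t [/ltW]. Qed.

Lemma gauge_le t z : 0 < t -> K z -> gauge K (t *: z) <= t.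
Proof. by move=> t0 Kz; apply: ge_inf; [exact: S_lb|split=> //; exists z]. Qed.

Lemma gauge_lt x t : gauge K x < t -> exists2 z, K z & x = t *: z.
Proof.
move=> /(inf_lt (S_neq0 x))[t' /S_up h t't].
by have [_] := h _ (ltW t't).
Qed.

Let le_of_lt (a b : R) : (forall t, a < t -> b <= t) -> b <= a.
Proof. by move=> h; apply/ler_addgt0Pr => e e0; apply: h; rewrite ltrDl. Qed.

Lemma gauge_norm : exists2 M : R, 0 < M & forall x, `|x| <= M * gauge K x.
Proof.
have [M M0 KM] := Kbounded; exists M => // x.
rewrite mulrC -ler_pdivrMr//; apply: (lb_le_inf (S_neq0 x)) => t [t0 [z Kz ->]].
by rewrite normrZ gtr0_norm// ler_pdivrMr// ler_pM2l// KM.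
Qed.

Lemma gauge0 : gauge K 0 = 0.
Proof.
apply/eqP; rewrite eq_le gauge_ge0 andbT; apply: le_of_lt => t t0.
by rewrite -(scaler0 _ t) gauge_le.
Qed.

Lemma gauge_gt0 x : x != 0 -> 0 < gauge K x.
Proof.
move=> x0; have [M M0 xM] := gauge_norm.
have := lt_le_trans (_ : 0 < `|x|) (xM x); rewrite normr_gt0 => /(_ x0).
by rewrite pmulr_rgt0.
Qed.

Lemma gauge_le_norm : exists2 C : R, 0 < C & forall x, gauge K x <= C * `|x|.
Proof.
have [r r0 rK] := Kball; exists (2 / r) => [|x]; first by rewrite divr_gt0.
have [->|x0] := eqVneq x 0; first by rewrite gauge0 normr0 mulr0.
have nx : 0 < `|x| by rewrite normr_gt0.
set t := 2 / r * _; have t0 : 0 < t by rewrite !mulr_gt0// invr_gt0.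
rewrite -{1}(scale1r x) -(divff (lt0r_neq0 t0)) -scalerA gauge_le//; apply: rK.
rewrite normrZ gtr0_norm ?invr_gt0// mulrC ltr_pdivrMr// /t mulrA.
by rewrite mulrCA divff ?gt_eqF// mulr1 ltr_pMl// ltr1n.
Qed.

Lemma gaugeZ c x : 0 < c -> gauge K (c *: x) = c * gauge K x.
Proof.
have le c' x' : 0 < c' -> gauge K (c' *: x') <= c' * gauge K x'.
  move=> c0; rewrite mulrC -ler_pdivrMr//; apply: le_of_lt => t xt.
  have [z Kz ->] := gauge_lt xt; rewrite ler_pdivrMr// scalerA mulrC gauge_le//.
  by rewrite mulr_gt0// (le_lt_trans (gauge_ge0 x')).
move=> c0; apply/eqP; rewrite eq_le le//=.
have := le c^-1 (c *: x); rewrite invr_gt0 scalerA mulVf ?gt_eqF// scale1r => /(_ c0).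
by rewrite mulrC ler_pdivlMr// mulrC.
Qed.

Lemma gaugeD x y : gauge K (x + y) <= gauge K x + gauge K y.
Proof.
apply/ler_addgt0Pr => e e0; have e20 : 0 < e / 2 by rewrite divr_gt0.
have xe : gauge K x < gauge K x + e / 2 by rewrite ltrDl.
have ye : gauge K y < gauge K y + e / 2 by rewrite ltrDl.
set s := gauge K x + e / 2 in xe; set t := gauge K y + e / 2 in ye.
have s0 : 0 < s by apply: le_lt_trans xe; exact: gauge_ge0.
have t0 : 0 < t by apply: le_lt_trans ye; exact: gauge_ge0.
have st0 : 0 < s + t by exact: addr_gt0.
have -> : gauge K x + gauge K y + e = s + t by rewrite /s /t; lra.
have [z Kz ->] := gauge_lt xe; have [w Kw ->] := gauge_lt ye.
have -> : s *: z + t *: w = (s + t) *: ((s / (s + t)) *: z + (1 - s / (s + t)) *: w).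
  apply/rowP => i; rewrite !mxE; field; exact: lt0r_neq0.
apply: gauge_le => //; apply: Kconv => //.
by rewrite (divr_ge0 (ltW s0) (ltW st0))/= ler_pdivrMr// mul1r lerDl ltW.
Qed.

Lemma gaugeB_le x y : gauge K x - gauge K y <= gauge K (x - y).
Proof. by rewrite lerBlDr -{1}(subrK y x) gaugeD. Qed.

Lemma gauge_continuous : continuous (gauge K).
Proof.
have [C C0 gC] := gauge_le_norm => x; apply/continuous_eps => e e0.
have := near_dist x (divr_gt0 e0 C0); apply: filterS => y xy.
have yx : `|y - x| < e / C by rewrite distrC.
rewrite ler_norml; apply/andP; split.
  rewrite lerNl opprB (le_trans (gaugeB_le _ _))// (le_trans (gC _))//.
  by rewrite mulrC -ler_pdivlMr// ltW.
rewrite (le_trans (gaugeB_le _ _))// (le_trans (gC _))//.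
by rewrite mulrC -ler_pdivlMr// ltW.
Qed.

Lemma gauge_mem x : K x -> gauge K x <= 1.
Proof. by move=> Kx; rewrite -(scale1r x) gauge_le. Qed.

Lemma mem_gauge x : gauge K x <= 1 -> K x.
Proof.
move=> x1; have Kc : closed K by apply: compact_closed => //; exact: norm_hausdorff.
apply: Kc => B /nbhs_ballP[r /= r0 rB].
(* [(1 - d) x] has gauge below 1, hence lies in [K], and is within [r] of [x]; the cap 1/2 keeps
   [1 - d] positive. *)
pose d := Num.min 2^-1 (r / (2 * (`|x| + 1))).
have nx : 0 < `|x| + 1 by rewrite ltr_wpDl.
have d0 : 0 < d by rewrite lt_min invr_gt0 ltr0n/= divr_gt0// mulr_gt0.
have d1 : d <= 2^-1 by rewrite ge_min lexx.
have dr : d <= r / (2 * (`|x| + 1)) by rewrite ge_min lexx orbT.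
have c0 : 0 < 1 - d by lra.
exists ((1 - d) *: x); split.
  have [|z Kz ->] := @gauge_lt ((1 - d) *: x) 1; last by rewrite scale1r.
  rewrite gaugeZ//; apply: (@le_lt_trans _ _ (1 - d)); last by rewrite ltrBlDr ltrDl.
  by rewrite ler_piMr// ltW.
apply: rB; rewrite -ball_normE /= scalerBl scale1r opprB addrC subrK normrZ gtr0_norm//.
apply: (@le_lt_trans _ _ (d * (`|x| + 1))); first by rewrite ler_pM2l// lerDl.
apply: (@le_lt_trans _ _ (r / 2)); last by rewrite ltr_pdivrMr// ltr_pMr// ltr1n.
by move: dr; rewrite invfM mulrA ler_pdivlMr.
Qed.

Lemma interior_gauge x : interior K x <-> gauge K x < 1.
Proof.
split=> [/nbhs_ballP[r /= r0 rK]|x1].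
  have nx : 0 < `|x| + 1 by rewrite ltr_wpDl.
  pose d := r / (2 * (`|x| + 1)).
  have d0 : 0 < d by rewrite divr_gt0// mulr_gt0.
  have /gauge_mem : K ((1 + d) *: x).
    apply: rK; rewrite -ball_normE /= scalerDl scale1r opprD addrA subrr add0r normrN.
    rewrite normrZ gtr0_norm//.
    apply: (@le_lt_trans _ _ (d * (`|x| + 1))); first by rewrite ler_pM2l// lerDl.
    rewrite /d invfM mulrA divfK ?gt_eqF// ltr_pdivrMr// ltr_pMr// ltr1n//.
  rewrite gaugeZ ?addr_gt0// => h; have := gauge_ge0 x.
  rewrite le_eqVlt => /orP[/eqP <-//|g0]; apply: lt_le_trans h.
  by rewrite mulrDl mul1r ltrDl mulr_gt0.
have : {for x, continuous (gauge K)} by exact: gauge_continuous.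
move=> /continuous_eps.
have e0 : 0 < (1 - gauge K x) / 2 by rewrite divr_gt0// subr_gt0.
move=> /(_ _ e0); apply: filterS => z; rewrite ler_norml => /andP[h _].
by apply: mem_gauge; lra.
Qed.

Lemma boundary_gauge x : boundary K x <-> gauge K x = 1.
Proof.
have Kc : closed K by apply: compact_closed => //; exact: norm_hausdorff.
split=> [[/Kc/gauge_mem h1 h2]|h].
  by apply/eqP; rewrite eq_le h1 leNgt; apply/negP => /interior_gauge.
split; first by apply: subset_closure; apply: mem_gauge; rewrite h.
by move=> /interior_gauge; rewrite h ltxx.
Qed.

Lemma polar_lt q z : gauge (polar K) q < 1 -> z != 0 -> dot q z < gauge K z.
Proof.
move=> q1 z0.
have [M M0 KM] := Kbounded.
have [|t [t0 [w Kw qE]] t1] :=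
  @inf_lt _ [set t : R | 0 < t /\ exists2 z, polar K z & q = t *: z] 1 _ q1.
  (* The infimum defining the gauge of the polar is over a nonempty set, hence not a default value:
     [t^-1 q] pairs to at most 1 with every point of [K], whose norm is at most [M]. *)
  pose t := n.+1%:R * `|q| * M + 1.
  have t0 : 0 < t by rewrite ltr_wpDl// !mulr_ge0// ltW.
  exists t; split => //; exists (t^-1 *: q); last by rewrite scalerA divff ?scale1r ?gt_eqF.
  move=> y Ky; rewrite -/(dot _ _) dotZl mulrC ler_pdivrMr// mul1r.
  rewrite (le_trans (ler_norm _))// (le_trans (norm_dot _ _))//.
  by rewrite /t (le_trans (ler_wpM2l _ (KM _ Ky)))// ?mulr_ge0// lerDl.
have gz := gauge_gt0 z0.
have Kz : K ((gauge K z)^-1 *: z).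
  by apply: mem_gauge; rewrite gaugeZ ?invr_gt0// mulVf// gt_eqF.
have := Kw _ Kz; rewrite -/(dot _ _) dotZr mulrC ler_pdivrMr// mul1r => h.
rewrite qE dotZl; apply: le_lt_trans (_ : t * gauge K z < _).
  by rewrite ler_pM2l.
by rewrite gtr_pMl.
Qed.

(** By the mean value theorem the gradient bound makes [phi] strictly 1-Lipschitz for the gauge.
    This is what keeps rays inside [U] and makes every boundary point its own only closest point. *)
Lemma potential_lt (phi : 'rV[R]_n.+1 -> R) b z :
  (forall u, differentiable phi u) -> (forall u, gauge (polar K) (grad phi u) < 1) ->
  b != z -> phi b - phi z < gauge K (b - z).
Proof.
move=> dphi gphi bz; have [|t _] := @mean_value _ _ phi z (b - z); first by move=> t _.
rewrite [z + _]addrC subrK dotC => ->; apply: polar_lt => //.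
by rewrite subr_eq0.
Qed.

End Gauge.

(** * Defining functions of boundaries *)

Section ClassC.
Context {R : realType} {n : nat}.
Implicit Types (f : 'rV[R]_n -> R) (V : set 'rV[R]_n).

Lemma class_C2P k a V f : (2 <= k)%N -> class_C k a V f -> forall z, V z ->
  [/\ differentiable f z, forall i, differentiable (partial i f) z &
      forall i j, {for z, continuous (partial j (partial i f))}].
Proof.
case: k => [|[|k]]// _ [df dpf] z Vz; split; first exact: df.
  by move=> i; have [dp _] := dpf i; exact: dp.
move=> i j; have [_ /(_ j)] := dpf i; case: k {dpf} => [|k] [h _]; first exact: h.
by apply: differentiable_continuous; exact: h.
Qed.

(** Jacobians act on row vectors from the right, so their entry [i j] is the derivative in direction
    [i] of the coordinate [j]. This is the transpose of the convention of [hessian]; symmetry is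
    never invoked. *)
Lemma C2_strict V f : open V ->
  (forall z, V z -> [/\ differentiable f z, forall i, differentiable (partial i f) z &
      forall i j, {for z, continuous (partial j (partial i f))}]) ->
  forall z, V z -> sgrad f (nbhs z) (grad f z) /\
    sdiff (grad f) (nbhs z) (hessian f z)^T.
Proof.
move=> Vo fV z Vz; have Vn : nbhs z V by exact: open_nbhs_nbhs.
have [_ dp cp] := fV _ Vz; split.
  apply: C1_sgrad; first by apply: filterS Vn => u /fV[].
  by move=> i; exact: differentiable_continuous.
apply: sdiff_coord => j.
have -> : \row_i (hessian f z)^T i j = grad (partial j f) z.
  by apply/rowP => i; rewrite !mxE.
have -> : (fun x => grad f x 0 j) = partial j f by apply/funext => u; rewrite mxE.
apply: C1_sgrad; first by apply: filterS Vn => u /fV[_ /(_ j)].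
by move=> i; exact: cp.
Qed.

Lemma class_C2_strict k a V f : (2 <= k)%N -> open V -> class_C k a V f ->
  forall z, V z -> sgrad f (nbhs z) (grad f z) /\
    sdiff (grad f) (nbhs z) (hessian f z)^T.
Proof. by move=> k2 Vo fC; apply: C2_strict => // z Vz; exact: class_C2P fC _ _. Qed.

End ClassC.

Section LastCoordinate.
Context {R : realType} {n : nat}.

Definition emax : 'rV[R]_n.+1 := delta_mx 0 ord_max.

(** Deletion of the last coordinate as a matrix, so that charts are treated with the rules for
    linear maps. *)
Definition dropmx : 'M[R]_(n.+1, n) := \matrix_(i, j) (i == lift ord_max j)%:R.

Lemma col'_dropmx (z : 'rV[R]_n.+1) : col' ord_max z = z *m dropmx.
Proof.
apply/rowP => j; rewrite !mxE (bigD1 (lift ord_max j))//= big1 ?addr0.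
  by rewrite mxE eqxx mulr1.
by move=> i ij; rewrite mxE (negPf ij) mulr0.
Qed.

Lemma dot_emax (z : 'rV[R]_n.+1) : dot z emax = z 0 ord_max.
Proof. by rewrite dotC dot_delta. Qed.

Lemma emax_dropmx : emax *m dropmx = 0.
Proof.
apply/rowP => j; rewrite -rowE !mxE; by rewrite (negPf (neq_lift _ _)).
Qed.

Lemma decomp_emax (z : 'rV[R]_n.+1) :
  z = (z *m dropmx) *m dropmx^T + dot z emax *: emax.
Proof.
rewrite -col'_dropmx dot_emax; apply/rowP => i; rewrite !mxE.
case: (unliftP ord_max i) => [j ->|->].
  rewrite (bigD1 j)//= big1 ?addr0.
    by rewrite !mxE eqxx mulr1 (eq_sym (lift _ _)) (negPf (neq_lift _ _)) mulr0 addr0.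
  by move=> l lj; rewrite !mxE (inj_eq lift_inj) eq_sym (negPf lj) mulr0.
rewrite big1 ?add0r ?eqxx ?mulr1// => l _.
by rewrite !mxE (negPf (neq_lift _ _)) mulr0.
Qed.

End LastCoordinate.

Section Defining.
Context {R : realType} {n : nat}.
Implicit Types (S : set 'rV[R]_n.+1) (y : 'rV[R]_n.+1).

(* A coordinate-free form of graph_chart: N is the gradient of H. *)
Definition defining S y (H : 'rV[R]_n.+1 -> R) (N : 'rV[R]_n.+1 -> 'rV[R]_n.+1) :=
  \forall x \near y, [/\ interior S x <-> 0 < H x, boundary S x <-> H x = 0,
    sgrad H (nbhs x) (N x), exists J, sdiff N (nbhs x) J & N x != 0].

(** The defining function is the height above the graph, the last chart coordinate minus [psi] of
    the others. Its gradient has last component 1 in the chart, hence never vanishes. *)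
Lemma chart_defining S y Q psi k a V : (2 <= k)%N ->
  graph_chart S y Q psi -> open_nbhs (0 : 'rV[R]_n) V -> class_C k a V psi ->
  exists H N, defining S y H N.
Proof.
move=> k2 [QQ chart] [Vo V0] psiC; have psi2 := class_C2_strict k2 Vo psiC.
have QQ' : Q^T *m Q = 1%:M by exact: mulmx1C.
pose w (x : 'rV[R]_n.+1) := x *m (Q *m dropmx) + - (y *m (Q *m dropmx)).
pose H x := dot ((x - y) *m Q) emax + - psi (w x).
pose N x : 'rV[R]_n.+1 := (emax - grad psi (w x) *m dropmx^T) *m Q^T.
have wE x : w x = col' ord_max ((x - y) *m Q).
  by rewrite col'_dropmx -mulmxA mulmxBl.
have wc x : {for x, continuous w}.
  by apply: sdiff_continuous; exact: sdiff_affine.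
have w0 : w y = 0 by rewrite /w subrr.
exists H, N; near=> x.
have Vw : V (w x).
  near: x; have : w @ y --> w y by exact: wc.
  by apply; rewrite w0; exact: open_nbhs_nbhs.
have [g1 g2] := psi2 _ Vw.
have [c1 c2] : let z := (x - y) *m Q in
    let z' : 'rV[R]_n := col' ord_max z in
    (interior S x <-> psi z' < z 0 ord_max) /\
    (boundary S x <-> z 0 ord_max = psi z') by near: x; exact: chart.
split.
- by rewrite /H subr_gt0 dot_emax wE.
- rewrite c2 /H dot_emax -wE; split => [->|/eqP]; first by rewrite subrr.
  by rewrite subr_eq0 => /eqP.
- have -> : N x = (emax *m Q^T) + - (grad psi (w x) *m (Q *m dropmx)^T).
    by rewrite /N mulmxBl trmx_mul mulmxA.
  apply: sgradD; last first.
    apply: sgradN; apply: (sgrad_comp (wc x)) => //; exact: sdiff_affine.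
  have -> : (fun x => dot ((x - y) *m Q) emax) = (fun x => dot (x *m Q + - (y *m Q)) emax).
    by apply/funext => u; rewrite mulmxBl.
  by apply: sgrad_dotl; exact: sdiff_affine.
- exists (Q *m dropmx *m (hessian psi (w x))^T *m (- (dropmx^T *m Q^T))).
  have -> : N = (fun u => u *m (- (dropmx^T *m Q^T)) + emax *m Q^T) \o (grad psi \o w).
    by apply/funext => u; rewrite /N /= mulmxBl mulmxN addrC mulmxA.
  have cg : {for x, continuous (grad psi \o w)}.
    by apply: continuous_comp => //; exact: sdiff_continuous g2.
  apply: (sdiff_comp cg); last exact: sdiff_affine.
  by apply: (sdiff_comp (wc x)) => //; exact: sdiff_affine.
- apply/eqP => N0.
  have /(congr1 (fun v => dot (v *m Q) emax)) := N0.
  rewrite /N -mulmxA QQ' mulmx1 mul0mx dot0l dotBl dot_mulmx trmxK emax_dropmx.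
  by rewrite dot0r dot_emax mxE !eqxx subr0 => /eqP; rewrite oner_eq0.
Unshelve. all: by end_near. Qed.

Lemma class_C_boundary_defining S y k a : (2 <= k)%N ->
  class_C_boundary k a S -> boundary S y -> exists H N, defining S y H N.
Proof.
by move=> k2 SC /SC[Q [psi [chart [V [V0 psiC]]]]]; exact: (chart_defining k2 chart V0 psiC).
Qed.

End Defining.

(** * Second-order regularity of the gauge *)

Section ContinuousAt.
Context {R : realType} {V W : normedModType R}.

Lemma continuous_at_inv (f : V -> R) x : f x != 0 ->
  {for x, continuous f} -> {for x, continuous (fun u => (f u)^-1)}.
Proof. by move=> fx cf; apply: cvgV. Qed.

Lemma continuous_at_scale (c : V -> R) (f : V -> W) x :
  {for x, continuous c} -> {for x, continuous f} ->
  {for x, continuous (fun u => c u *: f u)}.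
Proof. by move=> cc cf; apply: cvgZ. Qed.

Lemma continuous_at_id x : {for x, continuous (@id V)}.
Proof. exact: cvg_id. Qed.

End ContinuousAt.

Lemma sdiff_id {R : realType} {n : nat} (F : set_system 'rV[R]_n) {FF : Filter F} :
  sdiff (fun x => x) F 1%:M.
Proof.
by move=> e e0; near=> t; rewrite mulmx1 subrr normr0 mulr_ge0// ltW.
Unshelve. all: by end_near. Qed.

(** * First-order tests with one-sided increments *)

Section FirstOrder.
Context {R : realType} {n : nat}.
Implicit Types (f g : 'rV[R]_n -> R) (x v : 'rV[R]_n).

Lemma dir_est f x v e : differentiable f x -> 0 < e ->
  exists2 t0 : R, 0 < t0 & forall t, 0 < t < t0 ->
    `|f (x + t *: v) - f x - t * dot v (grad f x)| <= e * t.
Proof.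
move=> df e0; have v1 : 0 < `|v| + 1 by rewrite ltr_wpDl.
have := differentiable_dotP df (divr_gt0 e0 v1).
move=> /nbhs_ballP[r /= r0 h]; exists (r / (`|v| + 1)); first by rewrite divr_gt0.
move=> t /andP[t0]; rewrite ltr_pdivlMr// => tr.
have tv : `|t *: v| <= t * (`|v| + 1).
  by rewrite normrZ gtr0_norm// ler_pM2l// lerDl.
have hb : ball (0 : 'rV[R]_n) r (t *: v).
  by rewrite -ball_normE /= sub0r normrN (le_lt_trans tv).
have /= := h _ hb; rewrite dotZl [t *: v + x]addrC => h3; apply: (le_trans h3).
by rewrite mulrAC ler_pdivrMr// -mulrA ler_pM2l.
Qed.

Lemma dir_ge f x v c : differentiable f x ->
  (exists2 t0 : R, 0 < t0 & forall t, 0 < t < t0 -> f x + t * c <= f (x + t *: v)) ->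
  c <= dot v (grad f x).
Proof.
move=> df [t0 t00 fge]; apply/ler_addgt0Pr => e e0.
have [t1 t10 h] := dir_est v df e0.
pose t := Num.min t0 t1 / 2.
have m0 : 0 < Num.min t0 t1 by rewrite lt_min t00.
have t_gt0 : 0 < t by rewrite divr_gt0.
have tm : t < Num.min t0 t1 by rewrite ltr_pdivrMr// ltr_pMr// ltr1n.
have [tt0 tt1] : t < t0 /\ t < t1 by move: tm; rewrite lt_min => /andP.
have h1 := fge t; have h2 := h t; rewrite t_gt0 tt0 in h1; rewrite t_gt0 tt1 in h2.
have := h1 isT; have := h2 isT; rewrite ler_norml => /andP[_ h3] h4.
rewrite -(ler_pM2l t_gt0) mulrDr; lra.
Qed.

Lemma dir_le f x v c : differentiable f x ->
  (exists2 t0 : R, 0 < t0 & forall t, 0 < t < t0 -> f (x + t *: v) <= f x + t * c) ->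
  dot v (grad f x) <= c.
Proof.
move=> df [t0 t00 fle]; apply/ler_addgt0Pr => e e0.
have [t1 t10 h] := dir_est v df e0.
pose t := Num.min t0 t1 / 2.
have m0 : 0 < Num.min t0 t1 by rewrite lt_min t00.
have t_gt0 : 0 < t by rewrite divr_gt0.
have tm : t < Num.min t0 t1 by rewrite ltr_pdivrMr// ltr_pMr// ltr1n.
have [tt0 tt1] : t < t0 /\ t < t1 by move: tm; rewrite lt_min => /andP.
have h1 := fle t; have h2 := h t; rewrite t_gt0 tt0 in h1; rewrite t_gt0 tt1 in h2.
have := h1 isT; have := h2 isT; rewrite ler_norml => /andP[h3 _] h4.
rewrite -(ler_pM2l t_gt0) mulrDr; lra.
Qed.

Lemma dot_inj (u w : 'rV[R]_n) : (forall v, dot v u <= dot v w) -> u = w.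
Proof.
move=> h; apply/rowP => i; apply/eqP; rewrite eq_le -!dot_delta h/=.
by have := h (- delta_mx 0 i); rewrite !dotNl lerN2.
Qed.

End FirstOrder.

Lemma near_defining {R : realType} {n : nat} (S : set 'rV[R]_n.+1) y H N :
  defining S y H N -> \forall x \near y, defining S x H N.
Proof. exact: nbhs_interior. Qed.

(** * Strict differentiability of the gauge and of its gradient off the origin *)

Section GaugeC2.
Context {R : realType} {n : nat}.
Variable K : set 'rV[R]_n.+1.
Hypothesis Kcompact : compact K.
Hypothesis Kconvex : convex_set (K : set (convex_lmodType 'rV[R]_n.+1)).
Hypothesis K0 : interior K 0.
Hypothesis Kdef : forall y, boundary K y -> exists H N, defining K y H N.
Implicit Types (x y z e : 'rV[R]_n.+1).

Let g := gauge K.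
Let g_ge0 x : 0 <= g x := gauge_ge0 K0 x.
Let g_gt0 x (x0 : x != 0) : 0 < g x := gauge_gt0 Kcompact K0 x0.
Let gZ c x (c0 : 0 < c) : g (c *: x) = c * g x := gaugeZ Kconvex K0 x c0.
Let gD x y : g (x + y) <= g x + g y := gaugeD Kconvex K0 x y.
Let g_cont x : {for x, continuous g} := @gauge_continuous _ _ _ Kconvex K0 x.

(** By convexity the segment from [x] to a point [w] of gauge below 1 enters the interior, where
    [H > 0], so [(w - x) . N >= 0]. A small negative multiple of [N] as [w] makes the inequality at
    [x] strict. *)
Lemma defining_support x H N : defining K x H N -> g x = 1 -> dot x (N x) < 0.
Proof.
move=> def gx; have [_ bH sH _ N0] := nbhs_singleton def.
have Hx : H x = 0 by apply/bH/boundary_gauge.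
have [dH gH] := sgrad_differentiable sH.
have supp w : g w < 1 -> 0 <= dot (w - x) (N x).
  move=> gw; rewrite -gH; apply: dir_ge => //.
  have : \forall u \near x, interior K u -> 0 < H u.
    by apply: filterS def => u [[]].
  move=> /nbhs_ballP[r /= r0 hr]; have d1 : 0 < `|w - x| + 1 by rewrite ltr_wpDl.
  exists (Num.min 1 (r / (`|w - x| + 1))); first by rewrite lt_min ltr01 divr_gt0.
  move=> t /andP[t0]; rewrite lt_min => /andP[t1]; rewrite ltr_pdivlMr// => tr.
  rewrite Hx mulr0 addr0 ltW//; apply: hr.
    rewrite -ball_normE /= opprD addrA subrr add0r normrN normrZ gtr0_norm//.
    by apply: le_lt_trans tr; rewrite ler_pM2l// lerDl.
  apply/(interior_gauge Kcompact Kconvex K0); rewrite -/g.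
  have -> : x + t *: (w - x) = (1 - t) *: x + t *: w.
    by apply/rowP => i; rewrite !mxE; ring.
  apply: le_lt_trans (gD _ _) _; rewrite !gZ ?subr_gt0// gx.
  have : t * g w < t * 1 by rewrite ltr_pM2l//.
  lra.
pose d := (2 * (g (- N x) + 1))^-1.
have d0 : 0 < d by rewrite invr_gt0 mulr_gt0// ltr_wpDl.
have : g (d *: - N x) < 1.
  rewrite gZ// mulrC ltr_pdivrMr ?mulr_gt0 ?ltr_wpDl// mul1r.
  by have := g_ge0 (- N x); lra.
move=> /supp; rewrite dotBl dotZl dotNl subr_ge0 => /le_lt_trans; apply.
by rewrite mulrN oppr_lt0 mulr_gt0// dot_gt0.
Qed.

Let hat x := (g x)^-1 *: x.

Let g_hat x : x != 0 -> g (hat x) = 1.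
Proof. by move=> x0; rewrite gZ ?invr_gt0 ?g_gt0// mulVf// gt_eqF// g_gt0. Qed.

Let ginv_cont x : x != 0 -> {for x, continuous (fun x => (g x)^-1)}.
Proof.
by move=> x0; apply: continuous_at_inv; [rewrite gt_eqF// g_gt0|exact: (@g_cont x)].
Qed.

Let hat_cont x : x != 0 -> {for x, continuous hat}.
Proof.
move=> x0; apply: continuous_at_scale; first exact: ginv_cont.
exact: continuous_at_id.
Qed.

Let near_neq0 e : e != 0 -> \forall x \near e, x != 0.
Proof.
move=> e0; have e1 : 0 < `|e| by rewrite normr_gt0.
have := near_dist e e1; apply: filterS => x; apply: contraTneq => ->.
by rewrite subr0 ltxx.
Qed.

(** Replaces the implicit function theorem. The function [H] vanishes along [hat], so its strict
    derivative gives [(hat u - hat v) . N0 = o(u - v)]; expanding [hat u = (g u)^-1 u] yields a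
    linear relation for the increment of [1/g], whose coefficient [e . N0] is nonzero by
    [defining_support]. The Lipschitz bound from subadditivity controls the errors. The inverse of
    the gauge is treated first because [hat] is linear in it. *)
Let sgrad_ginv e H N : e != 0 -> defining K (hat e) H N ->
  sgrad (fun x => (g x)^-1) (nbhs e)
    (- ((g e)^-1 / dot e (N (hat e))) *: N (hat e)).
Proof.
move=> e0 def; set N0 := N (hat e).
have ge : 0 < g e by exact: g_gt0.
have eN : dot e N0 < 0.
  have := defining_support def (g_hat e0).
  by rewrite dotZl pmulr_rlt0// invr_gt0.
have [_ _ sH _ _] := nbhs_singleton def.
pose FF := filter_prod (nbhs e) (nbhs e); pose d (t : 'rV[R]_n.+1 * 'rV[R]_n.+1) := `|t.1 - t.2|.
have nz : \forall t \near FF, t.1 != 0 /\ t.2 != 0.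
  by exists ([set x | x != 0], [set x | x != 0]); [split; exact: near_neq0|move=> [? ?] []].
have rc : {for e, continuous (fun x => (g x)^-1)}.
  exact: ginv_cont.
pose proof (fst_cvg rc) as rc1; pose proof (snd_cvg rc) as rc2.
have big_g : big FF (fun t => g t.2 - g t.1) d.
  have [C C0 gC] := gauge_le_norm K0.
  exists C => //; near=> t; rewrite ler_norml; apply/andP; split.
    rewrite lerNl opprB (le_trans (gaugeB_le Kconvex K0 _ _))//.
  by rewrite (le_trans (gaugeB_le Kconvex K0 _ _))// (le_trans (gC _))// distrC.
have big_r : big FF (fun t => (g t.1)^-1 - (g t.2)^-1) d.
  have c1 : (fun t => (g t.1)^-1 * (g t.2)^-1) @ FF --> (g e)^-1 * (g e)^-1.
    exact: (cvgM rc1 rc2).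
  apply: (big_near _ (big_scale c1 big_g)); near=> t.
  have [t1 t2] : t.1 != 0 /\ t.2 != 0 by near: t.
  have := lt0r_neq0 (g_gt0 t1); have := lt0r_neq0 (g_gt0 t2).
  rewrite /GRing.scale/=; move: (g t.1) (g t.2) => a b b0 a0; field.
  by rewrite b0 a0.
have big_hat : big FF (fun t => hat t.1 - hat t.2) d.
  have b1 : big FF (fun t => (g t.1)^-1 *: (t.1 - t.2)) d.
    by apply: big_scale; [exact: rc1|exact: big_self].
  have b2 : big FF (fun t => ((g t.1)^-1 - (g t.2)^-1) *: t.2) d.
    by apply: big_scaler; [exact: cvg_snd|].
  apply: (big_near _ (bigD b1 b2)); near=> t.
  by rewrite /hat; apply/rowP => i; rewrite !mxE; ring.
have k1 : small FF (fun t => dot (hat t.1 - hat t.2) N0) d.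
  pose proof (small_comp (pair_cvg (hat_cont e0)) sH) as k.
  pose proof (small_trans k (big_norm big_hat)) as k'.
  apply: (small_near _ (smallN k')).
  have Hn : \forall x \near e, H (hat x) = 0.
    have bd : \forall u \near hat e, boundary K u <-> H u = 0.
      by apply: filterS def => u [].
    have := hat_cont e0 bd; have := near_neq0 e0; apply: filterS2 => x x0 hx.
    by apply/hx/(boundary_gauge Kcompact Kconvex K0); exact: g_hat.
  exists ((fun x => H (hat x) = 0), (fun x => H (hat x) = 0)) => //.
  by move=> [u v] [/= -> ->]; rewrite subrr sub0r opprK.
have k2 : small FF (fun t => ((g t.1)^-1 - (g e)^-1) *: dot (t.1 - t.2) N0) d.
  apply: small_scale; last by apply: big_dot; exact: big_self.
  by rewrite -(subrr (g e)^-1); apply: cvgB => //; exact: cvg_cst.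
have k3 : small FF (fun t => ((g t.1)^-1 - (g t.2)^-1) *: (dot t.2 N0 - dot e N0)) d.
  apply: small_scaler => //; rewrite -(subrr (dot e N0)); apply: cvgB; last exact: cvg_cst.
  have dc : {for e, continuous (fun x => dot x N0)} by exact: dotr_continuous.
  exact: (snd_cvg dc).

apply: (small_near _ (small_scalel (dot e N0)^-1 (smallB (smallB k1 k2) k3))); near=> t.
have [t1 t2] : t.1 != 0 /\ t.2 != 0 by near: t.
have := lt0r_neq0 (g_gt0 t1); have := lt0r_neq0 (g_gt0 t2).
have := lt0r_neq0 ge; have := lt_eqF eN.
rewrite /GRing.scale/= /hat dotZr !dotBl !dotZl.
move: (g t.1) (g t.2) (g e) (dot e N0) => a b c m m0 c0 b0 a0; field.
by rewrite ?m0 ?a0 ?b0 ?c0.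
Unshelve. all: by end_near. Qed.

Let gauge_sgrad_def e H N : e != 0 -> defining K (hat e) H N ->
  sgrad g (nbhs e) ((dot (hat e) (N (hat e)))^-1 *: N (hat e)).
Proof.
move=> e0 def; have ge : 0 < g e by exact: g_gt0.
have eN : dot e (N (hat e)) < 0.
  have := defining_support def (g_hat e0).
  by rewrite dotZl pmulr_rlt0// invr_gt0.
have rc : {for e, continuous (fun x => (g x)^-1)}.
  exact: ginv_cont.
have r0 : (g e)^-1 != 0 by rewrite invr_eq0 gt_eqF.
pose proof (sgradV r0 rc (sgrad_ginv e0 def)) as k; move: k.
have -> : (fun x => ((g x)^-1)^-1) = g by apply/funext => x; rewrite invrK.
rewrite scalerA; congr sgrad; congr (_ *: _).
rewrite /hat dotZl; have := lt0r_neq0 ge; have := lt_eqF eN.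
move: (g e) (dot e _) => a m m0 a0; field.
by rewrite ?m0 ?a0 ?b0 ?c0.
Qed.

Let near_hat e H N : e != 0 -> defining K (hat e) H N ->
  \forall x \near e, x != 0 /\ defining K (hat x) H N.
Proof.
move=> e0 def; near=> x; split; first by near: x; exact: near_neq0.
by near: x; exact: (hat_cont e0 (near_defining def)).
Unshelve. all: by end_near. Qed.

Let hat_boundary e : e != 0 -> boundary K (hat e).
Proof. by move=> e0; apply/(boundary_gauge Kcompact Kconvex K0); exact: g_hat. Qed.

Lemma gauge_sgrad e : e != 0 -> sgrad g (nbhs e) (grad g e).
Proof.
move=> e0; have [H [N def]] := Kdef (hat_boundary e0).
have sg := gauge_sgrad_def e0 def.
by have [_ ->] := sgrad_differentiable sg.
Qed.

(** Near [e] the gradient is the normal [N (hat x)], normalised to have pairing 1 with [hat x]: an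
    explicit expression in strictly differentiable maps. *)
Lemma gauge_sdiff e : e != 0 -> exists J, sdiff (grad g) (nbhs e) J.
Proof.
move=> e0; have [H [N def]] := Kdef (hat_boundary e0).
have eN := defining_support def (g_hat e0).
have [_ _ _ [J sN] _] := nbhs_singleton def.
have rc : {for e, continuous (fun x => (g x)^-1)}.
  exact: ginv_cont.
have sid : sdiff (fun x : 'rV[R]_n.+1 => x) (nbhs e) 1%:M by exact: sdiff_id.
pose proof (sdiff_scale rc (@continuous_at_id _ _ e) (sgrad_ginv e0 def) sid) as shat.
have hc := hat_cont e0.
pose proof (sdiff_comp hc shat sN) as sNh.
have Nc : (N \o hat) @ e --> N (hat e).
  by apply: continuous_comp => //; exact: sdiff_continuous sN.
pose proof (sgrad_dot hc Nc shat sNh) as sd.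
have dc : (fun x => dot (hat x) ((N \o hat) x)) @ e --> dot (hat e) (N (hat e)).
  exact: (sgrad_continuous sd).
have eN' : dot (hat e) (N (hat e)) != 0 by rewrite lt_eqF.
pose proof (sgradV eN' dc sd) as si.
pose proof (cvgV eN' dc) as ic.
pose proof (sdiff_scale ic Nc si sNh) as sp; move: sp; set J' := (X in sdiff _ _ X) => sp.
exists J'; apply: sdiff_near sp; near=> x.
have [x0 dx] : x != 0 /\ defining K (hat x) H N by near: x; exact: near_hat.
by have [_ ->] := sgrad_differentiable (gauge_sgrad_def x0 dx).
Unshelve. all: by end_near. Qed.

Let dg e : e != 0 -> differentiable g e.
Proof. by move=> /gauge_sgrad/sgrad_differentiable[]. Qed.

Lemma grad_gauge_le e z : e != 0 -> dot z (grad g e) <= g z.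
Proof.
move=> e0; apply: dir_le; first exact: dg.
exists 1 => // t /andP[t0 _]; apply: le_trans (gD _ _) _.
by rewrite gZ.
Qed.

Lemma grad_gauge_self e : e != 0 -> dot e (grad g e) = g e.
Proof.
move=> e0; apply/eqP; rewrite eq_le grad_gauge_le//=.
apply: dir_ge; first exact: dg.
exists 1 => // t /andP[t0 _].
by rewrite -{3}(scale1r e) -scalerDl gZ ?addr_gt0// mulrDl mul1r.
Qed.

(** A linear form below [g] and touching it at [e] is a subgradient there, and differentiability
    leaves only one. *)
Lemma grad_gauge_unique e q : e != 0 -> (forall z, dot z q <= g z) -> dot e q = g e ->
  grad g e = q.
Proof.
move=> e0 qle qe; apply/esym/dot_inj => v; apply: dir_ge; first exact: dg.
exists 1 => // t _; rewrite -qe -dotZl -dotDl; exact: qle.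
Qed.

Lemma grad_gaugeZ t e : 0 < t -> e != 0 -> grad g (t *: e) = grad g e.
Proof.
move=> t0 e0; have te0 : t *: e != 0 by rewrite scaler_eq0 negb_or e0 gt_eqF.
apply/esym/grad_gauge_unique => // [z|]; first exact: grad_gauge_le.
by have := grad_gauge_self te0; rewrite dotZl gZ// => /(mulfI (lt0r_neq0 t0)).
Qed.

(** Derivative of Euler's identity [dot x (grad g x) = g x]. *)
Lemma hess_gauge_self e J : e != 0 -> sdiff (grad g) (nbhs e) J -> J *m e^T = 0.
Proof.
move=> e0 sJ.
have sid : sdiff (fun x : 'rV[R]_n.+1 => x) (nbhs e) 1%:M by exact: sdiff_id.
pose proof (sgrad_dot (@continuous_at_id _ _ e) (sdiff_continuous sJ) sid sJ) as sd.
have sg : sgrad g (nbhs e) (grad g e *m (1%:M)^T + e *m J^T).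
  apply: sgrad_near sd; near=> x; apply: grad_gauge_self.
  by near: x; exact: near_neq0.
have [_] := sgrad_differentiable sg; rewrite trmx1 mulmx1 => /eqP.
rewrite -subr_eq0 opprD addrA subrr sub0r oppr_eq0 => /eqP /(congr1 trmx).
by rewrite trmx_mul trmxK trmx0.
Unshelve. all: by end_near. Qed.

(* The hypothesis on the kernel is the infinitesimal form of strict convexity. *)
Lemma grad_gauge_inj e c J : sdiff (grad g) (nbhs e) J ->
  (forall v, v *m J = 0 -> exists k, v = k *: e) ->
  g e = 1 -> g c = 1 -> grad g c = grad g e -> c = e.
Proof.
move=> sJ kerJ ge gc pce.
have neq0 x : g x = 1 -> x != 0.
  by move=> gx; apply/eqP => x0; move: gx; rewrite x0 /g gauge0// => /esym/eqP; rewrite oner_eq0.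
have e0 := neq0 _ ge; have c0 := neq0 _ gc.
pose x t := e + t *: (c - e).
have xE t : x t = (1 - t) *: e + t *: c by apply/rowP => i; rewrite !mxE; ring.
have px t : dot (x t) (grad g e) = 1.
  have h : dot c (grad g e) = 1 by rewrite -pce grad_gauge_self.
  by rewrite xE dotDl !dotZl h grad_gauge_self// ge; ring.
have gradx t : 0 < t < 1 -> grad g (x t) = grad g e.
  move=> /andP[t0 t1].
  have gx : g (x t) = 1.
    apply/eqP; rewrite eq_le; apply/andP; split.
      by rewrite xE (le_trans (gD _ _))// !gZ ?subr_gt0// ge gc; lra.
    by rewrite -(px t) grad_gauge_le.
  apply: grad_gauge_unique => [|z|]; [exact: neq0|exact: grad_gauge_le|].
  by rewrite px gx.
(* On the segment [g] is at most 1 by convexity and at least 1 by the common supporting form, so the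
   gradient is constant along it and [J] annihilates [c - e]. Then [c - e] is radial, and its
   pairing with [grad g e] is 0. *)
have ker : (c - e) *m J = 0.
  apply/eqP; rewrite -normr_eq0 eq_le normr_ge0 andbT; apply/ler_addgt0Pr => eps eps0.
  rewrite add0r; have d1 : 0 < `|c - e| + 1 by rewrite ltr_wpDl.
  have [[A B] /= [/nbhs_ballP[a /= a0 aA] /nbhs_ballP[b /= b0 bB]] AB] := sJ _ (divr_gt0 eps0 d1).
  have [t [t0 t1 ta]] : exists t, [/\ 0 < t, t < 1 & t < a / (`|c - e| + 1)].
    pose m := Num.min 1 (a / (`|c - e| + 1)); exists (m / 2).
    have m0 : 0 < m by rewrite lt_min ltr01 divr_gt0.
    have tm : m / 2 < m by rewrite ltr_pdivrMr// ltr_pMr// ltr1n.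
    by rewrite divr_gt0//; move: tm; rewrite {2}/m lt_min => /andP[].
  have := AB (x t, e) _; rewrite /= gradx ?t0// subrr sub0r normrN.
  have -> : x t - e = t *: (c - e) by rewrite /x addrAC subrr add0r.
  rewrite -scalemxAl !normrZ (gtr0_norm t0) mulrCA ler_pM2l// => h.
  apply: le_trans (h _) _.
    split; last by apply: bB; exact: ballxx.
    apply: aA; rewrite -ball_normE /= /x opprD addrA subrr add0r normrN normrZ (gtr0_norm t0).
    apply: (@le_lt_trans _ _ (t * (`|c - e| + 1))); first by rewrite ler_pM2l// lerDl.
    by rewrite -ltr_pdivlMr.
  by rewrite mulrAC ler_pdivrMr// ler_pM2l// lerDl.
have [k kE] := kerJ _ ker.
have : dot (c - e) (grad g e) = 0.
  by rewrite dotBl -{1}pce !grad_gauge_self// ge gc subrr.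
rewrite kE dotZl grad_gauge_self// ge mulr1 => k0.
by apply/eqP; rewrite -subr_eq0 kE k0 scale0r.
Qed.

End GaugeC2.

(** * Curvature and the Hessian of the gauge *)

Lemma continuous_at_cst {R : realType} {V W : normedModType R} (c : W) (x : V) :
  {for x, continuous (fun _ : V => c)}.
Proof. exact: cvg_cst. Qed.

Section StrictClassC.
Context {R : realType} {n : nat}.
Implicit Types (f : 'rV[R]_n -> R) (V : set 'rV[R]_n).

Lemma sdiff_hessian f x J : sdiff (grad f) (nbhs x) J -> hessian f x = J^T.
Proof.
move=> sJ; apply/matrixP => i j; rewrite !mxE.
have fE : (fun u => grad f u 0 i) = partial i f by apply/funext => u; rewrite mxE.
pose proof (coord_sdiff i sJ) as s; rewrite fE in s.
have [_] := sgrad_differentiable s.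
by move=> /rowP/(_ j); rewrite !mxE.
Qed.

Lemma sdiff_partial f x J i : sdiff (grad f) (nbhs x) J ->
  sgrad (partial i f) (nbhs x) (grad (partial i f) x).
Proof.
move=> sJ; have fE : (fun u => grad f u 0 i) = partial i f.
  by apply/funext => u; rewrite mxE.
pose proof (coord_sdiff i sJ) as s; rewrite fE in s.
by have [_ ->] := sgrad_differentiable s.
Qed.

(** Strict differentiability of the gradient at every point of an open set already makes the second
    partial derivatives continuous, through [sgrad_cvg]. *)
Lemma strict_class_C2 V f : open V ->
  (forall z, V z -> differentiable f z) ->
  (forall z, V z -> exists J, sdiff (grad f) (nbhs z) J) ->
  class_C 2 0 V f.
Proof.
move=> Vo df dg; have sp i z : V z -> sgrad (partial i f) (nbhs z) (grad (partial i f) z).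
  by move=> /dg[J]; exact: sdiff_partial.
have cpp i j z : V z -> {for z, continuous (partial j (partial i f))}.
  move=> Vz; have : {for z, continuous (grad (partial i f))}.
    apply: (@sgrad_cvg R n (nbhs z) _ (partial i f)) => [P||].
    - exact: nbhs_interior.
    - exact: sp.
    - by apply: filterS (open_nbhs_nbhs (conj Vo Vz)) => u; exact: sp.
  move=> /continuous_eps c; apply/continuous_eps => e /c; apply: filterS => u.
  apply: le_trans; apply: le_trans (coord_le_norm _ 0 j).
  by rewrite !mxE.
split=> // i; split; first by move=> z /(sp i)/sgrad_differentiable[].
move=> j; split; first by move=> z; exact: cpp.
(* With exponent 0 the power is identically 1, so it suffices that the oscillation near [z] is at
   most 2. *)
move=> z Vz; exists 2; have /continuous_eps/(_ _ ltr01) c := cpp i j z Vz.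
exists ([set u | `|partial j (partial i f) z - partial j (partial i f) u| <= 1],
  [set u | `|partial j (partial i f) z - partial j (partial i f) u| <= 1]) => //.
move=> [u v] [/= zu zv]; rewrite powRr0 mulr1.
move: (partial _ _ u) (partial _ _ v) (partial _ _ z) zu zv => a b d.
rewrite !ler_norml; lra.
Qed.

End StrictClassC.

Lemma exists_orthogonal {R : realType} {n : nat} (nu : 'rV[R]_n.+1) : dot nu nu = 1 ->
  exists Q : 'M[R]_n.+1, Q *m Q^T = 1%:M /\ emax *m Q^T = nu.
Proof.
move=> nu1; have [<-|enu] := eqVneq emax nu.
  by exists 1%:M; rewrite trmx1 !mulmx1.
(* the reflection exchanging emax and nu *)
pose u := emax - nu; have u0 : u != 0 by rewrite subr_eq0.
have uu := dot_gt0 u0; pose c := 2 / dot u u.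
have ee : dot (@emax R n) emax = 1 by rewrite dot_emax mxE !eqxx.
have uE : dot u u = 2 * dot emax u.
  by rewrite /u !dotBl !dotBr ee nu1 (dotC nu); ring.
have QT : (1%:M - c *: (u^T *m u))^T = 1%:M - c *: (u^T *m u).
  by rewrite linearB linearZ /= trmx_mul trmxK trmx1.
exists (1%:M - c *: (u^T *m u)); rewrite QT; split.
  rewrite mulmxBr mulmx1 -scalemxAr mulmxBl mul1mx -scalemxAl.
  have -> : u^T *m u *m (u^T *m u) = dot u u *: (u^T *m u).
    by rewrite mulmxA -(mulmxA u^T) dot_mx mul_mx_scalar scalemxAl.
  apply/matrixP => i j; rewrite !mxE /c; move: (\sum_(_ < _) _) => s; field.
  exact: lt0r_neq0.
rewrite mulmxBr mulmx1 -scalemxAr mulmx_trr scalerA.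
have -> : c * dot emax u = 1.
  have : 0 < dot emax u by move: uu; rewrite uE pmulr_rgt0.
  by rewrite /c uE; move: (dot emax u) => s s0; field; exact: lt0r_neq0.
by rewrite scale1r /u opprB addrC subrK.
Qed.

Section Curvature.
Context {R : realType} {n : nat}.
Variable K : set 'rV[R]_n.+1.
Hypothesis Kcompact : compact K.
Hypothesis Kconvex : convex_set (K : set (convex_lmodType 'rV[R]_n.+1)).
Hypothesis K0 : interior K 0.
Hypothesis Kdef : forall y, boundary K y -> exists H N, defining K y H N.
Hypothesis Kcurv : forall z c, boundary K z -> principal_curvature K z c -> 0 < c.

Opaque gauge.
Let g := gauge K.

Let g_neq0 x : g x = 1 -> x != 0.
Proof.
move=> gx; apply/eqP => x0; move: gx; rewrite x0 /g gauge0// => /esym/eqP.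
by rewrite oner_eq0.
Qed.

Section Chart.
Variables (e : 'rV[R]_n.+1) (Q : 'M[R]_n.+1) (a : R).
Hypothesis ge : g e = 1.
Hypothesis QQ : Q *m Q^T = 1%:M.
Hypothesis a0 : 0 < a.
Let nu := emax *m Q^T.
Hypothesis nuE : grad g e = - a *: nu.
Hypothesis nu1 : dot nu nu = 1.

(** [B] embeds the chart coordinates as the tangent hyperplane at [e], and [X w t] is the point at
    height [t] above the tangent point of coordinate [w]. The vector [nu] is the inner normal, as
    [g] has slope [-a] along it. *)
Let B := (dropmx^T *m Q^T) : 'M[R]_(n, n.+1).
Let X (w : 'rV[R]_n) t := e + w *m B + t *: nu.

Let XE x : x = X (col' ord_max ((x - e) *m Q)) (((x - e) *m Q) 0 ord_max).
Proof.
rewrite col'_dropmx -dot_emax /X /B /nu -addrA mulmxA scalemxAl -mulmxDl -decomp_emax.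
by rewrite -mulmxA QQ mulmx1 addrC subrK.
Qed.

Let nup : dot nu (grad g e) = - a.
Proof. by rewrite nuE dotZr nu1 mulr1. Qed.

(** The strict derivative at [e] is [-a] along [nu], which leaves a slope of at most [-a / 2]
    between any two vertically aligned points near [e]. The radius [d] keeps [X w t] in the ball of
    the strict estimate. *)
Let decr : exists2 d : R, 0 < d & forall w t t', `|w| < d -> `|t| < d -> `|t'| < d -> t < t' ->
  g (X w t') + a / 2 * (t' - t) <= g (X w t).
Proof.
have n1 : 0 < `|nu| + 1 by rewrite ltr_wpDl.
have B1 : 0 < n%:R * `|B| + 1 by rewrite ltr_wpDl// mulr_ge0.
have ea : 0 < a / 2 / (`|nu| + 1) by rewrite !divr_gt0.
have /sgradP/(_ _ ea)[r r0 h] := gauge_sgrad Kcompact Kconvex K0 Kdef (g_neq0 ge).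
pose d := r / 2 / (n%:R * `|B| + 1 + (`|nu| + 1)).
have D0 : 0 < n%:R * `|B| + 1 + (`|nu| + 1) by exact: addr_gt0.
have d0 : 0 < d by rewrite !divr_gt0.
have Xr w t : `|w| < d -> `|t| < d -> ball e r (X w t).
  move=> wd td; rewrite -ball_normE /= /X -addrA opprD addrA subrr add0r normrN.
  apply: le_lt_trans (ler_normD _ _) _; rewrite normrZ.
  have h1 : `|w *m B| <= (n%:R * `|B| + 1) * d.
    rewrite (le_trans (norm_mulmx _ _))// ler_pM ?mulr_ge0// ?lerDl//.
    exact: ltW.
  have h2 : `|t| * `|nu| <= (`|nu| + 1) * d.
    by rewrite mulrC ler_pM// ?lerDl// ltW.
  have : (n%:R * `|B| + 1) * d + (`|nu| + 1) * d = r / 2.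
    by rewrite -mulrDl /d mulrC divfK ?gt_eqF.
  by move: h1 h2; lra.
exists d => // w t t' wd td t'd tt'.
have := h _ _ (Xr _ _ wd t'd) (Xr _ _ wd td).
have -> : X w t' - X w t = (t' - t) *: nu.
  by rewrite /X; apply/rowP => i; rewrite !mxE; ring.
rewrite dotZl nup normrZ gtr0_norm ?subr_gt0// ler_norml => /andP[_].
have : a / 2 / (`|nu| + 1) * ((t' - t) * `|nu|) <= a / 2 * (t' - t).
  have -> : a / 2 / (`|nu| + 1) * ((t' - t) * `|nu|)
      = a / 2 * (t' - t) * (`|nu| / (`|nu| + 1)) by ring.
  rewrite ler_piMr//; first by rewrite mulr_ge0 ?subr_ge0 ?ltW// divr_gt0.
  by rewrite ler_pdivrMr// mul1r lerDl.
rewrite -/g; lra.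
Qed.

Let X_cont w : continuous (fun t => g (X w t)).
Proof.
move=> t; apply: (@continuous_comp _ _ _ (X w) g); last exact: gauge_continuous.
apply/continuous_eps => eps eps0.
have n1 : 0 < `|nu| + 1 by rewrite ltr_wpDl.
have := near_dist t (divr_gt0 eps0 n1); apply: filterS => s ts.
have -> : X w t - X w s = (t - s) *: nu.
  by rewrite /X; apply/rowP => i; rewrite !mxE; ring.
rewrite normrZ; apply: (@le_trans _ _ (`|t - s| * (`|nu| + 1))).
  by rewrite ler_wpM2l// lerDl.
by rewrite -ler_pdivlMr// ltW.
Qed.

Let Lip : exists2 C : R, 0 < C & forall w w' t, g (X w t) - g (X w' t) <= C * `|w - w'|.
Proof.
have [C C0 gC] := gauge_le_norm K0.
exists (C * (n%:R * `|B| + 1)); first by rewrite mulr_gt0// ltr_wpDl// mulr_ge0.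
move=> w w' t; apply: le_trans (gaugeB_le Kconvex K0 _ _) _.
apply: le_trans (gC _) _; rewrite -mulrA ler_pM2l//.
have -> : X w t - X w' t = (w - w') *m B.
  by rewrite mulmxBl /X; apply/rowP => i; rewrite !mxE; ring.
by apply: le_trans (norm_mulmx _ _) _; rewrite ler_wpM2r// lerDl.
Qed.

(** The height function is decreasing, and the intermediate value theorem finds its level 1. Moving
    [w] changes [g] by at most [C |w|], which the bound on [|w|] keeps below the drop [a / 2 * t0]
    gained over the height [t0]. *)
Let graph : exists (d t0 : R) (psi : 'rV[R]_n -> R), [/\ 0 < d, 0 < t0,
  (forall w t t', `|w| < d -> `|t| <= t0 -> `|t'| <= t0 -> t < t' ->
     g (X w t') + a / 2 * (t' - t) <= g (X w t)),
  (forall w, `|w| < d -> `|psi w| < t0 /\ g (X w (psi w)) = 1) & psi 0 = 0].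
Proof.
have [d d0 hd] := decr; pose t0 := d / 2; have t00 : 0 < t0 by rewrite divr_gt0.
have t0d : t0 < d by rewrite ltr_pdivrMr// ltr_pMr// ltr1n.
have mono w t t' : `|w| < d -> `|t| <= t0 -> `|t'| <= t0 -> t < t' ->
    g (X w t') + a / 2 * (t' - t) <= g (X w t).
  by move=> wd tt0 t't0; apply: hd => //; [exact: le_lt_trans t0d|exact: le_lt_trans t0d].
have [C C0 hC] := Lip.
pose d' := Num.min d (a / 2 * t0 / (2 * C)).
have d'0 : 0 < d' by rewrite lt_min d0 divr_gt0// ?mulr_gt0// divr_gt0.
have X00 : g (X 0 0) = 1 by rewrite /X mul0mx scale0r !addr0.
have sol w : exists t, `|w| < d' -> `|t| < t0 /\ g (X w t) = 1.
  have [wd'|] := boolP (`|w| < d'); last by exists 0.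
  have [wd wC] : `|w| < d /\ `|w| < a / 2 * t0 / (2 * C).
    by move: wd'; rewrite lt_min => /andP.
  have k1 : C * `|w| < a / 2 * t0.
    move: wC; rewrite ltr_pdivlMr ?mulr_gt0// => wC.
    have : 0 <= C * `|w| by rewrite mulr_ge0// ltW.
    move: wC; rewrite mulrCA (mulrC C); lra.
  have k2 := hC w 0 0; rewrite subr0 X00 in k2.
  have k3 := hC 0 w 0; rewrite sub0r normrN X00 in k3.
  have z0 : `|0 : R| <= t0 by rewrite normr0 ltW.
  have p0 : `|t0| <= t0 by rewrite ger0_norm// ltW.
  have m0 : `|- t0| <= t0 by rewrite normrN.
  have u1 : g (X w t0) < 1 by have := mono w 0 t0 wd z0 p0 t00; lra.
  have n0 : - t0 < 0 by rewrite oppr_lt0.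
  have u2 : 1 < g (X w (- t0)) by have := mono w (- t0) 0 wd m0 z0 n0; lra.
  have [|||t] := @IVT R (fun t => g (X w t)) (- t0) t0 1.
  - lra.
  - by apply: continuous_subspaceT; exact: X_cont.
  - by rewrite ge_min le_max (ltW u1) (ltW u2) !orbT.
  rewrite in_itv/= => /andP[tl tr] gt; exists t => _; split=> //.
  rewrite ltr_norml !lt_neqAle tl tr !andbT; apply/andP; split.
    by apply/eqP => E; rewrite E gt ltxx in u2.
  by apply/eqP => E; rewrite -E gt ltxx in u1.
have [psi hpsi] := choice sol.
exists d', t0, psi; split=> //.
  by move=> w t t'; rewrite lt_min => /andP[wd _]; exact: mono.
have [] := hpsi 0; first by rewrite normr0.
move=> pt p1; have [h|h|//] := ltgtP (psi 0) 0.
  have := mono 0 (psi 0) 0; rewrite !normr0 p1 X00 => /(_ d0 (ltW pt) (ltW t00) h).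
  have : 0 < a / 2 * (0 - psi 0) by rewrite mulr_gt0 ?divr_gt0// sub0r oppr_gt0.
  lra.
have := mono 0 0 (psi 0); rewrite !normr0 p1 X00 => /(_ d0 (ltW t00) (ltW pt) h).
have : 0 < a / 2 * (psi 0 - 0) by rewrite mulr_gt0 ?divr_gt0// subr0.
lra.
Qed.

(** Since [g = 1] on the graph [Y], the strict derivative of [g] gives [grad psi = G], minus the
    tangential part of [grad g] divided by its normal part. This is again strictly differentiable,
    so [psi] is of class C^2. At 0 the gradient of [g] is purely normal, and only the tangential
    block of [J] survives in the Hessian. *)
Let chart J : sdiff (grad g) (nbhs e) J -> exists psi V,
  [/\ graph_chart K e Q psi, open_nbhs (0 : 'rV[R]_n) V, class_C 2 0 V psi,
      grad psi 0 = 0 & (hessian psi 0)^T = a^-1 *: (B *m J *m B^T)].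
Proof.
move=> sJ; have [d [t0 [psi [d0 t00 mono hpsi psi0]]]] := graph.
have Q'Q : Q^T *m Q = 1%:M by exact: mulmx1C.
pose V : set 'rV[R]_n := ball 0 d.
have VE w : V w <-> `|w| < d.
  by rewrite /V -ball_normE /= sub0r normrN.
have Vo : open V by exact: ball_open.
have V0 : V 0 by apply/VE; rewrite normr0.
have Vn w : V w -> nbhs w V by move=> Vw; exact: open_nbhs_nbhs.
pose Y w := X w (psi w).
have gY w : V w -> g (Y w) = 1 by move=> /VE/hpsi[].
have Y0 w : V w -> Y w != 0 by move=> /gY/g_neq0.
have [C C0 hC] := Lip.
have a2 : 0 < a / 2 by rewrite divr_gt0.
have psi_le w w' : V w -> V w' -> psi w < psi w' -> a / 2 * (psi w' - psi w) <= C * `|w - w'|.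
  move=> Vw Vw' lt; have [/hpsi[tw gw] /hpsi[tw' gw']] := (iffLR (VE _) Vw, iffLR (VE _) Vw').
  have := mono w _ _ (iffLR (VE _) Vw) (ltW tw) (ltW tw') lt.
  have := hC w' w (psi w'); rewrite distrC gw gw'; lra.
have psi_lip w w' : V w -> V w' -> `|psi w - psi w'| <= C / (a / 2) * `|w - w'|.
  move=> Vw Vw'; rewrite mulrAC ler_pdivlMr// mulrC.
  have [lt|gt|->] := ltgtP (psi w) (psi w').
  - by rewrite ltr0_norm ?subr_lt0// opprB psi_le.
  - by rewrite gtr0_norm ?subr_gt0// distrC psi_le.
  - by rewrite subrr normr0 mulr0 mulr_ge0// ltW.
have psi_big w : V w -> big (filter_prod (nbhs w) (nbhs w))
    (fun t => psi t.1 - psi t.2) (fun t => `|t.1 - t.2|).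
  move=> Vw; exists (C / (a / 2)); first by rewrite divr_gt0.
  exists (V, V); first by split; exact: Vn.
  by move=> [u v] [/= Vu Vv]; exact: psi_lip.
have nup' w : V w -> dot nu (grad g (Y w)) < 0.
  move=> Vw; apply: (@le_lt_trans _ _ (- (a / 2))); last by rewrite oppr_lt0.
  have [_ dg] := sgrad_differentiable (gauge_sgrad Kcompact Kconvex K0 Kdef (Y0 _ Vw)).
  have [psit gw] := hpsi _ (iffLR (VE _) Vw).
  apply: dir_le.
    by have [] := sgrad_differentiable (gauge_sgrad Kcompact Kconvex K0 Kdef (Y0 _ Vw)).
  exists (t0 - `|psi w|); first by rewrite subr_gt0.
  move=> t /andP[t_gt0]; rewrite ltrBrDr => tlt.
  have E : Y w + t *: nu = X w (psi w + t).
    by rewrite /Y /X scalerDl addrA.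
  have tt : `|psi w + t| <= t0.
    by rewrite (le_trans (ler_normD _ _))// (gtr0_norm t_gt0) addrC ltW.
  have lt : psi w < psi w + t by rewrite ltrDl.
  have := mono w (psi w) (psi w + t) (iffLR (VE _) Vw) (ltW psit) tt lt.
  have -> : psi w + t - psi w = t by rewrite addrC addKr.
  by rewrite -E mulrN lerBrDr mulrC.
have psi_cont w : V w -> {for w, continuous psi}.
  move=> Vw; apply/continuous_eps => eps eps0.
  have Ca : 0 < C / (a / 2) by rewrite divr_gt0.
  have := near_dist w (divr_gt0 eps0 Ca); have := Vn _ Vw; apply: filterS2 => u Vu wu.
  by rewrite (le_trans (psi_lip _ _ Vw Vu))// mulrC -ler_pdivlMr// ltW.
have Y_cont w : V w -> {for w, continuous Y}.
  move=> Vw; rewrite /Y /X.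
  have -> : (fun w => e + w *m B + psi w *: nu) = (fun w => (w *m B + e) + psi w *: nu).
    by apply/funext => u; rewrite (addrC e).
  apply: continuousD; first by apply: sdiff_continuous; exact: sdiff_affine.
  by apply: continuous_at_scale; [exact: psi_cont|exact: continuous_at_cst].
pose G w := - (dot nu (grad g (Y w)))^-1 *: (grad g (Y w) *m B^T).
have spsi w : V w -> sgrad psi (nbhs w) (G w).
  move=> Vw.
  have bY : big (filter_prod (nbhs w) (nbhs w)) (fun t => Y t.1 - Y t.2) (fun t => `|t.1 - t.2|).
    have b1 : big (filter_prod (nbhs w) (nbhs w))
      (fun t => (t.1 - t.2) *m B) (fun t => `|t.1 - t.2|).
      by apply: big_mulmx; exact: big_self.
    have b2 : big (filter_prod (nbhs w) (nbhs w))
      (fun t => (psi t.1 - psi t.2) *: nu) (fun t => `|t.1 - t.2|).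
      by apply: big_scaler; [exact: cvg_cst|exact: psi_big].
    apply: (big_near _ (bigD b1 b2)); near=> t.
    by rewrite /Y /X mulmxBl; apply/rowP => i; rewrite !mxE; ring.
  pose proof (small_comp (pair_cvg (Y_cont _ Vw))
    (gauge_sgrad Kcompact Kconvex K0 Kdef (Y0 _ Vw))) as k1.
  pose proof (small_trans k1 (big_norm bY)) as k2.
  apply: (small_near _ (small_scalel (- (dot nu (grad g (Y w)))^-1) k2)).
  exists (V, V); first by split; exact: Vn.
  move=> [u v] [/= Vu Vv]; rewrite -/g !gY// subrr sub0r.
  have -> : Y u - Y v = (u - v) *m B + (psi u - psi v) *: nu.
    by rewrite /Y /X mulmxBl; apply/rowP => i; rewrite !mxE; ring.
  have := lt_eqF (nup' _ Vw); move: (u - v) (psi u - psi v) => A b.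
  rewrite /G dotZr dotDl dotZl -dot_mulmx /GRing.scale/=.
  by move: (dot nu _) (dot (A *m B) _) => s r s0; field; rewrite s0.
have gpsi w : V w -> grad psi w = G w.
  by move=> /spsi/sgrad_differentiable[].
have sY w : V w -> sdiff Y (nbhs w) (B + (psi w *: 0 + (G w)^T *m nu)).
  move=> Vw; rewrite /Y /X.
  have -> : (fun w => e + w *m B + psi w *: nu) = (fun w => (w *m B + e) + psi w *: nu).
    by apply/funext => u; rewrite (addrC e).
  apply: sdiffD; first exact: sdiff_affine.
  apply: (sdiff_scale (psi_cont _ Vw)); [exact: continuous_at_cst|exact: spsi|].
  by move=> eps eps0; near=> t; rewrite subrr mulmx0 subrr normr0 mulr_ge0// ltW.
(* [N] is the derivative of the scalar factor. It may stay unspecified, because at 0 it is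
   multiplied by the tangential part of [grad g e], which is 0. *)
have sG w J' : V w -> sdiff (grad g) (nbhs (Y w)) J' -> exists N,
    sdiff (grad psi) (nbhs w)
     (- (dot nu (grad g (Y w)))^-1 *: ((B + (psi w *: 0 + (G w)^T *m nu)) *m J' *m B^T)
       + N^T *m (grad g (Y w) *m B^T)).
  move=> Vw sJ'.
  pose proof (sdiff_comp (Y_cont _ Vw) (sY _ Vw) sJ') as s1.
  have c1 : {for w, continuous (grad g \o Y)}.
    by apply: continuous_comp; [exact: Y_cont|exact: sdiff_continuous sJ'].
  pose proof (sgrad_dotl nu s1) as s2.
  have c2 := sgrad_continuous s2.
  have nz : dot ((grad g \o Y) w) nu != 0 by rewrite dotC lt_eqF//; exact: nup'.
  pose proof (sgradN (sgradV nz c2 s2)) as s3.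
  have c3 := sgrad_continuous s3.
  pose proof (sdiff_comp c1 s1 (@sdiff_affine R n.+1 (nbhs ((grad g \o Y) w)) _ n B^T 0)) as s4.
  have c4 := sdiff_continuous s4.
  pose proof (sdiff_scale c3 c4 s3 s4) as s5.
  eexists; apply: sdiff_near; last first.
    move: s5; rewrite /= addr0 (dotC _ nu); exact.
  apply: filterS (Vn _ Vw) => u Vu; rewrite /= gpsi// /G addr0.
  by rewrite (dotC _ nu).
have Yz : Y 0 = e by rewrite /Y /X psi0 mul0mx scale0r !addr0.
have nuB : nu *m B^T = 0.
  by rewrite /B trmx_mul !trmxK /nu mulmxA -(mulmxA emax) Q'Q mulmx1 emax_dropmx.
have G0 : G 0 = 0.
  by rewrite /G Yz nuE -scalemxAl nuB !scaler0.
exists psi, V; split => //.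
- split => //; near=> x; rewrite /=.
  have wd : `|col' ord_max ((x - e) *m Q)| < d.
    near: x.
    have c : {for e, continuous
      (fun x : 'rV[R]_n.+1 => x *m (Q *m dropmx) + - (e *m (Q *m dropmx)))}.
      by apply: sdiff_continuous; exact: sdiff_affine.
    move/continuous_eps : c => /(_ (d / 2)); rewrite divr_gt0// => /(_ isT).
    apply: filterS => x; rewrite subrr sub0r normrN => h.
    rewrite col'_dropmx -mulmxA mulmxBl; apply: le_lt_trans h _.
    by rewrite ltr_pdivrMr// ltr_pMr// ltr1n.
  have tt0 : `|((x - e) *m Q) 0 ord_max| < t0.
    near: x.
    have c : {for e, continuous (fun x : 'rV[R]_n.+1 => x *m Q + - (e *m Q))}.
      by apply: sdiff_continuous; exact: sdiff_affine.
    move/continuous_eps : c => /(_ (t0 / 2)); rewrite divr_gt0// => /(_ isT).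
    apply: filterS => x; rewrite subrr sub0r normrN => h.
    rewrite (le_lt_trans (coord_le_norm _ _ _))// mulmxBl; apply: le_lt_trans h _.
    by rewrite ltr_pdivrMr// ltr_pMr// ltr1n.
  have := XE x; move: wd tt0; set w := col' _ _; set t := _ 0 ord_max => wd tt0 xE.
  have [pw gw] := hpsi _ wd.
  rewrite (interior_gauge Kcompact Kconvex K0) (boundary_gauge Kcompact Kconvex K0) -/g xE.
  have lt1 : psi w < t -> g (X w t) < 1.
    move=> lt; have := mono w (psi w) t wd (ltW pw) (ltW tt0) lt; rewrite gw.
    by apply: lt_le_trans; rewrite ltrDl mulr_gt0// subr_gt0.
  have gt1 : t < psi w -> 1 < g (X w t).
    move=> lt; have := mono w t (psi w) wd (ltW tt0) (ltW pw) lt; rewrite gw.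
    by apply: lt_le_trans; rewrite ltrDl mulr_gt0// subr_gt0.
  split; split => [h|h].
  + rewrite ltNge le_eqVlt; apply/negP => /orP[/eqP tE|/gt1 /(lt_trans h)].
      by rewrite tE gw ltxx in h.
    by rewrite ltxx.
  + exact: lt1.
  + by have [/gt1|/lt1|//] := ltgtP t (psi w); rewrite h ltxx.
  + by rewrite h.
- apply: strict_class_C2 => // z Vz.
    by have [] := sgrad_differentiable (spsi _ Vz).
  have [J' sJ'] := gauge_sdiff Kcompact Kconvex K0 Kdef (Y0 _ Vz).
  have [N sN] := sG _ _ Vz sJ'.
  by eexists; exact: sN.
- by rewrite gpsi.
- have [|N] := sG 0 J V0; first by rewrite Yz.
  move=> /sdiff_hessian ->; rewrite trmxK G0 Yz trmx0 mul0mx scaler0 !addr0 nup.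
  by rewrite {1}nuE -scalemxAl nuB scaler0 mulmx0 addr0 invrN opprK.
Unshelve. all: by end_near. Qed.

(** A tangent vector annihilated by [J] would be a null vector of the transposed chart Hessian. The
    determinant passes this to the Hessian itself, where it produces the principal curvature 0,
    which is excluded. *)
Lemma chart_hess_ker J v : sdiff (grad g) (nbhs e) J ->
  v *m J = 0 -> dot v nu = 0 -> v = 0.
Proof.
move=> sJ vJ vnu; apply/eqP/negPn/negP => v0.
have [psi [V [ch V0 psiC g0 hE]]] := chart sJ.
pose w := v *m Q *m dropmx.
have vE : v = w *m B.
  have := decomp_emax (v *m Q); rewrite dot_mulmx vnu scale0r addr0 -/w => h.
  by rewrite /B mulmxA -h -mulmxA QQ mulmx1.
have w0 : w != 0 by apply: contraNneq v0 => w0; rewrite vE w0 mul0mx.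
have det0 : \det (hessian psi 0) == 0.
  rewrite -det_tr; apply/det0P; exists w => //.
  have -> : w *m (hessian psi 0)^T = a^-1 *: ((w *m B) *m J *m B^T).
    by rewrite hE -scalemxAr !mulmxA.
  by rewrite -vE vJ mul0mx scaler0.
have := @Kcurv e 0; rewrite ltxx => h; suff : false by [].
apply: h; first by apply/(boundary_gauge Kcompact Kconvex K0).
exists Q, psi; split=> //; split; first by exists V.
split=> //; apply/eigenvalueP; have /det0P[u u0 uh] := det0.
by exists u => //; rewrite uh scale0r.
Qed.

End Chart.

(** Subtracting [(v . grad g e) e] makes [v] tangent. The result is still annihilated by [J], since
    [grad g] is homogeneous of degree 0 and so [e J = 0]; hence it vanishes by [chart_hess_ker]. The
    length [a] is the Euclidean one, as the reflection requires. *)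
Lemma hess_gauge_ker e J v : g e = 1 -> sdiff (grad g) (nbhs e) J ->
  v *m J = 0 -> exists k, v = k *: e.
Proof.
move=> ge sJ vJ; have e0 := g_neq0 ge.
have ep : dot e (grad g e) = 1 by rewrite grad_gauge_self.
have p0 : grad g e != 0.
  by apply/eqP => p0; move: ep; rewrite p0 dot0r => /esym/eqP; rewrite oner_eq0.
have pp := dot_gt0 p0.
pose a := Num.sqrt (dot (grad g e) (grad g e)).
have a0 : 0 < a by rewrite sqrtr_gt0.
have a2 : a * a = dot (grad g e) (grad g e) by rewrite -expr2 sqr_sqrtr// ltW.
pose nu := - a^-1 *: grad g e.
have nu1 : dot nu nu = 1.
  by rewrite dotZl dotZr -a2; field; exact: lt0r_neq0.
have [Q [QQ Qnu]] := exists_orthogonal nu1.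
have nuE : grad g e = - a *: (emax *m Q^T).
  by rewrite Qnu /nu scalerA mulrNN divff ?scale1r// lt0r_neq0.
exists (dot v (grad g e)); apply/eqP; rewrite -subr_eq0; apply/eqP.
apply: (chart_hess_ker ge QQ a0 nuE _ sJ).
- by rewrite Qnu.
- have eJ : e *m J = 0.
    apply/eqP; rewrite -normr_eq0 eq_le normr_ge0 andbT; apply/ler_addgt0Pr => eps eps0.
    rewrite add0r; have d1 : 0 < `|e| + 1 by rewrite ltr_wpDl.
    have [[A B] /= [/nbhs_ballP[r /= r0 rA] /nbhs_ballP[b /= b0 bB]] AB] := sJ _ (divr_gt0 eps0 d1).
    have [t t0 tr] : exists2 t, 0 < t & t < r / (`|e| + 1).
      by exists (r / (`|e| + 1) / 2); rewrite ?divr_gt0// ltr_pdivrMr// ltr_pMr ?divr_gt0// ltr1n.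
    have E : (1 + t) *: e - e = t *: e by rewrite scalerDl scale1r addrC addKr.
    have := AB ((1 + t) *: e, e) _; rewrite /= grad_gaugeZ// ?addr_gt0// subrr sub0r normrN E.
    rewrite -scalemxAl !normrZ (gtr0_norm t0) mulrCA ler_pM2l// => h.
    apply: le_trans (h _) _.
      split; last by apply: bB; exact: ballxx.
      apply: rA; rewrite -ball_normE /= -opprB E normrN normrZ (gtr0_norm t0).
      apply: (@le_lt_trans _ _ (t * (`|e| + 1))); first by rewrite ler_pM2l// lerDl.
      by rewrite -ltr_pdivlMr.
    by rewrite mulrAC ler_pdivrMr// ler_pM2l// lerDl.
  by rewrite mulmxBl vJ -scalemxAl eJ scaler0 subr0.
- by rewrite Qnu /nu dotZr dotBl dotZl ep mulr1 subrr mulr0.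
Qed.

End Curvature.

(** * The obstacle and its closest points *)

Lemma mulmx_inj_unit {F : fieldType} {n : nat} (A : 'M[F]_n) :
  (forall v : 'rV[F]_n, v *m A = 0 -> v = 0) -> A \in unitmx.
Proof.
move=> inj; rewrite -row_free_unit -kermx_eq0; apply/eqP/row_matrixP => i.
by rewrite row0; apply: inj; rewrite -row_mul mulmx_ker row0.
Qed.

Section Obstacle.
Context {R : realType} {n : nat}.
Variables (K U : set 'rV[R]_n.+1) (phi : 'rV[R]_n.+1 -> R).
Hypothesis Kcompact : compact K.
Hypothesis Kconvex : convex_set (K : set (convex_lmodType 'rV[R]_n.+1)).
Hypothesis K0 : interior K 0.
Hypothesis Kdef : forall y, boundary K y -> exists H N, defining K y H N.
Hypothesis Uopen : open U.
Hypothesis Ubounded : bounded_set U.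
Hypothesis dphi : forall z, differentiable phi z.
Hypothesis phi_lt : forall z, gauge (polar K) (grad phi z) < 1.
Implicit Types (x y z u v h : 'rV[R]_n.+1).

Let g := gauge K.
Let r := rho K U phi.

Let g_ge0 x : 0 <= g x := gauge_ge0 K0 x.
Let g_gt0 x (x0 : x != 0) : 0 < g x := gauge_gt0 Kcompact K0 x0.
Let gZ c x (c0 : 0 < c) : g (c *: x) = c * g x := gaugeZ Kconvex K0 x c0.
Let gD x y : g (x + y) <= g x + g y := gaugeD Kconvex K0 x y.
Let g0 : g 0 = 0 := gauge0 K0.

Let gZ0 c x : 0 <= c -> g (c *: x) = c * g x.
Proof.
by rewrite le_eqVlt => /orP[/eqP <-|/gZ//]; rewrite scale0r g0 mul0r.
Qed.

Let phi_potential b z : b != z -> phi b - phi z < g (b - z).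
Proof. by move=> bz; exact: (potential_lt Kcompact Kconvex K0 dphi phi_lt bz). Qed.

Let phi_le b z : phi b - phi z <= g (b - z).
Proof.
have [->|/phi_potential/ltW//] := eqVneq b z.
by rewrite !subrr.
Qed.

Lemma boundary_compact : compact (boundary U).
Proof.
apply: bounded_closed_compact.
  have /pinfty_ex_gt0[M M0 UM] := Ubounded.
  have sub : boundary U `<=` [set z | `|z| <= M].
    move=> z [zU _]; apply/ler_addgt0Pr => e e0.
    have [u [Uu zu]] := zU _ (near_dist z e0).
    rewrite -(subrK u z) (le_trans (ler_normD _ _))// addrC lerD//; first exact: UM.
    exact: ltW.
  exists M; split; first exact: gtr0_real.
  by move=> M' MM' z /sub/le_trans; apply; exact: ltW.
rewrite /boundary setDE; apply: closedI; first exact: closed_closure.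
by apply: open_closedC; exact: open_interior.
Qed.

Let closest_val x z : rho_closest K U phi x z -> r x = g (x - z) + phi z.
Proof. by case. Qed.

Lemma boundary_notin z : boundary U z -> ~ U z.
Proof. by move=> [_ nz] Uz; apply: nz; exact: open_nbhs_nbhs. Qed.

(** * Closest points: existence, rays, multiplier rule, envelope theorem *)

Section Closest.
Variable y0 : 'rV[R]_n.+1.
Hypothesis y0U : boundary U y0.

Let F x z := g (x - z) + phi z.

Let F_cont x z : {for z, continuous (F x)}.
Proof.
apply: continuousD; last exact: differentiable_continuous.
apply: (@continuous_comp _ _ _ (fun z => x - z) g); last exact: gauge_continuous.
by apply: continuousB; [exact: continuous_at_cst|exact: continuous_at_id].
Qed.

Lemma exists_closest x : exists z, rho_closest K U phi x z.
Proof.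
have [] := @EVT_min_rV R n.+1 (F x) (boundary U) (ex_intro _ _ y0U) boundary_compact.
  by apply: continuous_subspaceT => z; exact: F_cont.
move=> z /[!inE] zU zmin; exists z; split=> //.
apply/eqP; rewrite eq_le; apply/andP; split.
  apply: ge_inf; last by exists z.
  by exists (F x z) => _ [u uU <-]; apply: zmin; rewrite inE.
apply: lb_le_inf; first by exists (F x z), z.
by move=> _ [u uU <-]; apply: zmin; rewrite inE.
Qed.

Lemma rho_le x z : boundary U z -> r x <= g (x - z) + phi z.
Proof.
move=> zU; have [w [wU rw]] := exists_closest x.
apply: ge_inf; last by exists z.
have [] := @EVT_min_rV R n.+1 (F x) (boundary U) (ex_intro _ _ y0U) boundary_compact.
  by apply: continuous_subspaceT => u; exact: F_cont.
by move=> u _ umin; exists (F x u) => _ [v vU <-]; apply: umin; rewrite inE.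
Qed.

Lemma rho_triangle x x' : r x <= r x' + g (x - x').
Proof.
have [z [zU rz]] := exists_closest x'; rewrite /r rz -/g.
apply: le_trans (rho_le x zU) _.
have : g (x - z) <= g (x' - z) + g (x - x').
  have {1}-> : x - z = (x' - z) + (x - x') by apply/rowP => i; rewrite !mxE; ring.
  exact: gD.
by rewrite addrAC lerD2r.
Qed.

(** [rho] at the intermediate point is at most its value through [z], and at least [r x] minus the
    remaining length by the triangle inequality. The two bounds coincide. *)
Lemma closest_segment x z t : rho_closest K U phi x z -> 0 <= t <= 1 ->
  rho_closest K U phi (z + t *: (x - z)) z /\
  r x = r (z + t *: (x - z)) + g (x - (z + t *: (x - z))).
Proof.
move=> [zU rz] /andP[t0 t1]; set xt := z + _.
have E1 : xt - z = t *: (x - z) by rewrite /xt addrC addKr.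
have E2 : x - xt = (1 - t) *: (x - z).
  by apply/rowP => i; rewrite !mxE; ring.
have h1 : r xt <= t * g (x - z) + phi z.
  by rewrite -gZ0// -E1; exact: rho_le.
have h2 := rho_triangle x xt; rewrite E2 gZ0 ?subr_ge0// in h2.
rewrite {1}/r rz -/g in h2.
have h3 : r xt = t * g (x - z) + phi z by apply/eqP; rewrite eq_le h1/=; lra.
split; first by split=> //; rewrite -/r h3 E1 -/g gZ0.
by rewrite E2 gZ0 ?subr_ge0// h3 {1}/r rz -/g; ring.
Qed.

(* To second order in h this is the inequality between the Hessians. *)
Lemma rho_increment x z t h : rho_closest K U phi x z -> 0 <= t <= 1 ->
  r (x + h) - r x <= r (z + t *: (x - z) + h) - r (z + t *: (x - z)).
Proof.
move=> xz t01; have [_ ->] := closest_segment xz t01; set xt := z + _.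
have := rho_triangle (x + h) (xt + h).
have -> : x + h - (xt + h) = x - xt by rewrite opprD addrACA subrr addr0.
lra.
Qed.

(** First exit: the infimum of the parameters outside [U]. The exit point is outside since [U] is
    open, and earlier points of the segment approach it from inside. *)
Lemma crossing x z : U x -> ~ U z ->
  exists2 t : R, 0 < t <= 1 & boundary U (x + t *: (z - x)).
Proof.
move=> Ux Uz; pose k t := x + t *: (z - x).
have kc t : {for t, continuous k}.
  apply: continuousD; first exact: continuous_at_cst.
  by apply: continuous_at_scale; [exact: continuous_at_id|exact: continuous_at_cst].
pose E : set R := [set t | 0 <= t /\ ~ U (k t)].
have E1 : E 1 by split=> //; rewrite /k scale1r addrC subrK.
have Elb : has_lbound E by exists 0 => t [].
pose s := inf E.
have s0 : 0 <= s by apply: lb_le_inf; [exists 1|move=> t []].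
have s1 : s <= 1 by exact: ge_inf.
have below t : 0 <= t -> t < s -> U (k t).
  by move=> t0 ts; apply: contrapT => nU; move: ts; rewrite ltNge ge_inf.
have nUs : ~ U (k s).
  move=> Us; have : \forall t \near s, U (k t).
    by apply: kc; exact: open_nbhs_nbhs.
  move=> /nbhs_ballP[d /= d0 hd].
  have [t Et ts] := inf_adherent d0 (conj (ex_intro _ _ E1) Elb).
  have st : s <= t by exact: ge_inf.
  case: Et => t0; apply; apply: hd; rewrite -ball_normE /= ltr_norml.
  rewrite -/s in ts; lra.
have s_gt0 : 0 < s.
  rewrite lt_neqAle s0 andbT; apply/eqP => s00; apply: nUs.
  by rewrite -s00 /k scale0r addr0.
exists s; first by rewrite s_gt0.
split; last by move=> /interior_subset.
move=> B Bs; have /nbhs_ballP[d /= d0 hd] : \forall t \near s, B (k t) by exact: kc.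
pose t := Num.max 0 (s - d / 2).
have ts : t < s by rewrite gt_max s_gt0/= ltrBlDr ltrDl divr_gt0.
have t0 : 0 <= t by rewrite le_max lexx.
exists (k t); split; first exact: below.
apply: hd; rewrite -ball_normE /= ltr_norml.
have : s - d / 2 <= t by rewrite le_max lexx orbT.
move: d0; lra.
Qed.

(** The segment from [x] to [z'] meets the boundary, and the Lipschitz bound on [phi] shows that
    continuing to [z'] gains nothing. Minimality can thus be tested with straight exterior
    displacements instead of curves in the boundary. *)
Lemma closest_outside x z z' : U x -> rho_closest K U phi x z -> ~ U z' ->
  r x <= g (x - z') + phi z'.
Proof.
move=> Ux _ Uz'; have [t /andP[t0 t1] bt] := crossing Ux Uz'.
set b := x + _ in bt.
apply: le_trans (rho_le x bt) _.
have E1 : x - b = t *: (x - z') by apply/rowP => i; rewrite !mxE; ring.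
have E2 : b - z' = (1 - t) *: (x - z') by apply/rowP => i; rewrite !mxE; ring.
have := phi_le b z'; rewrite E1 E2 (gZ _ t0) gZ0 ?subr_ge0//; lra.
Qed.

Lemma closest_neq x z : U x -> rho_closest K U phi x z -> x - z != 0.
Proof.
move=> Ux [zU _]; rewrite subr_eq0; apply/eqP => xz.
by apply: (boundary_notin zU); rewrite -xz.
Qed.

(** A point of the ray outside [U] would compete with [z] by [closest_outside]; the strict bound of
    [potential_lt] would then give it a value below [r x]. *)
Lemma closest_segment_in x z t : U x -> rho_closest K U phi x z -> 0 < t <= 1 ->
  U (z + t *: (x - z)).
Proof.
move=> Ux xz /andP[t0 t1]; apply: contrapT => nU.
have := closest_outside Ux xz nU; set xt := z + _.
have E1 : xt - z = t *: (x - z) by rewrite /xt addrC addKr.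
have E2 : x - xt = (1 - t) *: (x - z) by apply/rowP => i; rewrite !mxE; ring.
have nz : xt != z.
  by rewrite -subr_eq0 E1 scaler_eq0 negb_or gt_eqF//= (closest_neq Ux xz).
have := phi_potential nz; rewrite E1 E2 (gZ _ t0) gZ0 ?subr_ge0//.
rewrite (closest_val xz); lra.
Qed.

(** Multiplier rule for one inequality constraint: a direction with [v . N < 0] leaves [U], so
    minimality gives [v . (q - p) >= 0] there. A form that is nonnegative on a half space is a
    multiple of its normal. *)
Lemma closest_multiplier x z H N : U x -> rho_closest K U phi x z ->
  defining U z H N ->
  exists2 l, 0 <= l & grad g (x - z) = grad phi z + l *: N z.
Proof.
move=> Ux xz def; have xz0 := closest_neq Ux xz.
have [zU rz] := xz.
have [_ bH sH _ N0] := nbhs_singleton def.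
have Hz : H z = 0 by exact/bH.
have [dH gH] := sgrad_differentiable sH.
have [dg _] := sgrad_differentiable (gauge_sgrad Kcompact Kconvex K0 Kdef xz0).
set p := grad _ _; set q := grad _ _.
have half v : dot v (N z) < 0 -> 0 <= dot v (q - p).
  move=> vN; apply/ler_addgt0Pr => e e0; have e20 : 0 < e / 2 by rewrite divr_gt0.
  have [t1 t10 h1] := dir_est (- v) dg e20.
  have [t2 t20 h2] := dir_est v (dphi z) e20.
  have vN2 : 0 < - dot v (N z) / 2 by rewrite divr_gt0// oppr_gt0.
  have [t3 t30 h3] := dir_est v dH vN2.
  have : \forall u \near z, interior U u -> 0 < H u.
    by apply: filterS def => u [[]].
  move=> /nbhs_ballP[d /= d0 hd]; have v1 : 0 < `|v| + 1 by rewrite ltr_wpDl.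
  pose m := Num.min (Num.min t1 t2) (Num.min t3 (d / (`|v| + 1))).
  have m0 : 0 < m by rewrite !lt_min t10 t20 t30 divr_gt0.
  have [t [t0 [tt1 tt2 tt3 td]]] :
    exists t, 0 < t /\ [/\ t < t1, t < t2, t < t3 & t < d / (`|v| + 1)].
    exists (m / 2); split; first by rewrite divr_gt0.
    have : m / 2 < m by rewrite ltr_pdivrMr// ltr_pMr// ltr1n.
    by rewrite {2}/m !lt_min => /andP[/andP[-> ->] /andP[-> ->]].
  have zt : ~ U (z + t *: v).
    move=> Uzt; have : 0 < H (z + t *: v).
      apply: hd; last by exact: open_nbhs_nbhs.
      rewrite -ball_normE /= opprD addrA subrr add0r normrN normrZ gtr0_norm//.
      apply: (@le_lt_trans _ _ (t * (`|v| + 1))); first by rewrite ler_pM2l// lerDl.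
      by rewrite -ltr_pdivlMr.
    have := h3 t; rewrite t0 tt3 Hz gH ler_norml => /(_ isT)/andP[_].
    have : t * dot v (N z) < 0 by rewrite pmulr_rlt0.
    lra.
  have := closest_outside Ux xz zt; rewrite (closest_val xz).
  have -> : x - (z + t *: v) = x - z + t *: - v by rewrite scalerN opprD addrA.
  have := h1 t; rewrite t0 tt1 ler_norml => /(_ isT)/andP[_].
  have := h2 t; rewrite t0 tt2 ler_norml => /(_ isT)/andP[_].
  rewrite dotNl -/p -/q dotBr => k1 k2 k3; rewrite -(ler_pM2l t0) mulr0 mulrDr mulrBr.
  lra.
have NN := dot_gt0 N0.
(* Passage to the closed half space: tilting [v] by a small multiple of [N z] changes the pairing by
   at most [e]. *)
have half' v : dot v (N z) <= 0 -> 0 <= dot v (q - p).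
  move=> vN; apply/ler_addgt0Pr => e e0.
  pose c := `|dot (N z) (q - p)| + 1; have c0 : 0 < c by rewrite ltr_wpDl.
  have ec : 0 < e / c by rewrite divr_gt0.
  have := half (v - (e / c) *: N z); rewrite !dotBl !dotZl => h.
  apply: le_trans (h _) _.
    have : 0 < e / c * dot (N z) (N z) by rewrite mulr_gt0.
    lra.
  rewrite lerD2l; apply: (@le_trans _ _ (e / c * c)); last by rewrite divfK// gt_eqF.
  rewrite -mulrN ler_pM2l//; apply: le_trans (ler_norm _) _.
  by rewrite normrN lerDl.
pose l := - dot (N z) (q - p) / dot (N z) (N z).
pose v := (q - p) + l *: N z.
have vN : dot v (N z) = 0.
  by rewrite dotDl dotZl /l divfK ?gt_eqF// (dotC (q - p)) subrr.
have v1 : 0 <= dot v (q - p) by apply: half'; rewrite vN.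
have v2 : 0 <= dot (- v) (q - p) by apply: half'; rewrite dotNl vN oppr0.
have v3 : dot v (q - p) = 0.
  by apply/eqP; rewrite eq_le v1 andbT -oppr_ge0 -dotNl.
have v0 : v = 0.
  apply/eqP/negPn/negP => /dot_gt0; rewrite {2}/v dotDr dotZr vN v3 mulr0 addr0 ltxx.
  by [].
exists l; last first.
  apply/eqP; rewrite -subr_eq0; apply/eqP; rewrite -[RHS]oppr0 -v0 /v.
  by apply/rowP => i; rewrite !mxE; ring.
rewrite /l divr_ge0 ?(ltW NN)//.
by have := half' (- N z); rewrite !dotNl oppr_le0 => /(_ (ltW NN)).
Qed.

Lemma closest_cvg (zc : 'rV[R]_n.+1 -> 'rV[R]_n.+1) x y :
  (forall u, rho_closest K U phi u (zc u)) -> boundary U y ->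
  (forall c, boundary U c -> g (x - c) + phi c <= g (x - y) + phi y -> c = y) ->
  forall e, 0 < e -> \forall u \near x, `|y - zc u| < e.
Proof.
move=> zcP yU uniq e e0.
have [C C0 gC] := gauge_le_norm K0.
pose D := boundary U `&` [set c | e <= `|y - c|].
have Dc : compact D.
  apply: compact_closedI; first exact: boundary_compact.
  move=> c cl; apply/ler_addgt0Pr => d d0.
  have [c' [/= ec' cc']] := cl _ (near_dist c d0).
  apply: (le_trans ec'); rewrite (_ : y - c' = (y - c) + (c - c')); last first.
    by rewrite addrA subrK.
  by rewrite (le_trans (ler_normD _ _))// lerD2l ltW.
have [D0|Dn] := pselect (D !=set0); last first.
  near=> u; rewrite ltNge; apply/negP => h; apply: Dn; exists (zc u); split => //.
  by have [] := zcP u.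
have [|c /[!inE] -[cU /= ce] cmin] := @EVT_min_rV R n.+1 (F x) D D0 Dc.
  by apply: continuous_subspaceT => z; exact: F_cont.
have gap : 0 < F x c - F x y.
  rewrite subr_gt0 ltNge; apply/negP => /uniq h; move: ce; rewrite h// subrr normr0.
  by rewrite leNgt e0.
have k0 : 0 < (F x c - F x y) / (2 * C) by rewrite divr_gt0// mulr_gt0.
have := near_dist x k0; apply: filterS => u xu.
rewrite ltNge; apply/negP => h; have [zU rz] := zcP u.
have h1 : F x c <= F x (zc u) by apply: cmin; rewrite inE.
have h2 : F x (zc u) <= F u (zc u) + g (x - u).
  have := gD (u - zc u) (x - u).
  rewrite /F (_ : u - zc u + (x - u) = x - zc u); first lra.
  by rewrite addrC addrA subrK.
have h3 : F u (zc u) <= F u y by rewrite /F -rz; exact: rho_le.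
have h4 : F u y <= F x y + g (u - x).
  have := gD (x - y) (u - x).
  rewrite /F (_ : x - y + (u - x) = u - y); first lra.
  by rewrite addrC addrA subrK.
have h5 := gC (x - u); have h6 := gC (u - x); rewrite (distrC u x) in h6.
have : C * `|x - u| < (F x c - F x y) / 2.
  rewrite mulrC -ltr_pdivlMr//; apply: lt_le_trans xu _.
  by rewrite invfM mulrA.
lra.
Unshelve. all: by end_near. Qed.

Lemma boundary_unique y c : boundary U c ->
  g (y - c) + phi c <= g (y - y) + phi y -> c = y.
Proof.
move=> cU; rewrite subrr g0 add0r => h; apply/esym/eqP/negPn/negP => /phi_potential.
by move: h; lra.
Qed.

(** With [z] fixed, [g (. - z) + phi z] lies above [rho] and touches it at [x], so the derivatives
    agree. *)
Lemma rho_grad x z : U x -> rho_closest K U phi x z -> differentiable r x ->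
  grad r x = grad g (x - z).
Proof.
move=> Ux xz dr; have xz0 := closest_neq Ux xz; have [zU rz] := xz.
have [dg _] := sgrad_differentiable (gauge_sgrad Kcompact Kconvex K0 Kdef xz0).
apply: dot_inj => v; apply/ler_addgt0Pr => e e0.
apply: dir_le => //; have [t0 t00 h] := dir_est v dg e0.
exists t0 => // t tt; have := h t tt; rewrite ler_norml => /andP[_].
have := rho_le (x + t *: v) zU; rewrite (closest_val xz) addrAC mulrDr.
lra.
Qed.

(* Envelope theorem: the convexity of the gauge gives the lower bound. *)
Lemma rho_differentiable (zc : 'rV[R]_n.+1 -> 'rV[R]_n.+1) x :
  (forall u, rho_closest K U phi u (zc u)) -> U x -> {for x, continuous zc} ->
  differentiable r x.
Proof.
move=> zcP Ux zcc; have xz0 := closest_neq Ux (zcP x).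
have [J sJ] := gauge_sdiff Kcompact Kconvex K0 Kdef xz0.
have [dg _] := sgrad_differentiable (gauge_sgrad Kcompact Kconvex K0 Kdef xz0).
have [] := @differentiable_dot R n.+1 r x (grad g (x - zc x)); last by [].
move=> e e0.
have pc : {for x, continuous (fun u => grad g (x - zc u))}.
  apply: (@continuous_comp _ _ _ (fun u => x - zc u) (grad g)); last exact: sdiff_continuous sJ.
  by apply: continuousB => //; exact: continuous_at_cst.
have nz : \forall u \near x, x - zc u != 0.
  have c : {for x, continuous (fun u => x - zc u)}.
    by apply: continuousB => //; exact: continuous_at_cst.
  have e1 : 0 < `|x - zc x| / 2 by rewrite divr_gt0// normr_gt0.
  move/continuous_eps : c => /(_ _ e1); apply: filterS => u.
  apply: contraTneq => ->; rewrite subr0 -ltNge ltr_pdivrMr// ltr_pMr ?normr_gt0//.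
  by rewrite ltr1n.
have n1 : 0 < n.+1%:R :> R by [].
move/continuous_eps : pc => /(_ _ (divr_gt0 e0 n1)) pc.
have /nbhs_ballP[d /= d0 hd] : \forall u \near x, x - zc u != 0 /\
    `|grad g (x - zc x) - grad g (x - zc u)| <= e / n.+1%:R.
  by near=> u; split; near: u.
have := near_dist (0 : 'rV[R]_n.+1) d0.
have := differentiable_dotP dg e0; apply: filterS2 => h est hd0.
rewrite sub0r normrN in hd0.
have [zU _] := zcP (h + x).
have /hd[nzh ph] : ball x d (h + x).
  by rewrite -ball_normE /= opprD addrCA subrr addr0 normrN.
rewrite ler_norml; apply/andP; split; last first.
  move: est; rewrite ler_norml => /andP[_]; have [zxU _] := zcP x.
  have := rho_le (h + x) zxU; rewrite (closest_val (zcP x)) addrA; lra.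
(* The supporting form of [g] at [x - zc (h + x)] is compared with [g] at [h + x - zc (h + x)]; only
   continuity of [zc] is then needed. *)
have low : dot h (grad g (x - zc (h + x))) <= r (h + x) - r x.
  have := rho_le x zU; rewrite (closest_val (zcP (h + x))).
  have := grad_gauge_le Kcompact Kconvex K0 Kdef (h + (x - zc (h + x))) nzh.
  rewrite dotDl grad_gauge_self// -/g addrA; lra.
have : `|dot h (grad g (x - zc x) - grad g (x - zc (h + x)))| <= e * `|h|.
  apply: le_trans (norm_dot _ _) _.
  rewrite mulrAC -mulrA mulrA; apply: (@le_trans _ _ (n.+1%:R * (e / n.+1%:R) * `|h|)).
    by rewrite ler_wpM2r// ler_pM2l.
  by rewrite mulrCA divff ?mulr1// gt_eqF.
rewrite dotBr ler_norml => /andP[_ up].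
by rewrite lerNl opprB; apply: le_trans up; rewrite lerD2l lerN2.
Unshelve. all: by end_near. Qed.

End Closest.
End Obstacle.

(** * Regularity of the obstacle *)

Lemma sdiff_unique {R : realType} {m n : nat} (f : 'rV[R]_m -> 'rV[R]_n) (x : 'rV[R]_m) J J' :
  sdiff f (nbhs x) J -> sdiff f (nbhs x) J' -> J = J'.
Proof.
move=> sJ sJ'; apply/matrixP => i j.
pose proof (coord_sdiff j sJ) as s; pose proof (coord_sdiff j sJ') as s'.
have [_ e] := sgrad_differentiable s; have [_ e'] := sgrad_differentiable s'.
by have := etrans (esym e) e'; move=> /rowP/(_ i); rewrite !mxE.
Qed.

Lemma cvg_dot {R : realType} {n : nat} {T : Type} (F : set_system T) {FF : Filter F}
    (f h : T -> 'rV[R]_n) (a b : 'rV[R]_n) :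
  f @ F --> a -> h @ F --> b -> (fun t => dot (f t) (h t)) @ F --> dot a b.
Proof.
move=> fa hb.
have dotr_cvg (k : T -> 'rV[R]_n) (c v : 'rV[R]_n) :
    k @ F --> c -> (fun t => dot (k t) v) @ F --> dot c v.
  move=> kc; have dc : {for c, continuous (fun x => dot x v)} by exact: dotr_continuous.
  exact: (cvg_comp _ _ kc dc).
have -> : dot a b = dot a b + 0 by rewrite addr0.
have -> : (fun t => dot (f t) (h t)) = (fun t => dot (f t) b + dot (f t) (h t - b)).
  by apply/funext => t; rewrite dotBr addrC subrK.
apply: cvgD; first exact: dotr_cvg.
have [C C0 fC] := cvg_bounded fa.
apply/cvgr0Pnorm_le => e e0.
have n1 : 0 < n.+1%:R * C by rewrite mulr_gt0.
move/cvgrPdist_le : hb => /(_ _ (divr_gt0 e0 n1)) hb.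
near=> t; apply: le_trans (norm_dot _ _) _.
have h1 : `|f t| <= C by near: t.
have h2 : `|h t - b| <= e / (n.+1%:R * C) by rewrite distrC; near: t.
apply: (@le_trans _ _ (n.+1%:R * C * (e / (n.+1%:R * C)))).
  by rewrite ler_pM ?mulr_ge0// ler_pM// ler_nat.
by rewrite mulrCA divff ?mulr1// gt_eqF.
Unshelve. all: by end_near. Qed.

Section GradientLipschitz.
Context {R : realType} {n : nat} {T : Type} (F : set_system T) {FF : Filter F}.
Variables (dp de : T -> 'rV[R]_n) (p0 : 'rV[R]_n) (Hg S : 'M[R]_n).
Hypothesis hp : small F (fun t => dp t - de t *m Hg) (fun t => `|de t|).
Hypothesis hp0 : small F (fun t => dot (de t) p0) (fun t => `|de t|).
Hypothesis hS : (Hg + p0^T *m p0) *m S = 1%:M.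

(** Inverts the map from unit directions to gradients to first order, with the same completion of
    the singular [Hg] by a rank one term as above. It turns the Lipschitz bound on [grad rho] into
    one on ray directions. *)
Lemma big_direction (h : T -> R) : (forall t, 0 <= h t) -> big F dp h -> big F de h.
Proof.
move=> h0 bp; apply: (@big_absorb _ _ _ _ _ _ (fun t => dp t *m S)) => //; last exact: big_mulmx.
have k : small F (fun t => (- (dp t - de t *m Hg) + dot (de t) p0 *: p0) *m S)
    (fun t => `|de t|).
  by apply: small_mulmx; apply: smallD; [exact: smallN|exact: small_scale_vec].
have b : big F (fun t => `|de t|) (fun t => `|de t| + h t).
  exists 1 => //; near=> t; by rewrite mul1r normr_id lerDl.
apply: (small_near _ (small_trans k b)); near=> t.
rewrite -mulmx_trr opprB addrAC -mulmxDr.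
by rewrite mulmxBl -mulmxA hS mulmx1.
Unshelve. all: by end_near. Qed.

End GradientLipschitz.

(** * Rays: foot, direction, length and multiplier as functions of the point *)

Section Rays.
Context {R : realType} {n : nat}.
Variables (K U : set 'rV[R]_n.+1) (phi : 'rV[R]_n.+1 -> R).
Hypothesis Kcompact : compact K.
Hypothesis Kconvex : convex_set (K : set (convex_lmodType 'rV[R]_n.+1)).
Hypothesis K0 : interior K 0.
Hypothesis Kdef : forall y, boundary K y -> exists H N, defining K y H N.
Hypothesis Kker : forall e J v, gauge K e = 1 -> sdiff (grad (gauge K)) (nbhs e) J ->
  v *m J = 0 -> exists k, v = k *: e.
Hypothesis Uopen : open U.
Hypothesis Ubounded : bounded_set U.
Hypothesis dphi : forall z, differentiable phi z.
Hypothesis phi_lt : forall z, gauge (polar K) (grad phi z) < 1.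
Hypothesis phi2 : forall z : 'rV[R]_n.+1, exists J, sdiff (grad phi) (nbhs z) J.
Variables (y : 'rV[R]_n.+1) (H : 'rV[R]_n.+1 -> R) (N : 'rV[R]_n.+1 -> 'rV[R]_n.+1).
Hypothesis yU : boundary U y.
Hypothesis def : defining U y H N.
Variable zc : 'rV[R]_n.+1 -> 'rV[R]_n.+1.
Hypothesis zcP : forall u, rho_closest K U phi u (zc u).
Implicit Types (x z u v e c : 'rV[R]_n.+1).

Let g := gauge K.
Let r := rho K U phi.

Definition ray_length u := gauge K (u - zc u).
Definition ray_dir u := (ray_length u)^-1 *: (u - zc u).
(** The multiplier solved from the rule by pairing with the ray direction, on which [grad g] is 1.
    Its limit then follows from the limits of foot and direction. *)
Definition ray_mult u :=
  (1 - dot (ray_dir u) (grad phi (zc u))) / dot (ray_dir u) (N (zc u)).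

Let sc := ray_length.
Let ec := ray_dir.
Let lc := ray_mult.

Let closest_neq u (Uu : U u) : u - zc u != 0 :=
  closest_neq Uopen Uu (zcP u).

Let g_neq0 x : g x = 1 -> x != 0.
Proof.
move=> gx; apply/eqP => x0; move: gx; rewrite x0 /g gauge0// => /esym/eqP.
by rewrite oner_eq0.
Qed.

Lemma ray_length_gt0 u : U u -> 0 < sc u.
Proof. by move=> /closest_neq; exact: gauge_gt0. Qed.

Lemma ray_end u : U u -> zc u + sc u *: ec u = u.
Proof.
move=> Uu; rewrite /ec /ray_dir scalerA divff ?scale1r; first by rewrite addrC subrK.
by rewrite gt_eqF// ray_length_gt0.
Qed.

Lemma gauge_ray_dir u : U u -> g (ec u) = 1.
Proof.
move=> Uu; rewrite /g /ec /ray_dir gaugeZ ?invr_gt0 ?ray_length_gt0//.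
by rewrite mulVf// gt_eqF// ray_length_gt0.
Qed.

Lemma grad_ray_dir u : U u -> grad g (ec u) = grad g (u - zc u).
Proof.
move=> Uu; rewrite /ec /ray_dir grad_gaugeZ ?invr_gt0 ?ray_length_gt0//.
exact: closest_neq.
Qed.

(** Pairing the rule with the direction gives [l (e . N) = 1 - e . grad phi], positive by the bound
    on [grad phi]. As [l >= 0], both factors are positive. *)
Lemma ray_multiplier u : U u -> defining U (zc u) H N ->
  [/\ 0 < dot (ec u) (N (zc u)), 0 < lc u &
      grad g (ec u) = grad phi (zc u) + lc u *: N (zc u)].
Proof.
move=> Uu du.
have [l l0 pE] := closest_multiplier Kcompact Kconvex K0 Kdef Uopen Ubounded dphi
  phi_lt yU Uu (zcP u) du.
rewrite -/g -grad_ray_dir// in pE.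
have e1 := gauge_ray_dir Uu; have e0 := g_neq0 e1.
have ep : dot (ec u) (grad g (ec u)) = 1 by rewrite /g grad_gauge_self.
have q1 : dot (ec u) (grad phi (zc u)) < 1.
  by rewrite -e1 dotC; exact: (polar_lt Kcompact Kconvex K0 (phi_lt _) e0).
have lN : l * dot (ec u) (N (zc u)) = 1 - dot (ec u) (grad phi (zc u)).
  by rewrite -ep pE dotDr dotZr; ring.
have lN0 : 0 < l * dot (ec u) (N (zc u)) by rewrite lN subr_gt0.
have l_gt0 : 0 < l.
  by rewrite lt_neqAle l0 andbT; apply: contraTneq lN0 => <-; rewrite mul0r ltxx.
have N_gt0 : 0 < dot (ec u) (N (zc u)) by move: lN0; rewrite pmulr_rgt0.
have lE : lc u = l by rewrite /lc /ray_mult -/ec -lN mulfK// gt_eqF.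
by rewrite lE.
Qed.

(** If [v] is annihilated, pairing with [e] gives [v . grad g e = 0] because [J e^T = 0]. Then
    [v J = 0], so [v] is radial, and the vanishing pairing makes it 0. *)
Lemma hess_gauge_unit e J : g e = 1 -> sdiff (grad g) (nbhs e) J ->
  exists S, (J + (grad g e)^T *m grad g e) *m S = 1%:M.
Proof.
move=> e1 sJ; have e0 := g_neq0 e1.
have ep : dot e (grad g e) = 1 by rewrite /g grad_gauge_self.
have Je : J *m e^T = 0 := hess_gauge_self Kcompact Kconvex K0 Kdef e0 sJ.
exists (invmx (J + (grad g e)^T *m grad g e)); apply: mulmxV.
apply: mulmx_inj_unit => v; rewrite mulmxDr mulmx_trr => vJ.
have vp : dot v (grad g e) = 0.
  have /(congr1 (fun w => dot w e)) := vJ.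
  rewrite dotDl dotZl (dotC (grad g e)) ep mulr1 dot0l dot_mulmx.
  have -> : e *m J^T = (J *m e^T)^T by rewrite trmx_mul trmxK.
  by rewrite Je trmx0 dot0r add0r.
move: vJ; rewrite vp scale0r addr0 => /(Kker e1 sJ)[k vE].
by move: vp; rewrite vE dotZl ep mulr1 => ->; rewrite scale0r.
Qed.

Section Along.
Variables (F : set_system 'rV[R]_n.+1) (e0 : 'rV[R]_n.+1) (s0 : R).
Context {FF : Filter F}.
Hypothesis FU : \forall u \near F, U u.
Hypothesis zF : zc @ F --> y.
Hypothesis eF : ec @ F --> e0.
Hypothesis sF : sc @ F --> s0.
Hypothesis e01 : g e0 = 1.
Hypothesis eN0 : dot e0 (N y) != 0.

Let F2 := filter_prod F F.
Let near1 (P : set 'rV[R]_n.+1) : F P -> \forall t \near F2, P t.1.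
Proof. by move=> FP; exists (P, setT); [split => //; exact: filterT|move=> t []]. Qed.
Let near2 (P : set 'rV[R]_n.+1) : F P -> \forall t \near F2, P t.2.
Proof. by move=> FP; exists (setT, P); [split => //; exact: filterT|move=> t []]. Qed.

Let dt (t : 'rV[R]_n.+1 * 'rV[R]_n.+1) := `|t.1 - t.2|.
Let de t := ec t.1 - ec t.2.
Let dz t := zc t.1 - zc t.2.

Let Nc : {for y, continuous N}.
Proof. by have [_ _ _ [J /sdiff_continuous]] := nbhs_singleton def. Qed.

Let lF : lc @ F --> (1 - dot e0 (grad phi y)) / dot e0 (N y).
Proof.
have qc : {for y, continuous (grad phi)}.
  by have [J] := phi2 y; exact: sdiff_continuous.
apply: cvgM.
  apply: cvgB; first exact: cvg_cst.
  by apply: cvg_dot => //; exact: (cvg_comp _ _ zF qc).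
by apply: cvgV => //; apply: cvg_dot => //; exact: (cvg_comp _ _ zF Nc).
Qed.

Lemma big_ray_dir : big F2 (fun t => grad g (ec t.1) - grad g (ec t.2)) dt -> big F2 de dt.
Proof.
have [J sJ] := gauge_sdiff Kcompact Kconvex K0 Kdef (g_neq0 e01).
have [S hS] := hess_gauge_unit e01 sJ.
pose proof (small_comp (pair_cvg eF) sJ) as hp.
pose proof (small_comp (pair_cvg eF) (gauge_sgrad Kcompact Kconvex K0 Kdef (g_neq0 e01))) as k.
apply: (big_direction hp _ hS) => [|t]; last exact: normr_ge0.
apply: (small_near _ (smallN k)).
have Fe : \forall u \near F, g (ec u) = 1 by apply: filterS FU => u; exact: gauge_ray_dir.
have h1 := near1 Fe; have h2 := near2 Fe; near=> t; rewrite /=.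
have -> : (gauge K (ec t.1)) = 1 by near: t.
have -> : (gauge K (ec t.2)) = 1 by near: t.
by rewrite subrr sub0r opprK.
Unshelve. all: by end_near. Qed.

(** Instance of the sensitivity analysis: [dz] is tangent to first order since [H] vanishes at the
    feet, and [de] is since [g] is 1 on the directions. The clauses on [L] and [P] are what
    invertibility of [L] requires: [e0] is in the range of [L], and the range of [P] together with
    [e0] spans the space. *)
Lemma ray_sensitivity : s0 = 0 \/ big F2 de dt -> exists L P E : 'M[R]_n.+1,
  [/\ s0 = 0 -> L = 1%:M, e0 *m L = e0,
      forall v, exists k, v = v *m P + k *: e0,
      small F2 (fun t => dz t *m L - (t.1 - t.2) *m P) dt &
      big F2 de dt /\ big F2 dz dt /\ forall B, L *m B = 1%:M -> sdiff ec F (P *m B *m E)].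
Proof.
move=> hbig.
have [J sJ] := gauge_sdiff Kcompact Kconvex K0 Kdef (g_neq0 e01).
have [S hS] := hess_gauge_unit e01 sJ.
have [Phi sPhi] := phi2 y.
have [_ bH sH [Nz sN] _] := nbhs_singleton def.
have ep : dot e0 (grad g e0) = 1 by rewrite /g grad_gauge_self// g_neq0.
have Je : J *m e0^T = 0 := hess_gauge_self Kcompact Kconvex K0 Kdef (g_neq0 e01) sJ.
have hz : \forall t \near F2, zc t.1 + sc t.1 *: ec t.1 - (zc t.2 + sc t.2 *: ec t.2) = t.1 - t.2.
  have h1 := near1 FU; have h2 := near2 FU; near=> t.
  by rewrite !ray_end//; near: t.
pose proof (small_comp (pair_cvg eF) sJ) as hp.
pose proof (small_comp (pair_cvg zF) sPhi) as hq.
pose proof (small_comp (pair_cvg zF) sN) as hN.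
pose proof (small_comp (pair_cvg eF) (gauge_sgrad Kcompact Kconvex K0 Kdef (g_neq0 e01))) as kp.
pose proof (small_comp (pair_cvg zF) sH) as kH.
have hp0 : small F2 (fun t => dot (ec t.1 - ec t.2) (grad g e0)) (fun t => `|ec t.1 - ec t.2|).
  apply: (small_near _ (smallN kp)).
  have Fe : \forall u \near F, g (ec u) = 1 by apply: filterS FU => u; exact: gauge_ray_dir.
  have h1 := near1 Fe; have h2 := near2 Fe; near=> t; rewrite /=.
  have -> : (gauge K (ec t.1)) = 1 by near: t.
  have -> : (gauge K (ec t.2)) = 1 by near: t.
  by rewrite subrr sub0r opprK.
have Fdef : \forall u \near F, defining U (zc u) H N.
  exact: (zF (near_defining def)).
have hN0 : small F2 (fun t => dot (zc t.1 - zc t.2) (N y)) (fun t => `|zc t.1 - zc t.2|).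
  apply: (small_near _ (smallN kH)).
  have FH : \forall u \near F, H (zc u) = 0.
    apply: filterS Fdef => u du; have [_ bu _ _ _] := nbhs_singleton du.
    by apply/bu; have [] := zcP u.
  have h1 := near1 FH; have h2 := near2 FH; near=> t; rewrite /=.
  have -> : H (zc t.1) = 0 by near: t.
  have -> : H (zc t.2) = 0 by near: t.
  by rewrite subrr sub0r opprK.
have Fm : \forall u \near F, grad g (ec u) = grad phi (zc u) + lc u *: N (zc u).
  apply: filterS2 FU Fdef => u Uu du; by have [] := ray_multiplier Uu du.
have Nf : (N \o zc) @ F --> N y by exact: (cvg_comp _ _ zF Nc).
have cdz := sens_big_dz hz hp hq hN hN0 hp0 (near1 Fm) (near2 Fm) (snd_cvg eF) (snd_cvg Nf)
  (fst_cvg lF) (fst_cvg sF) eN0 ep Je hS hbig.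
have cde := sens_big_de_h hz hp hq hN hN0 hp0 (near1 Fm) (near2 Fm) (snd_cvg eF) (snd_cvg Nf)
  (fst_cvg lF) (fst_cvg sF) eN0 ep Je hS hbig.
have cL := sens_dzL hz hp hq hN hN0 hp0 (near1 Fm) (near2 Fm) (snd_cvg eF) (snd_cvg Nf)
  (fst_cvg lF) (fst_cvg sF) eN0 ep Je hS hbig.
pose l0 := (1 - dot e0 (grad phi y)) / dot e0 (N y).
have cE B (LB : sens_L e0 (N y) s0 l0 Phi Nz S *m B = 1%:M) :=
  sens_e hz hp hq hN hN0 hp0 (near1 Fm) (near2 Fm) (snd_cvg eF) (snd_cvg Nf)
  (fst_cvg lF) (fst_cvg sF) eN0 ep Je hS hbig LB.
exists (sens_L e0 (N y) s0 l0 Phi Nz S), (sens_P e0 (N y)), (sens_E e0 (N y) l0 Phi Nz S); split.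
- by move=> ->; rewrite /sens_L scale0r addr0.
- exact: sens_e0L.
- move=> v; exists ((dot e0 (N y))^-1 * dot v (N y)).
  by rewrite /sens_P mulmxBr mulmx1 -scalemxAr mulmx_trr scalerA subrK.
- exact: cL.
- split; [exact: cde|split; [exact: cdz|exact: cE]].
Unshelve. all: by end_near. Qed.

End Along.

End Rays.

Section Regularity.
Context {R : realType} {n : nat}.
Variables (K U : set 'rV[R]_n.+1) (phi : 'rV[R]_n.+1 -> R).
Hypothesis Kcompact : compact K.
Hypothesis Kconvex : convex_set (K : set (convex_lmodType 'rV[R]_n.+1)).
Hypothesis K0 : interior K 0.
Hypothesis Kdef : forall y, boundary K y -> exists H N, defining K y H N.
Hypothesis Kker : forall e J v, gauge K e = 1 -> sdiff (grad (gauge K)) (nbhs e) J ->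
  v *m J = 0 -> exists k, v = k *: e.
Hypothesis Uopen : open U.
Hypothesis Ubounded : bounded_set U.
Hypothesis dphi : forall z, differentiable phi z.
Hypothesis phi_lt : forall z, gauge (polar K) (grad phi z) < 1.
Hypothesis phi2 : forall z : 'rV[R]_n.+1, exists J, sdiff (grad phi) (nbhs z) J.
Variable zc : 'rV[R]_n.+1 -> 'rV[R]_n.+1.
Hypothesis zcP : forall u, rho_closest K U phi u (zc u).
Implicit Types (x y z u v e c : 'rV[R]_n.+1).

Let g := gauge K.
Let r := rho K U phi.
Let sc := ray_length K zc.
Let ec := ray_dir K zc.
Let p u := grad g (ec u).

Let zcU u : boundary U (zc u). Proof. by have [] := zcP u. Qed.

Let g_neq0 x : g x = 1 -> x != 0.
Proof.
move=> gx; apply/eqP => x0; move: gx; rewrite x0 /g gauge0// => /esym/eqP.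
by rewrite oner_eq0.
Qed.

Let ge u (Uu : U u) : g (ec u) = 1 :=
  gauge_ray_dir Kcompact Kconvex K0 Uopen zcP Uu.

Let g_cont x : {for x, continuous g}.
Proof. exact: gauge_continuous. Qed.

Let grad_g_cont c : c != 0 -> {for c, continuous (grad g)}.
Proof.
by move=> /(gauge_sdiff Kcompact Kconvex K0 Kdef)[J]; exact: sdiff_continuous.
Qed.

Let grad_phi_cont z : {for z, continuous (grad phi)}.
Proof. by have [J] := phi2 z; exact: sdiff_continuous. Qed.

Lemma grad_rho u : U u -> differentiable r u -> grad r u = p u.
Proof.
move=> Uu du; rewrite /p /ec /g (grad_ray_dir Kcompact Kconvex K0 Kdef Uopen zcP Uu).
exact: (rho_grad Kcompact Kconvex K0 Kdef Uopen Ubounded dphi (zcU u) Uu (zcP u) du).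
Qed.

Let sc_cont x : {for x, continuous zc} -> {for x, continuous sc}.
Proof.
move=> zx; apply: (@continuous_comp _ _ _ (fun u => u - zc u) g); last exact: g_cont.
by apply: continuousB => //; exact: continuous_at_id.
Qed.

Let ec_cont x : U x -> {for x, continuous zc} -> {for x, continuous ec}.
Proof.
move=> Ux zx; apply: continuous_at_scale; last first.
  by apply: continuousB => //; exact: continuous_at_id.
apply: continuous_at_inv; last exact: sc_cont.
by rewrite gt_eqF// (ray_length_gt0 Kcompact K0 Uopen zcP).
Qed.

(* The Lipschitz bound makes the displacements of the closest point and of the
   ray direction O(h), so every h P is dz L + o(h): the matrix L is surjective,
   that is, x is not a focal point. *)
Lemma rho_twice_differentiable x H N : U x -> {for x, continuous zc} ->
  defining U (zc x) H N -> (\forall u \near x, differentiable r u) ->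
  big (filter_prod (nbhs x) (nbhs x)) (fun t => grad r t.1 - grad r t.2)
    (fun t => `|t.1 - t.2|) ->
  exists J, sdiff (grad r) (nbhs x) J.
Proof.
move=> Ux zx def dr br.
have Un : \forall u \near x, U u by exact: open_nbhs_nbhs.
have grE : \forall u \near x, grad r u = p u.
  by apply: filterS2 Un dr => u Uu; exact: grad_rho.
have bp : big (filter_prod (nbhs x) (nbhs x)) (fun t => p t.1 - p t.2) (fun t => `|t.1 - t.2|).
  apply: big_near br; exists ((fun u => grad r u = p u), (fun u => grad r u = p u)) => //.
  by move=> [u v] [/= -> ->].
have [eN _ _] := ray_multiplier Kcompact Kconvex K0 Kdef Uopen Ubounded dphi phi_lt
  (zcU x) zcP Ux def.
have ecx := ec_cont Ux zx.
pose proof (big_ray_dir Kcompact Kconvex K0 Kdef Kker Uopen zcP Un ecx (ge Ux) bp) as be.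
have [L [P [E [_ e0L vP dzL [_ [_ eP]]]]]] :=
  ray_sensitivity Kcompact Kconvex K0 Kdef Kker Uopen Ubounded dphi phi_lt phi2
  (zcU x) def zcP Un zx ecx (sc_cont zx) (ge Ux) (lt0r_neq0 eN) (or_intror be).
(* Multiplying [dz L = h P + o(h)] by the cokernel of [L] shows that the linear map [P *m cokermx L]
   is o(h); uniqueness of strict derivatives makes it 0. *)
have PC : P *m cokermx L = 0.
  have s0 : sdiff (fun u => u *m (P *m cokermx L) + 0) (nbhs x) 0.
    apply: (small_near _ (smallN (small_mulmx (cokermx L) dzL))); near=> t.
    rewrite mulmxBl -mulmxA mulmx_coker !mulmx0 sub0r opprK !addr0 subr0.
    by rewrite -mulmxA mulmxBl.
  by apply: sdiff_unique s0; exact: sdiff_affine.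
(* Every row is [v P + k e0]. The cokernel annihilates the first term by [PC], and the second
   because [e0 = e0 L]. *)
have Lunit : L \in unitmx.
  rewrite -row_full_unit -cokermx_eq0; apply/eqP/row_matrixP => i.
  rewrite row0 rowE; have [k ->] := vP (delta_mx 0 i).
  rewrite mulmxDl -mulmxA PC mulmx0 -scalemxAl -e0L -mulmxA mulmx_coker mulmx0 scaler0 addr0.
  by [].
have se := eP _ (mulmxV Lunit).
have [J sJ] := gauge_sdiff Kcompact Kconvex K0 Kdef (g_neq0 (ge Ux)).
pose proof (sdiff_comp ecx se sJ) as sp.
eexists; apply: sdiff_near sp.
by apply: filterS grE => u ->.
Unshelve. all: by end_near. Qed.

(** A half line starting inside the polar body leaves it only once: the form [grad g e2] lies below
    [g], so testing it on [e1] gives [e1 . q + l2 (e1 . N) <= 1 = e1 . q + l1 (e1 . N)], where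
    [e1 . N > 0]. *)
Lemma multiplier_unique e1 e2 q N l1 l2 : g e1 = 1 -> g e2 = 1 -> dot e1 q < 1 ->
  grad g e1 = q + l1 *: N -> grad g e2 = q + l2 *: N -> 0 < l1 -> l1 <= l2 -> l1 = l2.
Proof.
move=> ge1 ge2 q1 p1 p2 l10 l12.
have e10 := g_neq0 ge1; have e20 := g_neq0 ge2.
have h1 : dot e1 q + l1 * dot e1 N = 1.
  by rewrite -dotZr -dotDr -p1 /g grad_gauge_self.
have h2 : dot e1 q + l2 * dot e1 N <= 1.
  rewrite -dotZr -dotDr -p2 -ge1; exact: (grad_gauge_le Kcompact Kconvex K0 Kdef _ e20).
have N0 : 0 < dot e1 N by rewrite -(pmulr_rgt0 _ l10); lra.
by apply/eqP; rewrite eq_le l12 -(ler_pM2r N0); lra.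
Qed.

Lemma direction_unique e1 e2 q N l1 l2 : g e1 = 1 -> g e2 = 1 ->
  dot e1 q < 1 -> dot e2 q < 1 ->
  grad g e1 = q + l1 *: N -> grad g e2 = q + l2 *: N -> 0 < l1 -> 0 < l2 -> e1 = e2.
Proof.
move=> ge1 ge2 q1 q2 p1 p2 l10 l20.
have l12 : l1 = l2.
  have [l12|/ltW l21] := leP l1 l2.
    exact: (multiplier_unique ge1 ge2 q1 p1 p2 l10 l12).
  by rewrite (multiplier_unique ge2 ge1 q2 p2 p1 l20 l21).
have [J sJ] := gauge_sdiff Kcompact Kconvex K0 Kdef (g_neq0 ge2).
apply: (grad_gauge_inj Kcompact Kconvex K0 Kdef sJ) => //.
  by move=> v; exact: Kker.
by rewrite -/g p1 p2 l12.
Qed.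

(** * Approach to a boundary point from inside *)

Section AtBoundary.
Variables (x : 'rV[R]_n.+1) (H : 'rV[R]_n.+1 -> R) (N : 'rV[R]_n.+1 -> 'rV[R]_n.+1).
Hypothesis Ux : U x.
Let y := zc x.
Hypothesis def : defining U y H N.

Let F := within U (nbhs y).

Let FF : ProperFilter F.
Proof. by apply: within_nbhs_proper; have [] := zcU x. Qed.

Let FU : \forall u \near F, U u.
Proof. exact: withinT. Qed.

Let zcF : zc @ F --> y.
Proof.
have zy : zc y = y.
  have [zyU rzy] := zcP y; apply: (boundary_unique Kcompact Kconvex K0 dphi phi_lt zyU).
  rewrite -rzy; exact: (rho_le Kconvex K0 Ubounded dphi (zcU x) y (zcU x)).
apply: cvg_within_filter => B; rewrite -{1}zy => By.
have : {for y, continuous zc}; last exact.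
apply/continuous_eps => e e0; rewrite zy.
have := closest_cvg Kconvex K0 Ubounded dphi (zcU x) zcP (zcU x)
  (@boundary_unique _ _ K U phi Kcompact Kconvex K0 dphi phi_lt y) e0.
by apply: filterS => u /ltW.
Qed.

Let Ncont : {for y, continuous N}.
Proof. by have [_ _ _ [J /sdiff_continuous]] := nbhs_singleton def. Qed.

Let Fdef : \forall u \near F, defining U (zc u) H N.
Proof. exact: (zcF (near_defining def)). Qed.

Let q1 u c : g c = 1 -> dot c (grad phi u) < 1.
Proof.
by move=> gc; rewrite dotC -gc; exact: (polar_lt Kcompact Kconvex K0 (phi_lt _) (g_neq0 gc)).
Qed.

Let mult u : U u -> defining U (zc u) H N ->
  [/\ 0 < dot (ec u) (N (zc u)), 0 < ray_mult K phi N zc u &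
      p u = grad phi (zc u) + ray_mult K phi N zc u *: N (zc u)].
Proof.
exact: (ray_multiplier Kcompact Kconvex K0 Kdef Uopen Ubounded dphi phi_lt (zcU x) zcP).
Qed.

(* Any other limit direction at y would give a second solution of the
   multiplier equation at y. *)
Let other_direction c : g c = 1 -> c != ec x ->
  \forall t \near filter_prod (nbhs c) F, ec t.2 != t.1.
Proof.
move=> gc cx; pose FF2 := filter_prod (nbhs c) F.
have fst2 : fst @ FF2 --> c by exact: cvg_fst.
have zc2 : (fun t => zc t.2) @ FF2 --> y.
  by apply: cvg_comp zcF; exact: cvg_snd.
have N2 : (fun t => N (zc t.2)) @ FF2 --> N y by exact: (cvg_comp _ _ zc2 Ncont).
have q2 : (fun t => grad phi (zc t.2)) @ FF2 --> grad phi y.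
  exact: (cvg_comp _ _ zc2 (@grad_phi_cont y)).
have p2 : (fun t => grad g t.1) @ FF2 --> grad g c.
  exact: (cvg_comp _ _ fst2 (grad_g_cont (g_neq0 gc))).
pose Phi (c z : 'rV[R]_n.+1) (p N q : 'rV[R]_n.+1) := dot c N *: (p - q) - (1 - dot c q) *: N.
(* This is the multiplier equation with the multiplier eliminated and the denominator cleared, so it
   stays continuous where [c . N] vanishes. It holds exactly when the trial direction is the ray
   direction [ec t.2], hence a nonzero limit at [c] rules out directions near [c]. *)
have Phi2 : (fun t => dot t.1 (N (zc t.2)) *: (grad g t.1 - grad phi (zc t.2))
    - (1 - dot t.1 (grad phi (zc t.2))) *: N (zc t.2)) @ FF2
    --> dot c (N y) *: (grad g c - grad phi y) - (1 - dot c (grad phi y)) *: N y.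
  apply: cvgB; apply: cvgZ => //.
  - by apply: cvg_dot.
  - by apply: cvgB.
  - by apply: cvgB; [exact: cvg_cst|exact: cvg_dot].
have ev : \forall t \near FF2, U t.2 /\ defining U (zc t.2) H N.
  exists (setT, [set u | U u /\ defining U (zc u) H N]).
    by split; [exact: filterT|apply: filterI; [exact: FU|exact: Fdef]].
  by move=> t [].
have [Phi0|Phi0] := eqVneq (dot c (N y) *: (grad g c - grad phi y)
    - (1 - dot c (grad phi y)) *: N y) 0; last first.
  move/cvgr_neq0 : Phi2 => /(_ Phi0); apply: filterS2 ev => t [Ut dt].
  apply: contra_neq => <-; have [eN l0 pE] := mult Ut dt.
  rewrite -/(p t.2) pE [grad phi _ + _]addrC addrK scalerA -scalerBl.
  rewrite /ray_mult mulrC divfK ?gt_eqF//.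
  by rewrite subrr scale0r.
have [cN|cN] := ltP (dot c (N y)) 0.
  have : (fun t => dot t.1 (N (zc t.2))) @ FF2 --> dot c (N y) by exact: cvg_dot.
  move=> /cvgr_lt/(_ 0 cN); apply: filterS2 ev => t [Ut dt].
  apply: contraTneq => <-; have [eN _ _] := mult Ut dt.
  by rewrite -leNgt ltW.
exfalso; move/eqP : cx; apply.
have [_ _ _ _ Ny0] := nbhs_singleton def.
have [_ l0 px] := mult Ux def.
have cq : 0 < 1 - dot c (grad phi y) by rewrite subr_gt0; exact: q1.
have cN0 : 0 < dot c (N y).
  rewrite lt_neqAle cN andbT; apply/eqP => cN0; move: Phi0 => /eqP.
  by rewrite -cN0 scale0r sub0r oppr_eq0 scaler_eq0 (negPf Ny0) gt_eqF.
apply: (direction_unique gc (ge Ux) (q1 _ gc) (q1 _ (ge Ux)) _ px _ l0).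
  have -> : grad g c = grad phi y + ((dot c (N y))^-1 * (1 - dot c (grad phi y))) *: N y.
    move/eqP : Phi0; rewrite subr_eq0 => /eqP Phi0.
    by rewrite -scalerA -Phi0 scalerA mulVf ?gt_eqF// scale1r addrC subrK.
  by [].
by rewrite mulr_gt0// invr_gt0.
Qed.

(** The unit directions at distance at least [e] from [ec x] form a compact set; each is avoided
    locally by [other_direction], and the near-covering form of compactness makes this uniform. *)
Let ecF : ec @ F --> ec x.
Proof.
apply/cvgrPdist_lt => e e0.
pose C := boundary K `&` [set c | e <= `|ec x - c|].
have Cc : compact C.
  apply: compact_closedI; first by apply: boundary_compact; exact: compact_bounded.
  move=> c cl; apply/ler_addgt0Pr => d d0.
  have [c' [/= ec' cc']] := cl _ (near_dist c d0).
  apply: (le_trans ec'); rewrite (_ : ec x - c' = (ec x - c) + (c - c')); last first.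
    by rewrite addrA subrK.
  by rewrite (le_trans (ler_normD _ _))// lerD2l ltW.
move/compact_near_coveringP : Cc => /(_ _ F (fun u c => ec u != c) _) cov.
have /cov far : forall c, C c -> \near c & F, (ec F != c).
  move=> c [/(boundary_gauge Kcompact Kconvex K0) gc ce]; apply: other_direction => //.
  by apply: contraTneq ce => ->; rewrite /= subrr normr0 -ltNge.
apply: filterS2 FU far => u Uu Cu; rewrite ltNge; apply/negP => ue.
suff : C (ec u) by move=> /Cu; rewrite eqxx.
split => //; by apply/(boundary_gauge Kcompact Kconvex K0); exact: ge.
Qed.

Let scF : sc @ F --> (0 : R).
Proof.
have gc : {for (0 : 'rV[R]_n.+1), continuous g} by exact: g_cont.
have k : (fun u => u - zc u) @ F --> (0 : 'rV[R]_n.+1).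
  rewrite -(subrr y); apply: cvgB => //.
  by apply: cvg_within_filter; exact: cvg_id.
by rewrite -[X in _ --> X](gauge0 K0); exact: (cvg_comp _ _ k gc).
Qed.

(** As [U] is open, what holds along [F] also holds on full neighbourhoods of the points of [U]
    close to [y]. *)
Let FI P : F P -> F P°.
Proof.
move=> FP; have : \forall u \near y, \forall v \near u, U v -> P v by exact: nbhs_interior.
apply: filterS => u uP Uu; have := open_nbhs_nbhs (conj Uopen Uu).
by rewrite /interior/=; apply: filterS2 uP => v; exact.
Qed.

Let big_at (V : normedModType R) (f : 'rV[R]_n.+1 -> V) :
  big (filter_prod F F) (fun t => f t.1 - f t.2) (fun t => `|t.1 - t.2|) ->
  exists2 C : R, 0 < C & \forall u \near F, \forall v \near u & w \near u,
    `|f v - f w| <= C * `|v - w|.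
Proof.
move=> [C C0 [[A B] /= [FA FB] AB]]; exists C => //.
have FAB : F (A `&` B) by exact: filterI.
apply: filterS (FI FAB) => u uAB.
exists (A `&` B, A `&` B) => //.
by move=> [v w] [/= [Av _] [_ Bw]]; exact: (AB (v, w)).
Qed.

(* At the boundary the ray length vanishes and L is the identity, so that no
   Lipschitz bound is needed. *)
Lemma hessian_rho_boundary : exists J : 'M[R]_n.+1,
  (\forall u \near F, (\forall v \near u, differentiable r v) /\
     exists J' : 'M[R]_n.+1, sdiff (grad r) (nbhs u) J') /\
  hessian r @ F --> J^T.
Proof.
have [eN l0 _] := mult Ux def.
have [L [P [E [L1 _ _ _ [be [bz eP]]]]]] :=
  ray_sensitivity Kcompact Kconvex K0 Kdef Kker Uopen Ubounded dphi phi_lt phi2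
  (zcU x) def zcP FU zcF ecF scF (ge Ux) (lt0r_neq0 eN) (or_introl erefl).
have LB : L *m 1%:M = 1%:M by rewrite mulmx1 L1.
have se := eP _ LB.
have [Jg sJg] := gauge_sdiff Kcompact Kconvex K0 Kdef (g_neq0 (ge Ux)).
pose proof (sdiff_comp ecF se sJg) as sp.
set J := _ *m Jg in sp.
have [Cp Cp0 bp] := big_at (sdiff_big sp).
have [Cz Cz0 bz'] := big_at bz.
have zcc : \forall u \near F, {for u, continuous zc}.
  apply: filterS bz' => u uz; apply/continuous_eps => e e0.
  have : \forall w \near u, `|zc u - zc w| <= Cz * `|u - w|.
    case: uz => [[A B] /= [uA uB] AB]; apply: filterS uB => w Bw.
    by apply: (AB (u, w)); split => //; exact: nbhs_singleton.
  have := near_dist u (divr_gt0 e0 Cz0); apply: filterS2 => w uw /le_trans; apply.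
  by rewrite mulrC -ler_pdivlMr// ltW.
have dr : \forall u \near F, differentiable r u.
  apply: filterS2 FU zcc => u Uu zu.
  exact: (rho_differentiable Kcompact Kconvex K0 Kdef Uopen Ubounded dphi (zcU x) zcP Uu zu).
have gr : \forall u \near F, p u = grad r u.
  by apply: filterS2 FU dr => u Uu du; rewrite grad_rho.
(* Strict differentiability of [p] along [F] supplies the Lipschitz bound at each nearby interior
   point, where the ray length is positive and the second alternative applies. *)
have s2 : \forall u \near F, exists J', sdiff (grad r) (nbhs u) J'.
  near=> u; have Uu : U u by near: u; exact: FU.
  have du : defining U (zc u) H N by near: u; exact: Fdef.
  have zu : {for u, continuous zc} by near: u; exact: zcc.
  apply: (rho_twice_differentiable Uu zu du).
    by near: u; exact: (FI dr).
  have bu : \forall v \near u & w \near u, `|p v - p w| <= Cp * `|v - w|.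
    by near: u; exact: bp.
  have gu : \forall v \near u, p v = grad r v by near: u; exact: (FI gr).
  have bpu : big (filter_prod (nbhs u) (nbhs u)) (fun t => p t.1 - p t.2)
      (fun t => `|t.1 - t.2|) by exists Cp.
  apply: big_near bpu.
  exists ((fun v => p v = grad r v), (fun v => p v = grad r v)) => //.
  by move=> [v w] [/= -> ->].
exists J; split; first by apply: filterS2 (FI dr) s2 => u.
have sr : sdiff (grad r) F J.
  apply: sdiff_near sp; apply: filterS2 FU dr => u Uu du; by rewrite grad_rho.
(* The strict derivative along [F] forces the Hessians at interior points to converge to it. *)
have cv i : grad (partial i r) @ F --> \row_k J k i.
  apply: (@sgrad_cvg _ _ F _ (partial i r)); [exact: FI| |].
    pose proof (coord_sdiff i sr) as s.
    by apply: sgrad_near s; apply: filterE => u; rewrite mxE.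
  by apply: filterS s2 => u [J']; exact: sdiff_partial.
apply/cvgrPdist_le => e e0.
have : \forall u \near F, forall i, `|\row_k J k i - grad (partial i r) u| <= e.
  apply: filter_forall => i; have /cvgrPdist_le := cv i; exact.
apply: filterS => u ue; apply: norm_le_coord => [|i j]; first exact: ltW.
apply: le_trans (ue i); apply: le_trans (coord_le_norm _ 0 j).
by rewrite !mxE.
Unshelve. all: by end_near. Qed.

End AtBoundary.
End Regularity.

(** * Comparison of Hessians *)

Section QuadForm.
Context {R : realType} {n : nat}.
Implicit Types (A M J : 'M[R]_n) (x u v xi : 'rV[R]_n) (r : 'rV[R]_n -> R).

Lemma quad_formE A xi : quad_form A xi = dot (xi *m A) xi.
Proof.
rewrite /quad_form exchange_big; apply: eq_bigr => j _.
rewrite mxE mulr_suml; apply: eq_bigr => i _; rewrite mulrAC //.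
Qed.

(** With [A i i = 0] the form at [s e_i + u] is affine in [s], of slope [2 (u . u)]; the chosen [s]
    gives it the value -1. *)
Lemma psd_diag0 A i : A^T = A -> (forall xi, 0 <= quad_form A xi) -> A i i = 0 ->
  row i A = 0.
Proof.
move=> As Ap Aii; apply/eqP/negPn/negP => /dot_gt0; set u := row i A => u0.
pose s := - (quad_form A u + 1) / (2 * dot u u).
have := Ap (s *: delta_mx 0 i + u).
have Ai : delta_mx 0 i *m A = u by rewrite -rowE.
have Au : dot (u *m A) (delta_mx 0 i) = dot u u by rewrite dot_mulmx As Ai.
have Aii' : dot (delta_mx 0 i) u = 0 by rewrite dot_delta mxE.
rewrite quad_formE mulmxDl -scalemxAl Ai dotDl !dotDr !dotZl !dotZr Au (dotC u) Aii'.
rewrite -quad_formE /s mulr0 mulr0 add0r.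
have -> : - (quad_form A u + 1) / (2 * dot u u) * dot u u = - (quad_form A u + 1) / 2.
  by field; exact: lt0r_neq0.
lra.
Qed.

(* Symmetric Gaussian elimination: clearing the row and column of a positive
   diagonal entry subtracts a rank one matrix and keeps A semidefinite. *)
Lemma psd_trace A M : A^T = A -> (forall xi, 0 <= quad_form A xi) ->
  (forall xi, 0 <= quad_form M xi) -> 0 <= \tr (A *m M).
Proof.
(* Induction on a bound for the number of nonzero diagonal entries; when none is left, [psd_diag0]
   makes [A] zero. *)
move: {2}#|_| (leqnn #|[set i | A i i != 0]%SET|) => m.
elim: m A => [|m IH] A cA As Ap Mp.
  suff -> : A = 0 by rewrite mul0mx mxtrace0.
  apply/row_matrixP => i; rewrite row0; apply: psd_diag0 => //.
  move: cA; rewrite leqn0 cards_eq0 => /eqP/setP/(_ i); rewrite !inE.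
  by move=> /negbT/negPn/eqP.
have [i Ai|A0] := pickP (fun i => A i i != 0); last first.
  apply: IH => //; rewrite eq_card0// => i; by rewrite inE A0.
have a0 : 0 < A i i.
  rewrite lt_neqAle eq_sym Ai/=; have := Ap (delta_mx 0 i).
  by rewrite quad_formE -rowE dotC dot_delta mxE.
pose u := row i A; pose A' := A - (A i i)^-1 *: (u^T *m u).
have A'E : A = A' + (A i i)^-1 *: (u^T *m u) by rewrite subrK.
have ui j : u 0 j = A i j by rewrite mxE.
have As' j k : A j k = A k j by rewrite -{1}As mxE.
have A'jk j k : A' j k = A j k - (A i i)^-1 * (A i j * A i k).
  by rewrite !mxE big_ord1 !mxE.
have ei : delta_mx 0 i *m A = u by rewrite -rowE.
have tE : \tr (u^T *m u *m M) = dot (u *m M) u.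
  by rewrite -mulmxA mxtrace_mulC dot_mx mxtrace_scalar mulr1n.
rewrite {1}A'E mulmxDl linearD /= -scalemxAl linearZ /= tE -quad_formE.
rewrite addr_ge0//; last by rewrite mulr_ge0 ?invr_ge0 ?(ltW a0)//.
apply: IH => //.
- rewrite -ltnS; apply: leq_trans cA; apply: proper_card; apply/properP; split.
    apply/fintype.subsetP => j; rewrite !inE; apply: contra => /eqP Aj.
    have Aji : A j i = 0 by have /rowP/(_ i) := psd_diag0 As Ap Aj; rewrite !mxE.
    by rewrite A'jk Aj As' Aji !mul0r mulr0 subr0.
  have A'ii : A' i i = 0 by rewrite A'jk mulrA mulVf// mul1r subrr.
  by exists i; rewrite !inE// -/A' A'ii eqxx.
- by apply/matrixP => j k; rewrite mxE !A'jk As' (mulrC (A i k)).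
(* Completing the square: the reduced form at [xi] is the form of [A] at the point of the line
   [xi + R e_i] that minimises it. *)
- move=> xi; have := Ap (xi - ((A i i)^-1 * dot xi u) *: delta_mx 0 i).
  rewrite !quad_formE.
  have -> : xi *m A' = xi *m A - ((A i i)^-1 * dot xi u) *: u.
    by rewrite mulmxBr -scalemxAr mulmx_trr scalerA.
  have xe : dot (xi *m A) (delta_mx 0 i) = dot xi u by rewrite dot_mulmx As ei.
  have ue : dot u (delta_mx 0 i) = A i i by rewrite dotC dot_delta ui.
  rewrite mulmxBl -scalemxAl ei !dotBl !dotBr !dotZl !dotZr xe ue (dotC u xi).
  congr (0 <= _); field; exact: lt0r_neq0.
Qed.

Lemma quad_form_cvg {T : Type} (F : set_system T) {FF : Filter F} (A : T -> 'M[R]_n) B xi :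
  A @ F --> B -> (fun t => quad_form (A t) xi) @ F --> quad_form B xi.
Proof.
move=> AB; apply/cvgrPdist_le => e e0.
pose C := n%:R * (n%:R * `|xi|) * `|xi| + 1.
have C0 : 0 < C by rewrite ltr_wpDl// !mulr_ge0.
move/cvgrPdist_le : AB => /(_ _ (divr_gt0 e0 C0)); apply: filterS => t At.
rewrite !quad_formE -dotBl -mulmxBr (le_trans (norm_dot _ _))//.
apply: (@le_trans _ _ (C * `|B - A t|)).
  apply: (@le_trans _ _ (n%:R * (n%:R * `|B - A t| * `|xi|) * `|xi|)).
    by rewrite ler_wpM2r// ler_wpM2l// norm_mulmx.
  by rewrite /C mulrDl mul1r -subr_ge0 (_ : _ - _ = `|B - A t|)//; ring.
by rewrite mulrC -ler_pdivlMr.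
Qed.

(** The difference [f u = r (x' + u) - r (x + u)] is minimal at 0, so the gradients agree. The mean
    value theorem turns [f (t xi) >= f 0] into an inequality between gradients at [s t xi], which
    the strict derivatives linearise; no second-order Taylor formula is involved. *)
Lemma quad_hess_le r x x' J J' xi :
  (\forall u \near x, differentiable r u) -> (\forall u \near x', differentiable r u) ->
  sdiff (grad r) (nbhs x) J -> sdiff (grad r) (nbhs x') J' ->
  (forall h, r (x + h) - r x <= r (x' + h) - r x') ->
  quad_form J^T xi <= quad_form J'^T xi.
Proof.
move=> dx dx' sJ sJ' incr.
have gE : grad r x = grad r x'.
  apply: dot_inj => v; apply/ler_addgt0Pr => e e0; rewrite -lerBlDr.
  apply: dir_ge; first exact: nbhs_singleton dx'.
  have [t0 t00 h] := dir_est v (nbhs_singleton dx) e0.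
  exists t0 => // t tt; have := h t tt; rewrite ler_norml => /andP[+ _].
  have := incr (t *: v); rewrite mulrBr; lra.
pose f u := r (x' + u) - r (x + u).
have df u : differentiable r (x + u) -> differentiable r (x' + u) ->
    differentiable f u /\ grad f u = grad r (x' + u) - grad r (x + u).
  move=> d1 d2.
  have [fu fE] : differentiable f u /\
      'd f u = dotr (grad r (x' + u) - grad r (x + u)) :> ('rV[R]_n -> R).
    apply: differentiable_dot => e e0; have e20 : 0 < e / 2 by rewrite divr_gt0.
    apply: filterS2 (differentiable_dotP d1 e20) (differentiable_dotP d2 e20) => h.
    rewrite /f [x' + (h + u)]addrCA [x + (h + u)]addrCA dotBr !ler_norml.
    move=> /andP[h1 h2] /andP[h3 h4]; apply/andP; split; lra.
  split=> //; apply: dot_inj => v.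
  by rewrite -diff_grad// fE.
rewrite !quad_formE !dot_mulmx !trmxK.
apply/ler_addgt0Pr => e e0.
have C0 : 0 < n%:R * `|xi| * `|xi| + 1 by rewrite ltr_wpDl// !mulr_ge0.
pose e' := e / 2 / (n%:R * `|xi| * `|xi| + 1); have e'0 : 0 < e' by rewrite !divr_gt0.
have oneP (z : 'rV[R]_n) (Jz : 'M[R]_n) : sdiff (grad r) (nbhs z) Jz ->
    \forall u \near z, `|grad r u - grad r z - (u - z) *m Jz| <= e' * `|u - z|.
  move=> /(_ _ e'0)[[A B] /= [zA zB] AB]; apply: filterS zA => u Au.
  by apply: (AB (u, z)); split => //; exact: nbhs_singleton.
have P1 : \forall u \near x, differentiable r u /\
    `|grad r u - grad r x - (u - x) *m J| <= e' * `|u - x|.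
  by apply: filterI => //; exact: oneP.
have P2 : \forall u \near x', differentiable r u /\
    `|grad r u - grad r x' - (u - x') *m J'| <= e' * `|u - x'|.
  by apply: filterI => //; exact: oneP.
move: P1 P2 => /nbhs_ballP[a /= a0 ha] /nbhs_ballP[b /= b0 hb].
have xi1 : 0 < `|xi| + 1 by rewrite ltr_wpDl.
have m0 : 0 < Num.min a b by rewrite lt_min a0.
have [t t0 tE] : exists2 t : R, 0 < t & t * (`|xi| + 1) < Num.min a b.
  exists (Num.min a b / (`|xi| + 1) / 2); first by rewrite !divr_gt0.
  by rewrite mulrAC divfK ?gt_eqF// ltr_pdivrMr// ltr_pMr// ltr1n.
have tab s : 0 <= s <= 1 -> `|s *: (t *: xi)| < Num.min a b.
  move=> /andP[s0 s1]; rewrite !normrZ (ger0_norm s0) (gtr0_norm t0).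
  apply: (@le_lt_trans _ _ (t * (`|xi| + 1))).
    apply: (@le_trans _ _ (1 * (t * `|xi|))).
      by rewrite ler_wpM2r// mulr_ge0// ltW.
    by rewrite mul1r ler_pM2l// lerDl.
  exact: tE.
have bx z c s : Num.min a b <= c -> 0 <= s <= 1 -> ball z c (z + s *: (t *: xi)).
  move=> mc s01; rewrite -ball_normE /= opprD addrA subrr add0r normrN.
  by apply: lt_le_trans mc; exact: tab.
have ma : Num.min a b <= a by rewrite ge_min lexx.
have mb : Num.min a b <= b by rewrite ge_min lexx orbT.
have [s s01|s s01] := @mean_value R n f 0 (t *: xi).
  rewrite add0r; have [] // := df (s *: (t *: xi)).
  - by have [] := ha _ (bx x a s ma s01).
  - by have [] := hb _ (bx x' b s mb s01).
rewrite !add0r => fE.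
have s01' : 0 <= s <= 1 by case/andP: s01 => ? ?; rewrite !ltW.
have [d1 n1] := ha _ (bx x a s ma s01').
have [d2 n2] := hb _ (bx x' b s mb s01').
have [_ gf] := df _ d1 d2; rewrite gf in fE.
have f0 : 0 <= f (t *: xi) - f 0.
  by have := incr (t *: xi); rewrite /f !addr0; lra.
have {}f0 : 0 <= dot xi (grad r (x' + s *: (t *: xi)) - grad r (x + s *: (t *: xi))).
  by move: f0; rewrite fE dotZl pmulr_rge0.
have st0 : 0 < s * t by case/andP: s01 => s0 _; rewrite mulr_gt0.
have xE (z : 'rV[R]_n) : z + s *: (t *: xi) - z = (s * t) *: xi.
  by rewrite addrAC subrr add0r scalerA.
rewrite !xE normrZ (gtr0_norm st0) -!scalemxAl in n1 n2.
have est (w : 'rV[R]_n) : `|w| <= e' * (s * t * `|xi|) -> `|dot xi w| <= s * t * (e / 2).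
  move=> wle; apply: le_trans (norm_dot _ _) _.
  apply: (@le_trans _ _ (n%:R * `|xi| * (e' * (s * t * `|xi|)))).
    by rewrite ler_wpM2l// mulr_ge0.
  have -> : n%:R * `|xi| * (e' * (s * t * `|xi|)) = s * t * (e' * (n%:R * `|xi| * `|xi|)) by ring.
  rewrite ler_pM2l//; apply: (@le_trans _ _ (e' * (n%:R * `|xi| * `|xi| + 1))).
    by rewrite ler_pM2l// lerDl.
  by rewrite /e' divfK// gt_eqF.
have := est _ n1; have := est _ n2; rewrite !dotBr !dotZr gE.
move: f0; rewrite dotBr !ler_norml => f0 /andP[k1 k2] /andP[k3 k4].
rewrite -(ler_pM2l st0) mulrDr.
move: f0 k1 k2 k3 k4.
move: (dot xi (grad r (x' + _))) (dot xi (grad r (x + _))) (dot xi (grad r x')).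
move: (dot xi (xi *m J)) (dot xi (xi *m J')) => j j' c1 c2 c3; lra.
Qed.

End QuadForm.

Theorem lemma4 (R : realType) (n k : nat) (alpha : R)
  (K U : set 'rV[R]_n.+1) (phi : 'rV[R]_n.+1 -> R)
  (x y : 'rV[R]_n.+1) (A : 'M[R]_n.+1)
  (hk : (2 <= k)%N)
  (halpha : 0 <= alpha <= 1)
  (hKcompact : compact K)
  (hKconvex : convex_set (K : set (convex_lmodType 'rV[R]_n.+1)))
  (hK0 : interior K 0)
  (hKsmooth : class_C_boundary k alpha K)
  (hKcurv : forall z c, boundary K z -> principal_curvature K z c -> 0 < c)
  (hUopen : open U)
  (hUbounded : bounded_set U)
  (hUsmooth : class_C_boundary k alpha U)
  (hphi : class_C k alpha setT phi)
  (hDphi : forall z, gauge (polar K) (grad phi z) < 1)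
  (hx : (U `\` rho_ridge K U phi) x)
  (hy : unique (rho_closest K U phi x) y)
  (hAsym : A^T = A)
  (hApsd : forall xi : 'rV[R]_n.+1, 0 <= quad_form A xi) :
  \tr (A *m hessian (rho K U phi) x)
    <= \tr (A *m hessian_closure U (rho K U phi) y) /\
  (forall xi : 'rV[R]_n.+1,
    quad_form (hessian (rho K U phi) x) xi
      <= quad_form (hessian_closure U (rho K U phi) y) xi).
Proof.
have Kdef z : boundary K z -> exists H N, defining K z H N.
  exact: (class_C_boundary_defining hk hKsmooth).
have Kker e J v := @hess_gauge_ker _ _ K hKcompact hKconvex hK0 Kdef hKcurv e J v.
have dphi z : differentiable phi z.
  by have [] := class_C2P hk hphi (I : setT z).
have phi2 (z : 'rV[R]_n.+1) : exists J, sdiff (grad phi) (nbhs z) J.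
  by have [_ s] := class_C2_strict hk openT hphi (I : setT z); eexists; exact: s.
have [Ux nridge] := hx; have [xy yuniq] := hy; have [yU rxy] := xy.
have [V [[Vo Vx] [dr dpr]]] : exists V, open_nbhs x V /\ class_C 1 1 V (rho K U phi).
  by apply: contrapT => h; apply: nridge.
have [zc zcP] := choice (exists_closest hKconvex hK0 hUbounded dphi yU).
have zx : zc x = y by apply/esym/yuniq.
have Vn : nbhs x V by exact: open_nbhs_nbhs.
have drn : \forall u \near x, differentiable (rho K U phi) u.
  by apply: filterS Vn.
(* Uniqueness of the closest point at [x] makes any selection [zc] continuous there, even if nearby
   points have several closest points. *)
have zcx : {for x, continuous zc}.
  apply/continuous_eps => e e0; rewrite zx.
  have uniq c : boundary U c -> gauge K (x - c) + phi c <= gauge K (x - y) + phi y -> c = y.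
    move=> cU le; apply/esym/yuniq; split=> //; apply/eqP; rewrite eq_le rxy le andbT -rxy.
    exact: (rho_le hKconvex hK0 hUbounded dphi yU x cU).
  have := closest_cvg hKconvex hK0 hUbounded dphi yU zcP yU uniq e0.
  by apply: filterS => u /ltW.
have [H [N def]] := class_C_boundary_defining hk hUsmooth yU.
have defx : defining U (zc x) H N by rewrite zx.
have Lip : big (filter_prod (nbhs x) (nbhs x))
    (fun t => grad (rho K U phi) t.1 - grad (rho K U phi) t.2) (fun t => `|t.1 - t.2|).
  have /choice[C hC] : forall i, exists C, \forall u & v \near x,
      `|partial i (rho K U phi) u - partial i (rho K U phi) v| <= C * `|u - v| `^ 1.
    by move=> i; have [_] := dpr i; exact.
  (* One positive constant for all partial derivatives; the individual constants may be negative. *)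
  exists (\sum_i `|C i| + 1); first by rewrite ltr_wpDl// sumr_ge0.
  have : \forall t \near filter_prod (nbhs x) (nbhs x), forall i,
      `|partial i (rho K U phi) t.1 - partial i (rho K U phi) t.2| <= C i * `|t.1 - t.2| `^ 1.
    by apply: filter_forall => i; exact: hC.
  apply: filterS => t ht; apply: norm_le_coord => [|i j].
    by rewrite mulr_ge0// addr_ge0// sumr_ge0.
  rewrite !mxE (le_trans (ht j))// powRr1// ler_wpM2r// (bigD1 j)//=.
  rewrite (le_trans (ler_norm _))// -addrA lerDl addr_ge0// sumr_ge0//.
have [J sJ] := rho_twice_differentiable hKcompact hKconvex hK0 Kdef Kker hUopen hUbounded
  dphi hDphi phi2 zcP Ux zcx defx drn Lip.
have [Jb [near2 cvb]] := hessian_rho_boundary hKcompact hKconvex hK0 Kdef Kker hUopen hUbounded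
  dphi hDphi phi2 zcP Ux defx.
rewrite zx in near2 cvb.
have PF : ProperFilter (within U (nbhs y)) by apply: within_nbhs_proper; have [] := yU.
have closureE : hessian_closure U (rho K U phi) y = Jb^T.
  by apply: cvg_lim => //; exact: norm_hausdorff.
(* If the inequality failed at [y], convergence of the Hessians would make it fail at points of [U]
   near [y], in particular at a point of the ray, against [rho_increment]. *)
have quad_le xi : quad_form J^T xi <= quad_form Jb^T xi.
  rewrite leNgt; apply/negP => lt.
  pose proof (quad_form_cvg (xi := xi) cvb) as cq; have /cvgr_lt/(_ _ lt) lt' := cq.
  have [d /= d0 hd] : exists2 d : R, 0 < d & forall u, ball y d u -> U u ->
      quad_form (hessian (rho K U phi) u) xi < quad_form J^T xi /\
      ((\forall v \near u, differentiable (rho K U phi) v) /\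
       exists J' : 'M[R]_n.+1, sdiff (grad (rho K U phi)) (nbhs u) J').
    have both := @filterI _ (within U (nbhs y)) _ _ _ lt' near2.
    have {both}/nbhs_ballP[d /= d0 hd] : nbhs y [set u | U u ->
        quad_form (hessian (rho K U phi) u) xi < quad_form J^T xi /\
        ((\forall v \near u, differentiable (rho K U phi) v) /\
         exists J' : 'M[R]_n.+1, sdiff (grad (rho K U phi)) (nbhs u) J')] by exact: both.
    by exists d.
  have nx : 0 < `|x - y| + 1 by rewrite ltr_wpDl.
  pose t := Num.min 1 (d / (`|x - y| + 1) / 2).
  have t0 : 0 < t by rewrite lt_min ltr01 !divr_gt0.
  have t1 : t <= 1 by rewrite ge_min lexx.
  have t01 : 0 <= t <= 1 by rewrite ltW.
  have td : t <= d / (`|x - y| + 1) / 2 by rewrite ge_min lexx orbT.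
  have [||lt2 [dr2 [J' sJ']]] := hd (y + t *: (x - y)).
  - rewrite -ball_normE /= opprD addrA subrr add0r normrN normrZ gtr0_norm//.
    apply: (@le_lt_trans _ _ (t * (`|x - y| + 1))); first by rewrite ler_pM2l// lerDl.
    rewrite -ltr_pdivlMr//; apply: le_lt_trans td _.
    by rewrite ltr_pdivrMr// ltr_pMr ?divr_gt0// ltr1n.
  - apply: (closest_segment_in hKcompact hKconvex hK0 hUopen hUbounded dphi hDphi yU Ux xy).
    by rewrite t0.
  have := quad_hess_le xi drn dr2 sJ sJ'
    (fun h => rho_increment hKconvex hK0 hUbounded dphi yU h xy t01).
  by rewrite -(sdiff_hessian sJ') leNgt lt2.
(* The comparison of quadratic forms is the second claim; the first is the trace inequality for the
   semidefinite difference of the Hessians. *)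
rewrite closureE (sdiff_hessian sJ); split => //.
rewrite -subr_ge0 -linearB /= -mulmxBr; apply: psd_trace => // xi.
rewrite quad_formE mulmxBr dotBl -!quad_formE subr_ge0; exact: quad_le.
Qed.
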